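(* Let $L>0$, let $a$ satisfy (H_a), $g\in L^2(0,L)$, and let $\phi$ satisfy (H_φ), $\phi(0)=+\infty$, (H_int), (H_bdd), and be non-increasing on $[0,+\infty)$ (i.e. $\phi(s)\ge\phi(t)$ whenever $0\le s\le t$). Assume that for every $\eta\in(0,L)$ there is $M_\eta>0$ with $g(x)\ge -M_\eta$ for a.e. $x\in[0,L-\eta]$. Assume that problem (P) has at least one weak solution. Then there exist a number $$c^*\le \frac{1}{\sqrt L}\Big(\frac{\beta}{\alpha}+1\Big)\|g\|_{L^2(0,L)}-\inf_{s\in\mathbb{R}}\phi(s)$$ and a map $U:(-\infty,c^*]\to H^1_0(0,L)$, continuous for the weak topology of $H^1_0(0,L)$, such that: for every $c\le c^*$, $U(c)$ is a weak solution of (P) satisfying $a\,\frac{dU(c)}{dx}=\phi(U(c))+g+c$ in $\mathcal D'(0,L)$; $U(c)\ge0$; if $c_1<c_2\le c^*$ then $U(c_1)(x)<U(c_2)(x)$ for every $x\in(0,L)$; $U(c)\to0$ weakly in $H^1_0(0,L)$ and uniformly on $[0,L]$ as $c\to-\infty$; and every weak solution $u$ of (P) equals $U(c)$ for some $c\in(-\infty,c^*]$.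
   Context: (H_a): $a\in L^\infty(0,L)$ and there are constants $0<\alpha<\beta$ with $\alpha\le a(x)\le\beta$ for a.e. $x\in(0,L)$. (H_φ): $\phi:\mathbb{R}\to\mathbb{R}\cup\{+\infty\}$ is continuous when $\mathbb{R}\cup\{+\infty\}$ carries its usual topology, and $\phi(s)<+\infty$ for every $s\neq0$. (H_int): $\int_0^\delta\phi(t)\,dt<+\infty$ and $\int_{-\delta}^0\phi(t)\,dt<+\infty$ for every $\delta\in(0,1)$ (i.e. $\phi$ is integrable near $0$). (H_bdd): for every $\delta>0$, $\phi$ is bounded (and continuous) on $\mathbb{R}\setminus(-\delta,\delta)$. A weak solution of problem (P) with data $(a,g,\phi)$ is a function $u$ with $u\in H^1_0(0,L)$, $\phi(u)\in L^2(0,L)$, and $-\frac{d}{dx}(a\frac{du}{dx})=-\frac{d\phi(u)}{dx}-\frac{dg}{dx}$ in $\mathcal D'(0,L)$. *)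

(* Defs.v *)
From HB Require Import structures.
From mathcomp Require Import all_boot all_order all_algebra.
From mathcomp Require Import all_classical all_reals all_analysis.
From mathcomp Require Import measurable_realfun.
Set Implicit Arguments. Unset Strict Implicit. Unset Printing Implicit Defensive.
Import Order.TTheory GRing.Theory Num.Theory.
Import numFieldNormedType.Exports.
Local Open Scope classical_set_scope.
Local Open Scope ring_scope.

Section Defs.
Variable R : realType.
Local Notation mu := (@lebesgue_measure R).

Definition test_fun (L : R) (psi : R -> R) : Prop :=
  (forall (n : nat) (x : R), derivable (derive1n n psi) x 1) /\
  exists eps : R, 0 < eps /\
    forall x : R, x < eps \/ L - eps < x -> psi x = 0.

Definition L2 (L : R) (f : R -> R) : Prop :=
  measurable_fun `[0%R, L] f /\
  (\int[mu]_(x in `[0%R, L]) ((f x) ^+ 2)%:E < +oo)%E.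

Definition L2norm (L : R) (f : R -> R) : R :=
  Num.sqrt (fine (\int[mu]_(x in `[0%R, L]) ((f x) ^+ 2)%:E)).

Definition weak_deriv (L : R) (u w : R -> R) : Prop :=
  L2 L w /\
  forall psi, test_fun L psi ->
    (\int[mu]_(x in `[0%R, L]) (u x * derive1 psi x)%:E =
     - \int[mu]_(x in `[0%R, L]) (w x * psi x)%:E)%E.

(* H^1_0(0,L), elements represented by their continuous representative *)
Definition H10 (L : R) (u : R -> R) : Prop :=
  {within `[0%R, L], continuous u} /\ u 0 = 0 /\ u L = 0 /\
  L2 L u /\ exists w, weak_deriv L u w.

Definition H1inner (L : R) (u du v dv : R -> R) : R :=
  fine (\int[mu]_(x in `[0%R, L]) (u x * v x + du x * dv x)%:E).

Definition phi_L2 (L : R) (phi : R -> \bar R) (u : R -> R) : Prop :=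
  measurable_fun `[0%R, L] (fun x => phi (u x)) /\
  (\int[mu]_(x in `[0%R, L]) (phi (u x) * phi (u x)) < +oo)%E.

(* weak solution of (P):  -(a u')' = -(phi(u))' - g'  in D'(0,L) *)
Definition weak_sol (L : R) (a g : R -> R) (phi : R -> \bar R) (u : R -> R)
  : Prop :=
  H10 L u /\ phi_L2 L phi u /\
  exists w, weak_deriv L u w /\
    forall psi, test_fun L psi ->
      (\int[mu]_(x in `[0%R, L]) (a x * w x * derive1 psi x)%:E =
       \int[mu]_(x in `[0%R, L]) ((fine (phi (u x)) + g x) * derive1 psi x)%:E)%E.

Definition H_a (L alpha beta : R) (a : R -> R) : Prop :=
  0 < alpha /\ alpha < beta /\ measurable_fun `[0%R, L] a /\
  {ae mu, forall x, x \in `[0%R, L] -> alpha <= a x <= beta}.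

Definition H_phi (phi : R -> \bar R) : Prop :=
  continuous phi /\ (forall s, phi s != -oo%E) /\
  (forall s, s != 0 -> (phi s < +oo)%E).

Definition H_int (phi : R -> \bar R) : Prop :=
  forall delta : R, 0 < delta < 1 ->
    (\int[mu]_(t in `[0%R, delta]) phi t < +oo)%E /\
    (\int[mu]_(t in `[(- delta)%R, 0%R]) phi t < +oo)%E.

Definition H_bdd (phi : R -> \bar R) : Prop :=
  forall delta : R, 0 < delta ->
    exists M : R, forall s, delta <= `|s| -> (`|phi s| <= M%:E)%E.

End Defs.

(* Main.v *)
Require Import Defs.
From HB Require Import structures.
From mathcomp Require Import all_boot all_order all_algebra.
From mathcomp Require Import all_classical all_reals all_analysis.
From mathcomp Require Import measurable_realfun.
From mathcomp Require Import lra ring.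
Set Implicit Arguments. Unset Strict Implicit. Unset Printing Implicit Defensive.
Import Order.TTheory GRing.Theory Num.Theory.
Import numFieldNormedType.Exports.
Local Open Scope classical_set_scope.
Local Open Scope ring_scope.

(** In one dimension a weak solution satisfies [a u' = phi(u) + g + c] a.e. for
    some constant [c] (du Bois-Reymond). As [phi = +oo] at [0] and [g] is bounded
    below away from [L], such a [u] is positive in the interior, and since [phi] is
    nonincreasing on positive numbers the Cauchy problem with [u(0) = 0] is monotone:
    comparison holds, [u] is determined by [c], and it is increasing and Lipschitz
    in [c].

    For existence, [phi] is replaced by Lipschitz regularizations [phi_n] that
    increase to it, and [u_{n,c}] is given by Picard iteration. Say that [c] is
    admissible when [u_{n,c}(L) <= 0] for all [n]. The admissible constants form a
    closed interval unbounded on the left, bounded above because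
    [0 = int u' = int (phi(u) + g + c) / a], and every constant of a weak solution
    is admissible by comparison. For admissible [c], testing the equation with [u']
    gives [|u_{n,c}'|_2 <= |g|_2 / alpha] for large [n], uniformly in [c], and
    [u_{n,c}] increases to a solution that vanishes at [L]: being nonnegative, it
    cannot end below [0].

    The same bound, combined with uniform convergence of the primitives, yields the
    weak continuity and the weak limit at [-oo]. *)

(** Weak solutions are handled through the integral equation [u(x) = int_0^x b (f(u) + g + c)] with
    [b = 1/a], because [a] and [g] are only measurable. Every sign argument reduces to one
    principle: a primitive that starts nonpositive and does not increase while it is small and
    positive stays nonpositive.

    The Cauchy problem starts exactly at the singularity of [phi], so a regularization must keep
    three things at once: it is nonincreasing, which comparison needs; it stays below [phi] on
    positive numbers, so that true solutions are upper bounds; it grows with [n], so that limits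
    exist. An infimal convolution does all three and is Lipschitz on the whole line, so [u_{n,c}]
    exists even where it is negative.

    Near [L] it may well be negative, since [g] has no lower bound there. Hence positivity comes
    from a linear barrier on [[0, L - eta]], uniform in large [n], and the value at [L] is settled
    only in the limit. The sign condition at [L] that defines admissibility is the one that gives
    the boundary term of the energy identity the right sign, so that neither [phi] nor [c] enters
    the bound. *)

(** * Real-valued integrals over compact intervals *)

Section IntervalIntegral.
Variable R : realType.
Local Notation mu := (@lebesgue_measure R).
Implicit Types (w f g h : R -> R) (x y z a b d e k : R).

Definition itg w x y : R := \int[mu]_(t in `[x, y]) w t.
Definition L1 x y w : Prop := mu.-integrable `[x, y] (EFin \o w).
Definition meas x y w : Prop := measurable_fun `[x, y] w.

Lemma L1S a b x y w : L1 a b w -> a <= x -> y <= b -> L1 x y w.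
Proof.
move=> h ax yb; apply: integrableS h => //.
by apply: subset_itv; rewrite bnd_simp.
Qed.

Lemma measS a b x y w : meas a b w -> a <= x -> y <= b -> meas x y w.
Proof.
move=> h ax yb; apply: measurable_funS h => //.
by apply: subset_itv; rewrite bnd_simp.
Qed.

Lemma meas_norm x y w : meas x y w -> meas x y (fun t => `|w t|).
Proof. by move=> h; apply: measurableT_comp => //; exact: h. Qed.

Lemma meas_max x y w w' : meas x y w -> meas x y w' ->
  meas x y (fun t => Num.max (w t) (w' t)).
Proof. exact: measurable_maxr. Qed.

Lemma meas_min x y w w' : meas x y w -> meas x y w' ->
  meas x y (fun t => Num.min (w t) (w' t)).
Proof. exact: measurable_minr. Qed.

Lemma measD x y w w' : meas x y w -> meas x y w' ->
  meas x y (fun t => w t + w' t).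
Proof. exact: measurable_funD. Qed.

Lemma measM x y w w' : meas x y w -> meas x y w' ->
  meas x y (fun t => w t * w' t).
Proof. exact: measurable_funM. Qed.

Lemma meas_cst x y k : meas x y (fun=> k).
Proof. exact: measurable_cst. Qed.

Lemma meas_comp x y (F : R -> R) w : continuous F -> meas x y w ->
  meas x y (fun t => F (w t)).
Proof.
move=> cF mw; apply: (measurableT_comp (f := F)) => //.
exact: continuous_measurable_fun.
Qed.

Lemma meas_cont x y w : {within `[x, y], continuous w} -> meas x y w.
Proof. by move=> h; exact: subspace_continuous_measurable_fun. Qed.

Lemma L1_meas x y w : L1 x y w -> meas x y w.
Proof. by move=> /measurable_int /measurable_EFinP. Qed.

Lemma itgE x y w : L1 x y w -> ((itg w x y)%:E = \int[mu]_(t in `[x, y]) (w t)%:E)%E.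
Proof. by move=> h; rewrite /itg /Rintegral fineK//; exact: integrable_fin_num. Qed.

Lemma L1D x y w w' : L1 x y w -> L1 x y w' -> L1 x y (fun t => w t + w' t).
Proof. by move=> h h'; exact: (integrableD _ h h'). Qed.

Lemma L1Z x y k w : L1 x y w -> L1 x y (fun t => k * w t).
Proof. by move=> h; exact: (integrableZl _ k h). Qed.

Lemma L1N x y w : L1 x y w -> L1 x y (fun t => - w t).
Proof. by move=> h; exact: (integrableN h). Qed.

Lemma L1B x y w w' : L1 x y w -> L1 x y w' -> L1 x y (fun t => w t - w' t).
Proof. by move=> h /L1N; exact: L1D. Qed.

Lemma L1_norm x y w : L1 x y w -> L1 x y (fun t => `|w t|).
Proof. by move=> h; exact: integrable_norm. Qed.

Lemma L1_cst x y k : L1 x y (fun=> k).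
Proof.
apply: measurable_bounded_integrable => //=.
- by rewrite lebesgue_measure_itv /=; case: ifP => _; rewrite ltry.
- by exists `|k|; split; rewrite ?num_real// => M kM t _ /=; exact: ltW.
Qed.

Lemma L1_le x y w g : meas x y w -> (forall t, x <= t <= y -> `|w t| <= g t) ->
  L1 x y g -> L1 x y w.
Proof.
move=> mw wg; apply: le_integrable => //; first exact/measurable_EFinP.
move=> t /=; rewrite in_itv/= => xy; rewrite lee_fin.
by rewrite (le_trans (wg _ xy))// ler_norm.
Qed.

Lemma L1_bounded x y w k : meas x y w -> (forall t, x <= t <= y -> `|w t| <= k) ->
  L1 x y w.
Proof. by move=> mw wk; apply: (L1_le mw wk); exact: L1_cst. Qed.

Lemma itgD x y w w' : L1 x y w -> L1 x y w' ->
  itg (fun t => w t + w' t) x y = itg w x y + itg w' x y.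
Proof. by move=> h h'; rewrite /itg RintegralD. Qed.

Lemma itgB x y w w' : L1 x y w -> L1 x y w' ->
  itg (fun t => w t - w' t) x y = itg w x y - itg w' x y.
Proof. by move=> h h'; rewrite /itg RintegralB. Qed.

Lemma itgZ x y k w : L1 x y w -> itg (fun t => k * w t) x y = k * itg w x y.
Proof. by move=> h; rewrite /itg RintegralZl. Qed.

Lemma itgN x y w : L1 x y w -> itg (fun t => - w t) x y = - itg w x y.
Proof.
move=> h; rewrite -mulN1r -itgZ//; congr (itg _ x y).
by apply/funext => t; rewrite mulN1r.
Qed.

Lemma itg_cst x y k : x <= y -> itg (fun=> k) x y = k * (y - x).
Proof.
move=> xy; rewrite /itg Rintegral_cst//; congr (_ * _).
have := @lebesgue_measure_itv R `[x, y] => /= ->.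
move: xy; rewrite le_eqVlt => /predU1P[->|xy]; first by rewrite ltxx subrr.
by rewrite lte_fin xy.
Qed.

Lemma eq_itg x y w w' : (forall t, x <= t <= y -> w t = w' t) ->
  itg w x y = itg w' x y.
Proof.
by move=> e; apply: eq_Rintegral => t; rewrite inE/= in_itv/=; exact: e.
Qed.

Lemma itg_xx x w : itg w x x = 0.
Proof. by rewrite /itg set_itv1 Rintegral_set1. Qed.

Lemma itg_cat x y z w : L1 x z w -> x <= y -> y <= z ->
  itg w x z = itg w x y + itg w y z.
Proof.
move=> h xy yz; apply/eqP; rewrite addrC -subr_eq; apply/eqP.
rewrite /itg (Rintegral_itvB h) ?bnd_simp//.
apply: Rintegral_itv_obnd_cbnd; apply: integrableS h => //.
by apply: subset_itv; rewrite bnd_simp.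
Qed.

Lemma itg_norm x y w : L1 x y w -> `|itg w x y| <= itg (fun t => `|w t|) x y.
Proof. by move=> h; exact: le_normr_Rintegral. Qed.

Lemma ae_imply (P Q : R -> Prop) : {ae mu, forall t, P t} ->
  (forall t, P t -> Q t) -> {ae mu, forall t, Q t}.
Proof.
move=> H PQ.
have F := ae_filter_ringOfSetsType (mu : {measure set _ -> \bar R}).
exact: filterS PQ H.
Qed.

Lemma ae_and (P Q : R -> Prop) : {ae mu, forall t, P t} ->
  {ae mu, forall t, Q t} -> {ae mu, forall t, P t /\ Q t}.
Proof.
move=> p q.
have F := ae_filter_ringOfSetsType (mu : {measure set _ -> \bar R}).
exact: filterI p q.
Qed.

Lemma ae_all (P : R -> Prop) : (forall t, P t) -> {ae mu, forall t, P t}.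
Proof.
move=> p; have F := ae_filter_ringOfSetsType (mu : {measure set _ -> \bar R}).
exact: nearW.
Qed.

Lemma ae_neq x : {ae mu, forall t, t != x}.
Proof.
exists [set x]; split => //; first exact: lebesgue_measure_set1.
by move=> t /= /negP; rewrite negbK => /eqP.
Qed.

Lemma ae_closed x y (P : R -> Prop) : {ae mu, forall t, x < t < y -> P t} ->
  {ae mu, forall t, x <= t <= y -> P t}.
Proof.
move=> h; apply: (ae_imply (ae_and h (ae_and (ae_neq x) (ae_neq y)))).
move=> t [H [tx ty]] /andP[xt ty']; apply: H.
by rewrite !lt_neqAle xt ty' eq_sym tx ty.
Qed.

Lemma itg_le x y w w' : L1 x y w -> L1 x y w' ->
  {ae mu, forall t, x < t < y -> w t <= w' t} -> itg w x y <= itg w' x y.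
Proof.
move=> h h' /ae_closed le; rewrite -subr_ge0 -itgB//.
have hB := L1B h' h.
(* The difference agrees a.e. with its absolute value, which is nonnegative at every point. *)
rewrite [leRHS](_ : _ = itg (fun t => `|w' t - w t|) x y); last first.
  rewrite /itg /Rintegral; congr fine; apply: ae_eq_integral => //.
  - by case/integrableP : hB.
  - by case/integrableP : (L1_norm hB).
  - apply: (ae_imply le) => t /= H; rewrite in_itv/= => xy.
    by rewrite ger0_norm// subr_ge0 H.
by apply: Rintegral_ge0 => t _.
Qed.

Lemma itg_ge0 x y w : L1 x y w -> {ae mu, forall t, x < t < y -> 0 <= w t} ->
  0 <= itg w x y.
Proof.
move=> h le; have := itg_le (L1_cst x y 0) h le; apply: le_trans.
have [xy|yx] := leP x y; first by rewrite itg_cst// mul0r.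
by rewrite /itg set_itv_ge ?Rintegral_set0// bnd_simp -ltNge.
Qed.

Lemma eq_itg_ae x y w w' : L1 x y w -> L1 x y w' ->
  {ae mu, forall t, x < t < y -> w t = w' t} -> itg w x y = itg w' x y.
Proof.
move=> h h' e; apply: le_anti; rewrite !itg_le//.
  by apply: (ae_imply e) => t + xy => /(_ xy) ->.
by apply: (ae_imply e) => t + xy => /(_ xy) ->.
Qed.

Lemma itg_le_itv a b x y w : L1 a b w -> (forall t, 0 <= w t) ->
  a <= x -> x <= y -> y <= b -> itg w x y <= itg w a b.
Proof.
move=> h w0 ax xy yb.
rewrite (itg_cat h ax (le_trans xy yb)) (itg_cat (L1S h ax (lexx _)) xy yb).
have p u v : 0 <= itg w u v by apply: Rintegral_ge0.
by rewrite addrCA lerDl addr_ge0.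
Qed.

(** Absolute continuity of the integral, read on subintervals; it is what makes primitives
    continuous. *)
Lemma itg_ac a b w : L1 a b w -> forall e, 0 < e -> exists d, 0 < d /\
  forall x y, a <= x -> x <= y -> y <= b -> y - x < d ->
    itg (fun t => `|w t|) x y < e.
Proof.
move=> h e e0.
have h' : mu.-integrable setT (EFin \o (w \_ `[a, b])).
  by rewrite -restrict_EFin; apply/(integrable_mkcond _ _).1.
have [d [d0 H]] := integral_normr_continuous h' e0.
exists d; split => // x y ax xy yb yxd.
have : itg (fun t => `|(w \_ `[a, b]) t|) x y < e.
  apply: H => //.
  have := @lebesgue_measure_itv R `[x, y] => /= ->.
  by case: ifP => _; rewrite ?lte_fin.
apply: le_lt_trans; rewrite le_eqVlt; apply/orP; left; apply/eqP.
apply: eq_itg => t /andP[xt ty]; rewrite patchE mem_set//=.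
by rewrite in_itv/= (le_trans ax xt) (le_trans ty yb).
Qed.

Lemma itg_dominated x y (f_ : nat -> R -> R) f g :
  (forall n, meas x y (f_ n)) -> meas x y f ->
  {ae mu, forall t, x < t < y -> f_ ^~ t @ \oo --> f t} -> L1 x y g ->
  {ae mu, forall t, x < t < y -> forall n, `|f_ n t| <= g t} ->
  L1 x y f /\ (fun n => itg (f_ n) x y) @ \oo --> itg f x y.
Proof.
move=> mf_ mf /ae_closed cf ig /ae_closed fg.
have /= := @dominated_convergence _ _ _ mu `[x, y]%classic _
  (fun n => EFin \o f_ n) (EFin \o f) (EFin \o g).
case.
- by [].
- by move=> n; apply/measurable_EFinP; exact: mf_.
- by apply/measurable_EFinP; exact: mf.
- apply: (ae_imply cf) => t h /=; rewrite in_itv/= => xy.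
  by apply: cvg_EFin; [exact: nearW|exact: h].
- exact: ig.
- apply: (ae_imply fg) => t h n /=; rewrite in_itv/= => xy.
  by rewrite lee_fin h.
move=> if_ _ H; split => //.
(* Domination holds only a.e., while [L1_le] compares at every point: the bound used is
   [max(|f_ n|, g)], a.e. equal to [g]. *)
have ifn n : L1 x y (f_ n).
  apply: (L1_le (g := fun t => Num.max `|f_ n t| (g t))) => //.
    by move=> t _; rewrite le_max lexx.
  apply/integrableP; split.
      apply/measurable_EFinP; apply: meas_max; last exact: L1_meas.
    exact: meas_norm.
  case/integrableP : (L1_norm ig) => _; apply: le_lt_trans.
  apply: ae_ge0_le_integral => //.
  - apply/measurable_EFinP; apply: meas_norm.
    by apply: meas_max; [exact: meas_norm|exact: L1_meas].
  - apply/measurable_EFinP; apply: meas_norm; apply: meas_norm.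
    exact: L1_meas.
  - apply: (ae_imply fg) => t h /=; rewrite in_itv/= => xy.
    by rewrite lee_fin (max_idPr _) ?normr_id//; exact: h.
rewrite -(itgE if_) in H.
have -> : (fun n => itg (f_ n) x y) =
  (fun n => fine (\int[mu]_(t in `[x, y]) (f_ n t)%:E)%E) by [].
exact/fine_cvg.
Qed.

End IntervalIntegral.

(** * Continuity on an interval, absolutely continuous functions, sign principle *)

Section Continuity.
Variable R : realType.
Local Notation mu := (@lebesgue_measure R).
Implicit Types (w f g h u v : R -> R) (x y z a b d e k r : R).

(** Continuity relative to [[a, b]] in epsilon-delta form, so that endpoints need no one-sided
    limits and restriction to subintervals is immediate. *)
Definition econt a b u : Prop := forall x, a <= x <= b -> forall e, 0 < e ->
  exists d, 0 < d /\ forall y, a <= y <= b -> `|y - x| < d -> `|u y - u x| < e.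

Lemma within_econt a b u : {within `[a, b], continuous u} <-> econt a b u.
Proof.
rewrite subspace_continuousP; split => [H x xab e e0|H x].
  have xab' : `[a, b]%classic x by rewrite /= in_itv.
  have /cvgrPdist_lt /(_ _ e0) := H x xab'.
  rewrite /within /= => /nbhs_ballP[d /= d0 dH]; exists d; split => // y yab yx.
  by rewrite distrC; apply: dH; rewrite /= ?in_itv//= /ball/= distrC.
rewrite /= in_itv/= => xab; apply/cvgrPdist_lt => e e0.
have [d [d0 dH]] := H x xab e e0.
rewrite /within /=; apply/nbhs_ballP; exists d => //= y.
by rewrite /ball/= distrC => yx; rewrite in_itv/= distrC => yab; exact: dH.
Qed.

Lemma econt_meas a b u : econt a b u -> meas a b u.
Proof. by move=> /within_econt /meas_cont. Qed.

(** Replaces compactness: a property of subintervals that can be concatenated and holds on short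
    intervals on either side of each point holds on [[a, b]]. The supremum of the reachable points
    can neither be missed nor lie below [b]. It serves for boundedness, the chain rule and weak
    convergence. *)
Lemma interval_induction a b (Q : R -> R -> Prop) : a <= b ->
  (forall x y z, a <= x -> x <= y -> y <= z -> z <= b -> Q x y -> Q y z -> Q x z) ->
  (forall x, a <= x <= b -> exists d, 0 < d /\
    (forall y, x <= y -> y < x + d -> y <= b -> Q x y) /\
    (forall y, x - d < y -> y <= x -> a <= y -> Q y x)) ->
  Q a b.
Proof.
move=> ab tr loc; pose S := [set t | a <= t <= b /\ Q a t].
have Sa : S a.
  split; first by rewrite lexx ab.
  have [|d [d0 [+ _]]] := loc a; first by rewrite lexx ab.
  by apply => //; rewrite ltrDl.
have hS : has_sup S.
  by split; [exists a|exists b => t [/andP[]]].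
pose z := sup S.
have az : a <= z by apply: ub_le_sup => //; case: hS.
have zb : z <= b by apply: sup_le_ub; [exists a|move=> t [/andP[]]].
have [|d [d0 [dr dl]]] := loc z; first by rewrite az.
have Qaz : Q a z.
  have [t [/andP[at_ tb] Qt] zt] := sup_adherent d0 hS.
  have tz : t <= z by apply: ub_le_sup; [case: hS|split => //; rewrite at_].
  exact: (tr _ t) (dl _ _ _ _).
move: zb; rewrite le_eqVlt => /predU1P[<-//|zb].
pose y := Num.min b (z + d / 2).
have zy : z < y by rewrite lt_min zb ltrDl divr_gt0.
have yb : y <= b by rewrite ge_min lexx.
have : S y.
  split; first by rewrite yb (le_trans az (ltW zy)).
  apply: (tr _ z) => //; first exact: ltW.
  apply: dr => //; first exact: ltW.
  by rewrite gt_min; apply/orP; right; rewrite ltrD2l gtr_pMr// invf_lt1// ltr1n.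
move=> /(ub_le_sup (proj2 hS)); rewrite -/z => yz.
by move: (lt_le_trans zy yz); rewrite ltxx.
Qed.

Lemma econt_bounded a b u : a <= b -> econt a b u ->
  exists k, 0 <= k /\ forall x, a <= x <= b -> `|u x| <= k.
Proof.
move=> ab cu.
pose Q x y := exists k, 0 <= k /\ forall t, x <= t <= y -> `|u t| <= k.
suff : Q a b by [].
apply: interval_induction => //.
  move=> x y z _ _ _ _ [k [k0 kP]] [l [l0 lP]]; exists (k + l); split.
    exact: addr_ge0.
  move=> t /andP[xt tz]; have [ty|yt] := leP t y.
    by rewrite (le_trans (kP t _)) ?xt// lerDl.
  by rewrite (le_trans (lP t _)) ?(ltW yt)// lerDr.
move=> x xab; have [d [d0 dP]] := cu x xab 1 ltr01.
have H t : a <= t <= b -> `|t - x| < d -> `|u t| <= `|u x| + 1.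
  move=> tab /(dP _ tab) /ltW tx.
  rewrite -[u t](subrK (u x)) addrC (le_trans (ler_normD _ _))// lerD2l//.
exists d; split => //; case/andP : xab => ax xb; split.
  move=> y xy yd yb; exists (`|u x| + 1); split; first by rewrite addr_ge0.
  move=> t /andP[xt ty]; apply: H; first by rewrite (le_trans ax xt) (le_trans ty yb).
  by rewrite ger0_norm ?subr_ge0// ltrBlDl (le_lt_trans ty).
move=> y yd yx ay; exists (`|u x| + 1); split; first by rewrite addr_ge0.
move=> t /andP[yt tx]; apply: H; first by rewrite (le_trans ay yt) (le_trans tx xb).
by rewrite distrC ger0_norm ?subr_ge0// ltrBlDl -ltrBlDr (lt_le_trans yd).
Qed.

Lemma econtS a b x y u : econt a b u -> a <= x -> y <= b -> econt x y u.
Proof.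
move=> cu ax yb t /andP[xt ty] e e0.
have [|d [d0 dP]] := cu t _ e e0.
  by rewrite (le_trans ax xt) (le_trans ty yb).
exists d; split => // s /andP[xs sy]; apply: dP.
by rewrite (le_trans ax xs) (le_trans sy yb).
Qed.

Lemma econt_L1 a b u : a <= b -> econt a b u -> L1 a b u.
Proof.
move=> ab cu; have [k [_ kP]] := econt_bounded ab cu.
by apply: (L1_bounded (econt_meas cu)) kP.
Qed.

Lemma econt_comp a b u (F : R -> R) :
  (forall x, a <= x <= b -> {for u x, continuous F}) -> econt a b u ->
  econt a b (F \o u).
Proof.
move=> cF cu x xab e e0.
have /cvgrPdist_lt /(_ _ e0) /nbhs_ballP[d /= d0 dP] := cF x xab.
have [r [r0 rP]] := cu x xab d d0; exists r; split => // y yab yx.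
by rewrite distrC; apply: dP; rewrite /ball/= distrC; exact: rP.
Qed.

Lemma econtT a b u : continuous u -> econt a b u.
Proof. by move=> cu; apply/within_econt; exact: continuous_subspaceT. Qed.

Lemma econtD a b u v : econt a b u -> econt a b v ->
  econt a b (fun t => u t + v t).
Proof.
move=> cu cv x xab e e0; have e20 : 0 < e / 2 by rewrite divr_gt0.
have [d [d0 dP]] := cu x xab _ e20; have [r [r0 rP]] := cv x xab _ e20.
exists (Num.min d r); split; first by rewrite lt_min d0.
move=> y yab; rewrite lt_min => /andP[/(dP _ yab) h /(rP _ yab) h'].
rewrite opprD addrACA (le_lt_trans (ler_normD _ _))//.
by rewrite [ltRHS](splitr e) ltrD.
Qed.

Lemma econtN a b u : econt a b u -> econt a b (fun t => - u t).
Proof.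
move=> cu x xab e e0; have [d [d0 dP]] := cu x xab _ e0.
by exists d; split => // y yab yx; rewrite -opprD normrN; exact: dP.
Qed.

(** This is absolute continuity of [u] with a.e. derivative [w]. In integral form it passes to
    limits and never requires differentiating [u]. *)
Definition prim a b u w : Prop :=
  L1 a b w /\ forall x, a <= x <= b -> u x = u a + itg w a x.

Lemma primB a b u w x y : prim a b u w -> a <= x -> x <= y -> y <= b ->
  u y - u x = itg w x y.
Proof.
move=> [iw pw] ax xy yb; rewrite (pw x) ?ax ?(le_trans xy)//.
rewrite (pw y) ?yb ?(le_trans ax)// (itg_cat (L1S iw _ yb) ax xy)//; lra.
Qed.

Lemma prim_econt a b u w : prim a b u w -> econt a b u.
Proof.
move=> pu x /andP[ax xb] e e0; have [d [d0 dP]] := itg_ac (proj1 pu) e0.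
exists d; split => // y /andP[ay yb] yx.
have [xy|/ltW yx'] := leP x y.
  rewrite (primB pu)//; apply: le_lt_trans (dP x y _ _ _ _) => //.
    by apply: itg_norm; exact: L1S (proj1 pu) _ _.
  by rewrite -(ger0_norm (_ : 0 <= y - x)) ?subr_ge0.
rewrite distrC (primB pu)//; apply: le_lt_trans (dP y x _ _ _ _) => //.
  by apply: itg_norm; exact: L1S (proj1 pu) _ _.
by rewrite -(ger0_norm (_ : 0 <= x - y)) ?subr_ge0// distrC.
Qed.

Lemma primS a b u w x y : prim a b u w -> a <= x -> x <= y -> y <= b ->
  prim x y u w.
Proof.
move=> pu ax xy yb; split; first exact: L1S (proj1 pu) _ _.
move=> t /andP[xt ty]; rewrite -(primB pu)// ?(le_trans ty)//; lra.
Qed.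

Lemma primD a b u w u' w' : prim a b u w -> prim a b u' w' ->
  prim a b (fun t => u t + u' t) (fun t => w t + w' t).
Proof.
move=> [iw pw] [iw' pw']; split; first exact: L1D.
move=> x /andP[ax xb]; rewrite pw ?ax// pw' ?ax// itgD; last 2 first.
- exact: L1S iw _ _.
- exact: L1S iw' _ _.
lra.
Qed.

Lemma primN a b u w : prim a b u w -> prim a b (fun t => - u t) (fun t => - w t).
Proof.
move=> [iw pw]; split; first exact: L1N.
move=> x /andP[ax xb]; rewrite pw ?ax// itgN; last exact: L1S iw _ _.
lra.
Qed.

Lemma prim_lin a b k : prim a b (fun t => k * t) (fun=> k).
Proof.
split; first exact: L1_cst.
by move=> x /andP[ax xb]; rewrite itg_cst//; lra.
Qed.

(* It suffices that [u] does not increase where it is small and positive: [u]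
   has to cross these values before becoming large. *)
Lemma prim_le0 a b u w d : prim a b u w -> u a <= 0 -> 0 < d ->
  {ae mu, forall t, a < t < b -> 0 < u t < d -> w t <= 0} ->
  forall x, a <= x <= b -> u x <= 0.
Proof.
move=> pu ua0 d0 wle x /andP[ax xb]; rewrite leNgt; apply/negP => ux0.
pose S := [set t | a <= t <= x /\ u t <= 0].
have hS : has_sup S.
  split; first by exists a; split => //; rewrite lexx ax.
  by exists x => t [/andP[]].
pose z := sup S.
have az : a <= z by apply: ub_le_sup; [case: hS|split => //; rewrite lexx ax].
have zx : z <= x by apply: sup_le_ub; [case: hS|move=> t [/andP[]]].
have cu := prim_econt pu.
have zab : a <= z <= b by rewrite az (le_trans zx).
have uz : u z <= 0.
  rewrite leNgt; apply/negP => uz0.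
  have [r [r0 rP]] := cu z zab _ uz0.
  have [t [/andP[at_ tx] ut] zt] := sup_adherent r0 hS.
  have tz : t <= z by apply: ub_le_sup; [case: hS|split => //; rewrite at_].
  have : `|u t - u z| < u z.
    apply: rP; first by rewrite at_ (le_trans tx).
    by rewrite distrC ger0_norm ?subr_ge0//; move: zt; rewrite -/z; lra.
  by rewrite ltr_norml; lra.
have zx' : z < x.
  by rewrite lt_neqAle zx andbT; apply: contraTneq ux0 => <-; rewrite -leNgt.
have upos t : z < t <= x -> 0 < u t.
  move=> /andP[zt tx]; rewrite ltNge; apply/negP => ut.
  suff : t <= z by rewrite leNgt zt.
  by apply: ub_le_sup; [case: hS|split => //; rewrite tx (le_trans az (ltW zt))].
have [r [r0 rP]] := cu z zab _ d0.
pose y := Num.min x (z + r / 2).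
have zy : z < y by rewrite lt_min zx' ltrDl divr_gt0.
have yx : y <= x by rewrite ge_min lexx.
have yr : y < z + r.
  by rewrite gt_min; apply/orP; right; rewrite ltrD2l gtr_pMr// invf_lt1// ltr1n.
have : u y - u z <= 0.
  rewrite (primB pu)// ?(ltW zy)// ?(le_trans yx)//.
  rewrite -[leRHS](mul0r (y - z)) -(itg_cst _ (ltW zy)); apply: itg_le.
  - by apply: L1S (proj1 pu) _ _ => //; exact: le_trans yx _.
  - exact: L1_cst.
  apply: (ae_imply wle) => t H /andP[zt ty]; apply: H.
    by rewrite (le_lt_trans az zt) (lt_le_trans ty)// (le_trans yx).
  rewrite upos ?zt ?(le_trans (ltW ty))//=.
  have : `|u t - u z| < d.
    apply: rP.
      by rewrite (le_trans az (ltW zt)) (le_trans (ltW ty))// (le_trans yx).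
    by rewrite ger0_norm ?subr_ge0 ?(ltW zt)// ltrBlDl (lt_trans ty).
  by rewrite ltr_norml; lra.
have := upos y; rewrite zy yx => /(_ isT); lra.
Qed.

End Continuity.

(** * Chain rule and integration by parts for absolutely continuous functions *)

Section Calculus.
Variable R : realType.
Local Notation mu := (@lebesgue_measure R).
Implicit Types (w f g h u v p : R -> R) (x y z a b d e k r C L : R).

Lemma L1_mul_econt a b u w : a <= b -> econt a b u -> L1 a b w ->
  L1 a b (fun t => u t * w t).
Proof.
move=> ab cu iw; have [k [k0 kP]] := econt_bounded ab cu.
apply: (L1_le (g := fun t => k * `|w t|)).
- by apply: measM; [exact: econt_meas|exact: L1_meas].
- by move=> t tab; rewrite normrM ler_wpM2r// kP.
- by apply: L1Z; exact: L1_norm.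
Qed.

Lemma itg_norm_le a b w g : L1 a b w -> L1 a b g ->
  (forall t, a <= t <= b -> `|w t| <= g t) -> `|itg w a b| <= itg g a b.
Proof.
move=> iw ig wg; apply: le_trans (itg_norm iw) _; apply: itg_le => //.
  exact: L1_norm.
by apply: ae_all => t /andP[/ltW ? /ltW ?]; apply: wg; apply/andP.
Qed.

(** The defect [D x y] of the identity is additive over adjacent intervals. Near each point,
    freezing [F (u x)] and linearizing [Phi] bound it by [2 e] times the variation [int |w|].
    Interval induction makes this global, and [e] is arbitrary. *)
Lemma prim_chain a b u w (Phi F : R -> R) : a <= b -> prim a b u w ->
  econt a b (F \o u) ->
  (forall x, a <= x <= b -> forall e, 0 < e -> exists d, 0 < d /\
    forall t, `|t - u x| < d ->
      `|Phi t - Phi (u x) - F (u x) * (t - u x)| <= e * `|t - u x|) ->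
  itg (fun t => F (u t) * w t) a b = Phi (u b) - Phi (u a).
Proof.
move=> ab pu cF dPhi; have iw := proj1 pu; have cu := prim_econt pu.
have iFw := L1_mul_econt ab cF iw; have inw := L1_norm iw.
set G := fun t => F (u t) * w t.
pose D x y := Phi (u y) - Phi (u x) - itg G x y.
suff H e : 0 < e -> `|D a b| <= 2 * e * itg (fun t => `|w t|) a b.
  have V0 : 0 <= itg (fun t => `|w t|) a b.
    by apply: itg_ge0 => //; exact: ae_all.
  have : `|D a b| <= 0.
    apply/ler_addgt0Pr => e e0; rewrite add0r.
    (* The [+ 1] keeps the quotient meaningful when the variation vanishes. *)
    have e'0 : 0 < e / (2 * (itg (fun t => `|w t|) a b + 1)).
      by rewrite divr_gt0// mulr_gt0// ltr_wpDl.
    apply: le_trans (H _ e'0) _.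
    rewrite invfM mulrCA (mulrA 2) mulfV// mul1r -mulrA ger_pMr//.
    by rewrite ler_pdivrMl ?mulr1 ?lerDl// ltr_wpDl.
  by rewrite normr_le0 /D subr_eq0 eq_sym => /eqP.
move=> e0; pose V x y := itg (fun t => `|w t|) x y.
pose Q x y : Prop := `|D x y| <= 2 * e * V x y.
have key x s t : a <= s -> s <= t -> t <= b -> a <= x <= b ->
    (forall r, s <= r <= t -> `|F (u x) - F (u r)| <= e) ->
    `|F (u x) * (u t - u s) - itg G s t| <= e * V s t.
  move=> as_ st tb xab Fe; have iw' := L1S iw as_ tb.
  rewrite (primB pu)// -itgZ// -itgB; last 2 first.
  - exact: L1Z.
  - exact: L1S iFw _ _.
  rewrite -itgZ; last exact: L1_norm.
  apply: itg_norm_le.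
  - by apply: L1B; [exact: L1Z|exact: L1S iFw _ _].
  - by apply: L1Z; exact: L1_norm.
  by move=> r rst; rewrite /G -mulrBl normrM ler_wpM2r// Fe.
have uV s t : a <= s -> s <= t -> t <= b -> `|u t - u s| <= V s t.
  by move=> as_ st tb; rewrite (primB pu)//; apply: itg_norm; exact: L1S iw _ _.
suff : Q a b by [].
apply: interval_induction => //.
  move=> x y z ax xy yz zb Qxy Qyz; rewrite /Q /D /V.
  rewrite (itg_cat (L1S iFw ax zb) xy yz) (itg_cat (L1S inw ax zb) xy yz).
  rewrite mulrDr (le_trans _ (lerD Qxy Qyz))//.
  apply: le_trans (ler_normD _ _); rewrite /D le_eqVlt; apply/orP; left.
  by apply/eqP; congr `| _ |; lra.
move=> x xab; have /andP[ax xb] := xab.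
have [d1 [d10 d1P]] := dPhi x xab e e0.
have [d2 [d20 d2P]] := cu x xab d1 d10.
have [d3 [d30 d3P]] := cF x xab e e0.
have near t : a <= t <= b -> `|t - x| < Num.min d2 d3 ->
    `|Phi (u t) - Phi (u x) - F (u x) * (u t - u x)| <= e * `|u t - u x| /\
    `|F (u x) - F (u t)| <= e.
  move=> tab; rewrite lt_min => /andP[t2 t3]; split.
    by apply: d1P; exact: d2P.
  by rewrite distrC; apply: ltW; exact: d3P.
exists (Num.min d2 d3); split; first by rewrite lt_min d20.
split.
  move=> y xy yd yb; rewrite /Q.
  have yx : `|y - x| < Num.min d2 d3 by rewrite ger0_norm ?subr_ge0// ltrBlDl.
  have [||n1 _] := near y; rewrite ?(le_trans ax)//.
  have k1 : `|F (u x) * (u y - u x) - itg G x y| <= e * V x y.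
    apply: key => // r /andP[xr ry].
    have [||_ //] := near r; first by rewrite (le_trans ax)// (le_trans ry).
    apply: le_lt_trans yx; rewrite !ger0_norm ?subr_ge0//; lra.
  rewrite (_ : D x y = (Phi (u y) - Phi (u x) - F (u x) * (u y - u x)) +
    (F (u x) * (u y - u x) - itg G x y)); last by rewrite /D; lra.
  apply: le_trans (ler_normD _ _) _.
  rewrite -mulrA mulrDl mul1r; apply: lerD => //.
  by apply: le_trans n1 _; rewrite ler_wpM2l ?(ltW e0)// uV.
move=> y yd yx ay; rewrite /Q.
have yx' : `|y - x| < Num.min d2 d3.
  by rewrite distrC ger0_norm ?subr_ge0// ltrBlDl -ltrBlDr.
have [||n1 _] := near y; rewrite ?ay ?(le_trans yx)//.
have k1 : `|F (u x) * (u x - u y) - itg G y x| <= e * V y x.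
  apply: key => // r /andP[yr rx].
  have [||_ //] := near r; first by rewrite (le_trans ay)// (le_trans rx).
  apply: le_lt_trans yx'; rewrite distrC [leRHS]distrC.
  rewrite !ger0_norm ?subr_ge0//; lra.
rewrite (_ : D y x = - (Phi (u y) - Phi (u x) - F (u x) * (u y - u x)) +
  (F (u x) * (u x - u y) - itg G y x)); last by rewrite /D; lra.
apply: le_trans (ler_normD _ _) _; rewrite normrN.
rewrite -mulrA mulrDl mul1r; apply: lerD => //.
by apply: le_trans n1 _; rewrite ler_wpM2l ?(ltW e0)// distrC uV.
Qed.

Lemma prim_sqr a b u w : a <= b -> prim a b u w ->
  itg (fun t => 2 * u t * w t) a b = u b ^+ 2 - u a ^+ 2.
Proof.
move=> ab pu.
apply: (prim_chain (Phi := fun t => t ^+ 2) (F := fun t => 2 * t) ab pu).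
  apply: econt_comp (prim_econt pu) => x _.
  by apply: cvgM; [exact: cvg_cst|exact: cvg_id].
move=> x xab e e0; exists e; split => // t te.
rewrite (_ : _ - _ = (t - u x) * (t - u x)); last by ring.
by rewrite normrM ler_wpM2r// ltW.
Qed.

(** Polarization of [prim_sqr], applied to [u + v], [u] and [v]. *)
Lemma prim_parts a b u w v p : a <= b -> prim a b u w -> prim a b v p ->
  itg (fun t => u t * p t) a b + itg (fun t => w t * v t) a b =
  u b * v b - u a * v a.
Proof.
move=> ab pu pv.
have H := prim_sqr ab (primD pu pv); move: H.
have iup := L1_mul_econt ab (prim_econt pu) (proj1 pv).
have ivw := L1_mul_econt ab (prim_econt pv) (proj1 pu).
have iuw := L1_mul_econt ab (prim_econt pu) (proj1 pu).
have ivp := L1_mul_econt ab (prim_econt pv) (proj1 pv).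
have Hu := prim_sqr ab pu; have Hv := prim_sqr ab pv.
have iuw2 := L1Z 2 iuw; have ivp2 := L1Z 2 ivp.
rewrite (eq_itg (w' := fun t => 2 * (u t * w t) + 2 * (v t * p t) +
  2 * (u t * p t + v t * w t))); last by move=> t _; ring.
rewrite itgD; [|exact: L1D|by apply: L1Z; exact: L1D].
rewrite itgD// !(itgZ 2)//; last exact: L1D.
rewrite (itgD iup ivw).
rewrite (eq_itg (w' := fun t => 2 * (u t * w t))) in Hu; last by move=> t _; ring.
rewrite (eq_itg (w' := fun t => 2 * (v t * p t))) in Hv; last by move=> t _; ring.
move=> H; rewrite (itgZ 2 iuw) in Hu; rewrite (itgZ 2 ivp) in Hv.
rewrite [X in _ + X](eq_itg (w' := fun t => v t * w t)); last first.
  by move=> t _; rewrite mulrC.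
lra.
Qed.

Lemma prim_derive a b u : a <= b -> (forall x, derivable u x 1) ->
  continuous (derive1 u) -> prim a b u (derive1 u).
Proof.
move=> ab du cdu; have idu c : a <= c -> L1 a c (derive1 u).
  by move=> ac; apply: econt_L1 => //; exact: econtT.
split; first exact: idu.
have cu : continuous u by move=> x; apply: differentiable_continuous; exact/derivable1_diffP.
move=> x /andP[ax xb]; move: (ax); rewrite le_eqVlt => /predU1P[<-|ltax].
  by rewrite itg_xx addr0.
have LR : derivable_oo_LRcontinuous u a x.
  split => //; first by apply: cvg_at_right_filter; exact: cu.
  by apply: cvg_at_left_filter; exact: cu.
have H := continuous_FTC2 ltax (continuous_subspaceT cdu) LR (fun _ _ => erefl).
have : ((itg (derive1 u) a x)%:E = (u x)%:E - (u a)%:E)%E.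
  by rewrite (itgE (idu _ ax)).
by rewrite -EFinB => -[->]; rewrite addrC subrK.
Qed.

Lemma derive1_approx u x : derivable u x 1 -> forall e, 0 < e -> exists d, 0 < d /\
  forall t, `|t - x| < d -> `|u t - u x - derive1 u x * (t - x)| <= e * `|t - x|.
Proof.
move=> du e e0; rewrite derive1E.
have /cvgrPdist_lt /(_ _ e0) := du.
rewrite /nbhs/= => -[d /= d0 dP]; exists d; split => // t tx.
have [->|tnx] := eqVneq t x; first by rewrite !subrr mulr0 subr0 !normr0 mulr0.
have tx0 : t - x != 0 by rewrite subr_eq0.
have := dP (t - x); rewrite /ball_ /= sub0r normrN => /(_ tx tx0).
rewrite /GRing.scale/= mulr1 subrK => /ltW H.
rewrite -ler_pdivrMr ?normr_gt0//; apply: le_trans H.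
rewrite -normfV -normrM distrC le_eqVlt; apply/orP; left; apply/eqP.
by congr `| _ |; rewrite /derive/= /GRing.scale/=; field.
Qed.

End Calculus.

(** * Square-integrable functions and passage to the limit *)

Section SquareIntegrable.
Variable R : realType.
Local Notation mu := (@lebesgue_measure R).
Implicit Types (w f g h u v p : R -> R) (x y z a b d e k r C L : R).

Definition sqi a b f : Prop := meas a b f /\ L1 a b (fun t => f t ^+ 2).

Lemma L2P L f : L2 L f <-> sqi 0 L f.
Proof.
split => -[mf H]; split => //.
  apply/integrableP; split; first by apply/measurable_EFinP; exact: measurable_funX.
  by move: H; under eq_integral do rewrite -[(_ ^+ 2)%:E]gee0_abs ?lee_fin ?sqr_ge0//.
case/integrableP : H => _.
by under eq_integral do rewrite /= ger0_norm ?sqr_ge0//.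
Qed.

Lemma sqi_le a b f g k : meas a b f -> (forall t, a <= t <= b -> `|f t| <= k * `|g t|) ->
  sqi a b g -> sqi a b f.
Proof.
move=> mf fg [mg ig]; split => //; apply: (L1_le (g := fun t => k ^+ 2 * g t ^+ 2)).
- exact: measurable_funX.
- move=> t /fg H; rewrite ger0_norm ?sqr_ge0// -exprMn -real_normK ?num_real//.
  rewrite -[leRHS]real_normK ?num_real// lerXn2r ?nnegrE//.
  by apply: le_trans H _; rewrite normrM ler_wpM2r// ler_norm.
- exact: L1Z.
Qed.

Lemma sqi_bounded a b f k : meas a b f -> (forall t, a <= t <= b -> `|f t| <= k) ->
  sqi a b f.
Proof.
move=> mf fk; apply: (sqi_le (g := fun=> 1) (k := k)) => //.
  by move=> t /fk; rewrite normr1 mulr1.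
by split; [exact: meas_cst|exact: L1_cst].
Qed.

Lemma sqi_cst a b k : sqi a b (fun=> k).
Proof. by apply: (sqi_bounded (k := `|k|)) => //; exact: meas_cst. Qed.

Lemma sqi_econt a b u : a <= b -> econt a b u -> sqi a b u.
Proof.
move=> ab cu; have [k [_ kP]] := econt_bounded ab cu.
exact: (sqi_bounded (econt_meas cu) kP).
Qed.

Lemma sqi_L1M a b f g : sqi a b f -> sqi a b g -> L1 a b (fun t => f t * g t).
Proof.
move=> [mf i2f] [mg i2g]; apply: (L1_le (g := fun t => f t ^+ 2 + g t ^+ 2)).
- exact: measM.
- move=> t _; rewrite normrM -(real_normK (num_real (f t))).
  rewrite -(real_normK (num_real (g t))).
  have := sqr_ge0 (`|f t| - `|g t|); have := normr_ge0 (f t).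
  have := normr_ge0 (g t); nra.
- exact: L1D.
Qed.

Lemma sqi_L1 a b f : sqi a b f -> L1 a b f.
Proof.
move=> i; have := sqi_L1M i (sqi_cst a b 1); congr (mu.-integrable _ _).
by apply/funext => t; rewrite /= mulr1.
Qed.

Lemma sqiD a b f g : sqi a b f -> sqi a b g -> sqi a b (fun t => f t + g t).
Proof.
move=> i i'; split; first by apply: measD; [case: i|case: i'].
rewrite (_ : (fun t => _) = fun t => f t ^+ 2 + 2 * (f t * g t) + g t ^+ 2).
  apply: L1D; [apply: L1D|]; [by case: i| |by case: i'].
  by apply: L1Z; exact: sqi_L1M.
by apply/funext => t; ring.
Qed.

Lemma sqiM a b f g k : meas a b g -> (forall t, a <= t <= b -> `|g t| <= k) ->
  sqi a b f -> sqi a b (fun t => g t * f t).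
Proof.
move=> mg gk i; apply: (sqi_le (k := k) _ _ i).
  by apply: measM => //; case: i.
by move=> t /gk H; rewrite normrM ler_wpM2r.
Qed.

Lemma sqiZ a b f k : sqi a b f -> sqi a b (fun t => k * f t).
Proof. by apply: (sqiM (k := `|k|)) => //; exact: meas_cst. Qed.

Lemma sqiN a b f : sqi a b f -> sqi a b (fun t => - f t).
Proof.
move=> /(sqiZ (-1)); congr (sqi a b _).
by apply/funext => t; rewrite mulN1r.
Qed.

Lemma sqiS a b x y f : sqi a b f -> a <= x -> y <= b -> sqi x y f.
Proof. by move=> [mf i] ax yb; split; [exact: measS mf _ _|exact: L1S i _ _]. Qed.

(** Stands in for Cauchy-Schwarz in the estimates below: the weight [e] is chosen according to the
    sizes of the two norms. *)
Lemma itg_young a b f g e : sqi a b f -> sqi a b g -> 0 < e ->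
  itg (fun t => `|f t * g t|) a b <=
  e * itg (fun t => f t ^+ 2) a b + e^-1 * itg (fun t => g t ^+ 2) a b.
Proof.
move=> i i' e0; have ifg := sqi_L1M i i'.
have [_ i2] := i; have [_ i2'] := i'.
rewrite -(itgZ e i2) -(itgZ e^-1 i2') -itgD; [|exact: L1Z|exact: L1Z].
apply: itg_le; [exact: L1_norm|by apply: L1D; exact: L1Z|apply: ae_all => t _].
rewrite normrM -(real_normK (num_real (f t))) -(real_normK (num_real (g t))).
have H := sqr_ge0 (e * `|f t| - `|g t|).
rewrite -(ler_pM2l e0) mulrDr (mulrA e e^-1) mulfV ?gt_eqF// mul1r.
have f0 := normr_ge0 (f t); have g0 := normr_ge0 (g t).
have : 0 <= e * (`|f t| * `|g t|) by rewrite !mulr_ge0// ltW.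
nra.
Qed.

(** Convergence is assumed only at interior points, so Fatou is applied on the open interval and the
    endpoints are restored as a null set. *)
Lemma fatou_sqr a b (f_ : nat -> R -> R) f C :
  (forall n, meas a b (f_ n)) -> meas a b f ->
  (forall t, a < t < b -> f_ ^~ t @ \oo --> f t) ->
  (forall n, sqi a b (f_ n)) ->
  (forall n, itg (fun t => f_ n t ^+ 2) a b <= C) ->
  sqi a b f /\ itg (fun t => f t ^+ 2) a b <= C.
Proof.
move=> mf_ mf cf if_ leC.
have mf2 : measurable_fun `]a, b[ (fun t => (f t ^+ 2)%:E).
  apply/measurable_EFinP; apply: measurable_funX; apply: measurable_funS mf => //.
  by apply: subset_itvW.
have mf2_ n : measurable_fun `]a, b[ (fun t => (f_ n t ^+ 2)%:E).
  apply/measurable_EFinP; apply: measurable_funX; apply: measurable_funS (mf_ n) => //.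
  by apply: subset_itvW.
have oc (h : R -> R) : meas a b h -> (\int[mu]_(t in `]a, b[) (h t ^+ 2)%:E =
    \int[mu]_(t in `[a, b]) (h t ^+ 2)%:E)%E.
  move=> mh; have mh2 : measurable_fun `[a, b] (fun t => h t ^+ 2).
    exact: measurable_funX.
  by apply/esym/integral_itv_bndoo/measurable_EFinP; apply: measurable_funS mh2 => //; apply: subset_itvW.
have le : (\int[mu]_(t in `[a, b]) (f t ^+ 2)%:E <= C%:E)%E.
  rewrite -oc//.
  have H : (\int[mu]_(t in `]a, b[) limn_einf (fun n => (f_ n t ^+ 2)%:E) <=
      limn_einf (fun n => \int[mu]_(t in `]a, b[) (f_ n t ^+ 2)%:E))%E.
    by apply: fatou => // n t _; rewrite lee_fin sqr_ge0.
  have E : (\int[mu]_(t in `]a, b[) limn_einf (fun n => (f_ n t ^+ 2)%:E) =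
      \int[mu]_(t in `]a, b[) (f t ^+ 2)%:E)%E.
    apply: eq_integral => t; rewrite inE/= in_itv/= => tab.
    have c : (fun n => (f_ n t ^+ 2)%:E) @ \oo --> (f t ^+ 2)%:E.
      apply: cvg_EFin; first exact: nearW.
      by apply: cvgM; exact: cf.
    by have [-> _] := cvg_limn_einf_sup c.
  rewrite -E; apply: le_trans H _.
  rewrite limn_einf_lim; apply: lime_le; first exact: is_cvg_einfs.
  apply: nearW => n; apply: (@le_trans _ _ (\int[mu]_(t in `]a, b[) (f_ n t ^+ 2)%:E)%E).
    by apply: ereal_inf_lbound; exists n => /=.
  by rewrite oc// -itgE ?lee_fin//; case: (if_ n).
have i2 : L1 a b (fun t => f t ^+ 2).
  apply/integrableP; split; first by apply/measurable_EFinP; exact: measurable_funX.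
  by under eq_integral do rewrite /= ger0_norm ?sqr_ge0//; rewrite (le_lt_trans le) ?ltry.
by split; [|rewrite -lee_fin itgE].
Qed.

(* [|e| <= min(|e|, k) + e^2 / k]: the first term is dominated and the second
   one is uniformly small. *)
Lemma cvg_itg_norm a b (f_ : nat -> R -> R) f C :
  (forall n, meas a b (f_ n)) -> meas a b f ->
  (forall t, a < t < b -> f_ ^~ t @ \oo --> f t) ->
  (forall n, sqi a b (f_ n)) ->
  (forall n, itg (fun t => f_ n t ^+ 2) a b <= C) ->
  (fun n => itg (fun t => `|f_ n t - f t|) a b) @ \oo --> (0 : R).
Proof.
move=> mf_ mf cf if_ leC; have [if2 fC] := fatou_sqr mf_ mf cf if_ leC.
pose e_ n t := f_ n t - f t.
have ie n : sqi a b (e_ n) by apply: sqiD => //; exact: sqiN.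
have eC n : itg (fun t => e_ n t ^+ 2) a b <= 4 * C.
  apply: (@le_trans _ _ (itg (fun t => 2 * f_ n t ^+ 2 + 2 * f t ^+ 2) a b)).
    have [_ i2] := if_ n; have [_ i2'] := if2.
    apply: itg_le; [by case: (ie n)|by apply: L1D; exact: L1Z|].
    apply: ae_all => t _; have := sqr_ge0 (f_ n t + f t); rewrite /e_; nra.
  have [_ i2] := if_ n; have [_ i2'] := if2.
  rewrite itgD ?itgZ//; [|exact: L1Z|exact: L1Z]; have := leC n; lra.
apply/cvgrPdist_lt => e e0.
have C0 : 0 <= C.
  by apply: le_trans fC; apply: itg_ge0; [case: if2|apply: ae_all => t _; exact: sqr_ge0].
(* Chosen so that the uniform term, at most [4 C / k], is below [e / 2]. *)
pose k := 8 * (C + 1) / e.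
have k0 : 0 < k by rewrite divr_gt0 ?mulr_gt0// ltr_wpDl.
pose m_ n t := Num.min `|e_ n t| k.
have mm n : meas a b (m_ n).
  by apply: meas_min; [apply: meas_norm; case: (ie n)|exact: meas_cst].
have /= [] := @itg_dominated _ a b m_ (fun=> 0) (fun=> k) mm.
- exact: meas_cst.
- apply: ae_all => t tab; apply/cvgrPdist_lt => r r0.
  have /cvgrPdist_lt/(_ _ r0) := cf t tab.
  apply: filterS => n H; rewrite sub0r normrN ger0_norm; last first.
    by rewrite le_min normr_ge0 ltW.
  by rewrite gt_min /e_ distrC H.
- exact: L1_cst.
- apply: ae_all => t _ n; rewrite ger0_norm ?ge_min ?lexx ?orbT//.
  by rewrite le_min normr_ge0 ltW.
move=> _; have -> : itg (fun=> 0) a b = 0 :> R.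
  by rewrite /itg Rintegral_cst// mul0r.
have e20 : 0 < e / 2 by rewrite divr_gt0.
move=> /cvgrPdist_lt /(_ _ e20); apply: filterS => n; rewrite !sub0r !normrN => H.
have i1 := L1_norm (sqi_L1 (ie n)); have [_ i2] := ie n.
have im : L1 a b (m_ n).
  apply: (L1_le _ _ i1) => // t _; rewrite ger0_norm ?ge_min ?lexx//.
  by rewrite le_min normr_ge0 ltW.
rewrite ger0_norm; last by apply: itg_ge0 => //; apply: ae_all.
apply: (@le_lt_trans _ _ (itg (m_ n) a b + k^-1 * itg (fun t => e_ n t ^+ 2) a b)).
  rewrite -itgZ// -itgD//; last exact: L1Z.
  apply: itg_le => //; first by apply: L1D => //; exact: L1Z.
  apply: ae_all => t _; rewrite /m_ -/(e_ n t).
  have [ek|ke] := leP `|e_ n t| k; first by rewrite lerDl mulr_ge0 ?invr_ge0 ?sqr_ge0// ltW.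
  rewrite -[leLHS]add0r lerD ?(ltW k0)// ler_pdivlMl// -real_normK ?num_real//.
  by rewrite expr2 ler_wpM2r// ltW.
have : itg (m_ n) a b < e / 2 by apply: le_lt_trans H; exact: ler_norm.
have : k^-1 * itg (fun t => e_ n t ^+ 2) a b <= e / 2.
  rewrite ler_pdivrMl// /k; apply: le_trans (eC n) _.
  rewrite (_ : 8 * (C + 1) / e * (e / 2) = 4 * (C + 1)); last by field; rewrite gt_eqF.
  lra.
lra.
Qed.

End SquareIntegrable.

(** * Smooth functions approximating indicators of intervals *)

Section SmoothBumps.
Variable R : realType.
Implicit Types (f g : R -> R) (x y z c k s t e d l C : R) (p q : {poly R}).

(** Induction on the polynomial: half of the exponential absorbs the new factor [y], the other half
    is left for the induction hypothesis. *)
Lemma poly_expR_bounded p k : 0 < k ->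
  exists C, forall y, 0 <= y -> `|p.[y]| * expR (- (k * y)) <= C.
Proof.
elim/poly_ind: p k => [|p c IH] k k0.
  by exists 0 => y _; rewrite horner0 normr0 mul0r.
have k20 : 0 < k / 2 by rewrite divr_gt0.
have [C CP] := IH _ k20; exists (C * (2 / k) + `|c|) => y y0.
rewrite hornerMXaddC.
have e1 : expR (- (k * y)) <= 1 by rewrite expR_le1 oppr_le0 mulr_ge0// ltW.
have eE : expR (- (k * y)) = expR (- (k / 2 * y)) * expR (- (k / 2 * y)).
  by rewrite -expRD; congr expR; field.
have ye : y * expR (- (k / 2 * y)) <= 2 / k.
  rewrite expRN ler_pdivrMr ?expR_gt0//.
  apply: (@le_trans _ _ (2 / k * (1 + k / 2 * y))).
    rewrite mulrDr mulr1 mulrA (_ : 2 / k * (k / 2) = 1); last by field; rewrite gt_eqF.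
    by rewrite mul1r lerDr divr_ge0// ltW.
  by rewrite ler_wpM2l ?expR_ge1Dx// divr_ge0// ltW.
apply: le_trans (_ : (`|p.[y] * y| + `|c|) * expR (- (k * y)) <= _).
  by rewrite ler_wpM2r ?expR_ge0// ler_normD.
rewrite mulrDl lerD//; last by rewrite ler_piMr.
rewrite normrM (ger0_norm y0) eE mulrACA.
by apply: ler_pM => //; rewrite ?mulr_ge0 ?expR_ge0 ?CP.
Qed.

(** The classical flat function [exp(-1/x)], with a polynomial in [1/x] in front so that the family
    is stable under differentiation: [p] becomes [X^2 (p - p')]. *)
Definition expinv p x : R := if 0 < x then p.[x^-1] * expR (- x^-1) else 0.

Lemma is_derive_quadratic f x l C :
  (forall h, `|f (x + h) - f x - l * h| <= C * h ^+ 2) -> is_derive x 1 f l.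
Proof.
move=> H.
have C0 : 0 <= C.
  by have := le_trans (normr_ge0 _) (H 1); rewrite expr1n mulr1.
have cv : (fun h => h^-1 *: (f (h *: 1 + x) - f x)) @ 0^' --> l.
  apply/cvgrPdist_lt => e e0; rewrite /nbhs/=.
  exists (e / (C + 1)) => /=; first by rewrite divr_gt0// ltr_wpDl.
  move=> h; rewrite /ball_/= sub0r normrN => he h0.
  rewrite /GRing.scale/= mulr1 (addrC h).
  rewrite (_ : l - _ = - h^-1 * (f (x + h) - f x - l * h)); last by field.
  rewrite normrM normrN normfV ltr_pdivrMl ?normr_gt0//.
  apply: le_lt_trans (H h) _; rewrite -real_normK ?num_real// expr2 mulrA mulrC.
  rewrite ltr_pM2l ?normr_gt0//.
  move: he; rewrite ltr_pdivlMr ?ltr_wpDl//; apply: le_lt_trans.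
  by rewrite mulrC ler_wpM2l// lerDl.
apply: DeriveDef; first by apply/cvg_ex; exists l.
by rewrite /derive; apply: cvg_lim.
Qed.

Lemma is_derive_expinv p x :
  is_derive x 1 (expinv p) (expinv ('X^2 * (p - p^`())) x).
Proof.
have [x0|x0|<-] := ltgtP 0 x.
- apply: (@near_eq_is_derive _ _ _ (fun y => p.[y^-1] * expR (- y^-1))).
    near=> y; rewrite /expinv ifT//; near: y; exact: lt_nbhsr.
  have dV : is_derive x 1 (fun y : R => y^-1) (- x ^- 2 *: 1).
    by apply: (@is_deriveV _ id); rewrite gt_eqF.
  have dp : is_derive x 1 (fun y : R => p.[y^-1]) (p^`().[x^-1] * (- x ^- 2 *: 1)).
    by apply: (@is_derive1_comp _ (horner p) (fun y => y^-1)).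
  have dN : is_derive x 1 (fun y : R => - y^-1) (- (- x ^- 2 *: 1)).
    exact: is_deriveN.
  have de : is_derive x 1 (fun y : R => expR (- y^-1))
      (expR (- x^-1) * (- (- x ^- 2 *: 1))).
    by apply: (@is_derive1_comp _ expR (fun y => - y^-1)).
  apply: is_derive_eq (is_deriveM dp de) _.
  rewrite /expinv x0 /GRing.scale/= hornerM hornerXn hornerD hornerN exprVn.
  ring.
- apply: (@near_eq_is_derive _ _ _ (cst 0)).
    near=> y; rewrite /expinv ifF//; apply/negbTE; rewrite -leNgt ltW//.
    near: y; exact: lt_nbhsl.
  by rewrite /expinv ltNge ltW//=; exact: is_derive_cst.
rewrite /expinv ltxx.
(* Flatness at [0]: with [y = 1/h], boundedness of [y^2 p(y) exp(-y)] says that the function is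
   [O(h^2)], so its derivative is zero. *)
have [C CP] := poly_expR_bounded ('X^2 * p) ltr01.
apply: (@is_derive_quadratic _ _ _ (Num.max C 0)) => h.
rewrite add0r ltxx mul0r !subr0; case: ifPn => h0; last first.
  by rewrite normr0 mulr_ge0 ?sqr_ge0// le_max lexx orbT.
have hi : 0 <= h^-1 by rewrite invr_ge0 ltW.
have := CP _ hi; rewrite mul1r hornerM hornerXn !normrM => H.
rewrite (ger0_norm (expR_ge0 _)).
apply: (@le_trans _ _ (C * h ^+ 2)); last by rewrite ler_wpM2r ?sqr_ge0// le_max lexx.
rewrite -ler_pdivrMr ?exprn_gt0//; apply: le_trans H.
rewrite (ger0_norm hi) le_eqVlt; apply/orP; left; apply/eqP.
by rewrite -exprVn expr2; ring.
Unshelve. all: by end_near. Qed.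

(* Closed under differentiation, hence made of smooth functions. *)
Inductive bumpy : (R -> R) -> Prop :=
| bumpy_expinv p k c : bumpy (fun x => expinv p (k * x + c))
| bumpyD f g : bumpy f -> bumpy g -> bumpy (fun x => f x + g x)
| bumpyM f g : bumpy f -> bumpy g -> bumpy (fun x => f x * g x)
| bumpyZ k f : bumpy f -> bumpy (fun x => k * f x).

Lemma bumpy_derive f : bumpy f ->
  exists2 g, bumpy g & forall x, is_derive x 1 f (g x).
Proof.
elim=> [p k c|{}f g _ [f' bf df] _ [g' bg dg]|{}f g bf [f' bf' df] bg [g' bg' dg]|k {}f _ [f' bf df]].
- exists (fun x => k * expinv ('X^2 * (p - p^`())) (k * x + c)).
    by apply: bumpyZ; exact: bumpy_expinv.
  move=> x.
  have da : is_derive x 1 (fun y : R => k * y + c) k.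
    rewrite [X in is_derive _ _ _ X](_ : k = k *: 1 + 0); last by rewrite addr0 /GRing.scale/= mulr1.
    exact: (@is_deriveD _ _ _ (fun y => k * y) (cst c)).
  apply: is_derive_eq (is_derive1_comp (is_derive_expinv p _) da) _.
  by rewrite mulrC.
- by exists (fun x => f' x + g' x) => [|x]; [exact: bumpyD|exact: is_deriveD].
- exists (fun x => f x * g' x + g x * f' x); last by move=> x; exact: is_deriveM.
  by apply: bumpyD; exact: bumpyM.
- by exists (fun x => k * f' x) => [|x]; [exact: bumpyZ|exact: is_deriveZ].
Qed.

Lemma bumpy_derivable f : bumpy f -> forall x, derivable f x 1.
Proof. by move=> /bumpy_derive[g _ df] x; have [] := df x. Qed.

Lemma bumpy_derive1 f : bumpy f -> bumpy (derive1 f).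
Proof.
move=> /bumpy_derive[g bg df]; rewrite (_ : derive1 f = g)//.
by apply/funext => x; rewrite derive1E; have [_ ->] := df x.
Qed.

Lemma bumpy_derive1n f n : bumpy f -> bumpy (derive1n n f).
Proof. by move=> bf; elim: n => // n IH; rewrite derive1nS; exact: bumpy_derive1. Qed.

Lemma bumpy_continuous f : bumpy f -> continuous f.
Proof.
move=> bf x; apply: differentiable_continuous.
by apply/derivable1_diffP; exact: bumpy_derivable.
Qed.

(** Vanishes outside []s, t[] for every [n]; the slope [n + 1] drives both factors to [1] inside, so
    the bumps tend to the indicator while staying in [[0, 1]]. *)
Definition itvbump s t (n : nat) x : R :=
  expinv 1 (n.+1%:R * x + - (n.+1%:R * s)) * expinv 1 (- n.+1%:R * x + n.+1%:R * t).

Lemma bumpy_itvbump s t n : bumpy (itvbump s t n).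
Proof. by apply: bumpyM; exact: bumpy_expinv. Qed.

Lemma expinv1_itv x : 0 <= expinv 1 x <= 1.
Proof.
rewrite /expinv; case: ifPn => x0; last by rewrite lexx ler01.
by rewrite hornerE mul1r expR_ge0/= expR_le1 oppr_le0 invr_ge0 ltW.
Qed.

Lemma itvbump01 s t n x : 0 <= itvbump s t n x <= 1.
Proof.
have /andP[a0 a1] := expinv1_itv (n.+1%:R * x + - (n.+1%:R * s)).
have /andP[b0 b1] := expinv1_itv (- n.+1%:R * x + n.+1%:R * t).
by rewrite /itvbump mulr_ge0//= mulr_ile1.
Qed.

Lemma itvbump_out s t n x : x <= s \/ t <= x -> itvbump s t n x = 0.
Proof.
rewrite /itvbump /expinv => -[xs|tx].
  rewrite ifF ?mul0r//; apply/negbTE; rewrite -leNgt -mulrBr.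
  by rewrite mulr_ge0_le0// subr_le0.
rewrite [X in _ * X]ifF ?mulr0//; apply/negbTE; rewrite -leNgt mulNr addrC -mulrBr.
by rewrite mulr_ge0_le0// subr_le0.
Qed.

Lemma itvbump_cvg s t x : s < x < t -> (fun n => itvbump s t n x) @ \oo --> (1 : R).
Proof.
move=> /andP[sx xt].
have H z : 0 < z -> (fun n : nat => expinv 1 (n.+1%:R * z)) @ \oo --> (1 : R).
  move=> z0; rewrite (_ : (fun _ => _) = fun n : nat => expR (- z^-1 * n.+1%:R^-1)).
    rewrite -[X in _ --> X]expR0 -(mulr0 (- z^-1)).
    apply: continuous_cvg; first exact: continuous_expR.
    by apply: cvgM; [exact: cvg_cst|exact: cvg_harmonic].
  apply/funext => n; rewrite /expinv ifT ?mulr_gt0// hornerE mul1r invfM.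
  by congr expR; rewrite mulNr mulrC.
rewrite -[X in _ --> X]mulr1; rewrite (_ : itvbump s t ^~ x = fun n : nat =>
  expinv 1 (n.+1%:R * (x - s)) * expinv 1 (n.+1%:R * (t - x))).
  by apply: cvgM; apply: H; rewrite subr_gt0.
apply/funext => n; rewrite /itvbump; congr (expinv _ _ * expinv _ _); ring.
Qed.

End SmoothBumps.

(** * Du Bois-Reymond lemma; weak derivatives as a.e. derivatives *)

Section WeakDerivatives.
Variable R : realType.
Local Notation mu := (@lebesgue_measure R).
Implicit Types (f g h u v w p psi chi : R -> R) (x y z c k s t e d l C L eps : R).

Lemma test_fun_derivable L psi : test_fun L psi -> forall x, derivable psi x 1.
Proof. by move=> [H _] x; exact: (H 0%N). Qed.

Lemma test_fun_derive1_cont L psi : test_fun L psi -> continuous (derive1 psi).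
Proof.
move=> [H _] x; apply: differentiable_continuous.
by apply/derivable1_diffP; exact: (H 1%N).
Qed.

Lemma test_fun_cont L psi : test_fun L psi -> continuous psi.
Proof.
move=> [H _] x; apply: differentiable_continuous.
by apply/derivable1_diffP; exact: (H 0%N).
Qed.

Lemma test_fun_0 L psi : test_fun L psi -> psi 0 = 0.
Proof. by move=> [_ [eps [e0 H]]]; apply: H; left. Qed.

Lemma test_fun_L L psi : test_fun L psi -> psi L = 0.
Proof. by move=> [_ [eps [e0 H]]]; apply: H; right; rewrite ltrBlDr ltrDl. Qed.

Lemma test_fun_prim L psi : 0 < L -> test_fun L psi -> prim 0 L psi (derive1 psi).
Proof.
move=> L0 H; apply: prim_derive; first exact: ltW.
  exact: test_fun_derivable H.
exact: test_fun_derive1_cont H.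
Qed.

Lemma itg_test_fun L psi : 0 < L -> test_fun L psi -> itg (derive1 psi) 0 L = 0.
Proof.
move=> L0 H; have := primB (test_fun_prim L0 H) (lexx 0) (ltW L0) (lexx L).
by rewrite (test_fun_0 H) (test_fun_L H) subrr => <-.
Qed.

Lemma L1_test_fun L psi h : 0 < L -> test_fun L psi -> L1 0 L h ->
  L1 0 L (fun t => h t * psi t).
Proof.
move=> L0 H ih; rewrite (_ : (fun _ => _) = fun t => psi t * h t).
  by apply: L1_mul_econt => //; [exact: ltW|apply: econtT; exact: test_fun_cont H].
by apply/funext => t; rewrite mulrC.
Qed.

Lemma L1_test_fun_derive1 L psi h : 0 < L -> test_fun L psi -> L1 0 L h ->
  L1 0 L (fun t => h t * derive1 psi t).
Proof.
move=> L0 H ih; rewrite (_ : (fun _ => _) = fun t => derive1 psi t * h t).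
  apply: L1_mul_econt => //; first exact: ltW.
  by apply: econtT; exact: test_fun_derive1_cont H.
by apply/funext => t; rewrite mulrC.
Qed.

(** The primitive vanishes to the left of the support; zero mean makes it vanish to the right as
    well. *)
Lemma primitive_test_fun L chi eps : bumpy chi -> 0 < eps ->
  (forall x, x < eps \/ L - eps < x -> chi x = 0) -> itg chi 0 L = 0 -> 0 < L ->
  exists2 psi, test_fun L psi & derive1 psi = chi.
Proof.
move=> bc e0 chi0 ic L0.
have cc := bumpy_continuous bc.
(* Integrating from [-oo] lets the fundamental theorem apply at every real point, as smoothness of a
   test function is required on all of [R]. *)
pose psi x : R := \int[mu]_(t in `]-oo, x]) chi t.
have ichi : L1 0 L chi by apply: econt_L1; [exact: ltW|exact: econtT].
have out (A : set R) : (forall x, 0 <= x <= L -> ~ A x -> chi x = 0) -> chi \_ A = chi \_ `[0, L].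
  move=> H; apply/funext => x; rewrite !patchE mem_setE in_itv/=.
  have [xL|xL] := boolP (0 <= x <= L).
    case: ifPn => // /negP xA; apply/esym/H => // Ax; apply: xA; exact: mem_set.
  have -> : chi x = 0.
    apply: chi0; move: xL; rewrite negb_and -!ltNge => /orP[x0|xL]; [left|right].
      exact: lt_trans e0.
    by apply: lt_trans xL; rewrite ltrBlDr ltrDl.
  by case: ifP.
have ichiT : mu.-integrable setT (EFin \o chi).
  have := (integrable_mkcond (mu := mu) (EFin \o chi) (measurable_itv `[0, L])).1 ichi.
  rewrite restrict_EFin -(out setT) ?patch_setT//.
  by move=> x _ /(_ I).
have psi0 x : x < eps -> psi x = 0.
  move=> xe; have -> : psi x = \int[mu]_(t in `]-oo, x]) 0.
    apply: eq_Rintegral => y; rewrite inE/= in_itv/= => yx.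
    by apply: chi0; left; exact: le_lt_trans xe.
  by rewrite Rintegral_cst// mul0r.
have psi1 x : L - eps < x -> psi x = 0.
  move=> xe; rewrite /psi Rintegral_mkcond (out [set` `]-oo, x]]) -?Rintegral_mkcond//.
  move=> y _; rewrite /= in_itv/= => /negP; rewrite -ltNge => xy.
  by apply: chi0; right; exact: lt_trans xy.
have dpsi x : derivable psi x 1 /\ derive1 psi x = chi x.
  apply: (@continuous_FTC1 _ chi -oo%O x (x + 1)) => //.
  - by rewrite ltrDl.
  - exact: integrableS ichiT.
  - exact: ltNyr.
  - exact: cc.
have E : derive1 psi = chi by apply/funext => x; case: (dpsi x).
exists psi => //; split; last first.
  by exists eps; split => // x [|]; [exact: psi0|exact: psi1].
case=> [|n] x; first by case: (dpsi x).
have -> : derive1n n.+1 psi = derive1n n chi by rewrite /derive1n iterSr E.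
by apply: bumpy_derivable; exact: bumpy_derive1n.
Qed.

Lemma itg_mul_itv L h s t : L1 0 L h -> 0 <= s -> s <= t -> t <= L ->
  itg (fun x => h x * (\1_`]s, t[ x)) 0 L = itg h s t.
Proof.
move=> ih s0 st tL.
have ih1 : L1 0 L (fun x => h x * (\1_`]s, t[ x)).
  apply: (L1_le (g := fun x => `|h x|)).
  - by apply: measM; [exact: L1_meas|exact: measurable_indic].
  - move=> x _; rewrite normrM ler_piMr//.
    by rewrite indicE; case: (_ \in _); rewrite ?normr1 ?normr0 ?ler01.
  - exact: L1_norm.
have out x y : 0 <= x -> x <= y -> y <= L -> (y <= s \/ t <= x) ->
    itg (fun x => h x * (\1_`]s, t[ x)) x y = 0.
  move=> x0 xy yL H; rewrite -[RHS](mul0r (y - x)) -(itg_cst _ xy); apply: eq_itg.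
  move=> r /andP[xr ry]; rewrite indicE memNset ?mulr0//= in_itv/=.
  move=> /andP[sr rt]; case: H => [ys|tx].
    by move: (lt_le_trans sr (le_trans ry ys)); rewrite ltxx.
  by move: (lt_le_trans rt (le_trans tx xr)); rewrite ltxx.
rewrite (itg_cat ih1 s0 (le_trans st tL)).
have -> : itg (fun x => h x * (\1_`]s, t[ x)) 0 s = 0.
  by apply: out => //; [exact: le_trans tL|left].
rewrite add0r (itg_cat (L1S ih1 s0 (lexx _)) st tL).
have -> : itg (fun x => h x * (\1_`]s, t[ x)) t L = 0.
  by apply: out => //; [exact: le_trans st|right].
rewrite addr0; apply: eq_itg_ae.
- exact: L1S ih1 _ _.
- exact: L1S ih _ _.
by apply: ae_all => x sxt; rewrite indicE mem_set ?mulr1//= in_itv.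
Qed.

Lemma itg_bump_cvg L h s t : L1 0 L h -> 0 <= s -> s <= t -> t <= L ->
  (fun n => itg (fun x => h x * itvbump s t n x) 0 L) @ \oo --> itg h s t.
Proof.
move=> ih s0 st tL; rewrite -(itg_mul_itv ih s0 st tL).
have mb n : meas 0 L (itvbump s t n).
  apply: econt_meas; apply: econtT; apply: bumpy_continuous.
  exact: bumpy_itvbump.
have [|||||_ //] := @itg_dominated _ 0 L (fun n x => h x * itvbump s t n x)
  (fun x => h x * (\1_`]s, t[ x)) (fun x => `|h x|).
- by move=> n; apply: measM => //; exact: L1_meas.
- by apply: measM; [exact: L1_meas|exact: measurable_indic].
- apply: ae_all => x _; apply: cvgM; first exact: cvg_cst.
  have [/andP[sx xt]|xst] := boolP (s < x < t).
    have -> : \1_`]s, t[ x = 1 :> R.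
      by rewrite indicE mem_set//= in_itv/= sx.
    by apply: itvbump_cvg; rewrite sx.
  have -> : \1_`]s, t[ x = 0 :> R.
    by rewrite indicE memNset//= in_itv/=; apply/negP.
  rewrite (_ : itvbump s t ^~ x = cst 0); first exact: cvg_cst.
  apply/funext => n; apply: itvbump_out; move: xst.
  by rewrite negb_and -!leNgt => /orP[|]; [left|right].
- exact: L1_norm.
- apply: ae_all => x _ n; rewrite normrM ler_piMr//.
  by have /andP[b0 b1] := itvbump01 s t n x; rewrite ger0_norm.
Qed.

(** Lebesgue differentiation: a.e., [h] is the derivative of its primitive, which is constant on
    []0, L[]. *)
Lemma ae_eq0_of_itg L h : L1 0 L h -> (forall x, 0 < x < L -> itg h 0 x = 0) ->
  {ae mu, forall t, 0 < t < L -> h t = 0}.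
Proof.
move=> ih h0; pose hL := h \_ `[0, L].
have ihT : mu.-integrable setT (EFin \o hL).
  by rewrite /hL -restrict_EFin; apply/(integrable_mkcond _ _).1.
have iy y : mu.-integrable `[0, y] (EFin \o hL) by exact: integrableS ihT.
have loc : locally_integrable setT hL by exact: open_integrable_locally openT ihT.
have := FTC1 iy loc; move=> H; apply: (ae_imply H) => x.
move=> + /andP[x0 xL].
have B : (0%:E < x%:E :> \bar R)%E by rewrite lte_fin.
move=> /(_ B)[_].
have -> : hL x = h x by rewrite /hL patchE mem_set//= in_itv/= !ltW.
move=> <-.
rewrite derive1E (@near_eq_derive _ _ _ _ (cst 0)) ?derive_cst//.
near=> y.
have y0 : 0 < y by near: y; exact: lt_nbhsr.
have yL : y < L by near: y; exact: lt_nbhsl.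
transitivity (itg h 0 y); last by apply: h0; rewrite y0.
apply: eq_Rintegral => z.
rewrite inE/= in_itv/= => /andP[z0 zy]; rewrite /hL patchE mem_set// /= in_itv/= z0.
by rewrite (le_trans zy)// ltW.
Unshelve. all: by end_near. Qed.

(** An arbitrary bump, corrected by a multiple of a fixed one to have zero mean, is an admissible
    [psi']. This gives [int (f - c) chi = 0] for every bump [chi]; bumps tend to indicators, so
    [f - c] has zero integral on every compact subinterval of []0, L[]. *)
Lemma du_Bois_Reymond L f : 0 < L -> L1 0 L f ->
  (forall psi, test_fun L psi -> itg (fun t => f t * derive1 psi t) 0 L = 0) ->
  exists c, {ae mu, forall t, 0 < t < L -> f t = c}.
Proof.
move=> L0 if_ H.
have Lc1 : L1 0 L (fun=> 1) by exact: L1_cst.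
have i1 chi : bumpy chi -> L1 0 L chi.
  by move=> bc; apply: econt_L1; [exact: ltW|apply/econtT/bumpy_continuous].
have if1 chi : bumpy chi -> L1 0 L (fun t => f t * chi t).
  move=> bc; rewrite (_ : (fun _ => _) = fun t => chi t * f t).
    by apply: L1_mul_econt => //; [exact: ltW|apply/econtT/bumpy_continuous].
  by apply/funext => t; rewrite mulrC.
have L3 : 0 < L / 3 by rewrite divr_gt0.
(* The integrals of these bumps tend to [L / 3], the length of the middle third. *)
have [n n0] : exists n, itg (itvbump (L / 3) (L * (2 / 3)) n) 0 L != 0.
  have /cvgrPdist_lt/(_ _ L3) : (fun n => itg (fun x => 1 *
      itvbump (L / 3) (L * (2 / 3)) n x) 0 L) @ \oo --> itg (fun=> 1) (L / 3) (L * (2 / 3)).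
    by apply: itg_bump_cvg => //; lra.
  move=> [n _ /(_ n (leqnn n))] /=; rewrite itg_cst; last lra.
  move=> K; exists n; apply: contraTN K => /eqP E.
  under eq_itg do rewrite mul1r; rewrite E -leNgt ger0_norm; lra.
set chi2 := itvbump (L / 3) (L * (2 / 3)) n.
have b2 : bumpy chi2 by exact: bumpy_itvbump.
(* The only possible constant: the average of [f] weighted by the fixed bump. *)
pose c := itg (fun t => f t * chi2 t) 0 L / itg chi2 0 L; exists c.
have key s t m : 0 < s -> t < L -> itg (fun x => (f x - c) * itvbump s t m x) 0 L = 0.
  move=> s0 tL; set chi1 := itvbump s t m.
  have b1 : bumpy chi1 by exact: bumpy_itvbump.
  (* [chi] has zero mean, so it is the derivative of a test function. *)
  pose chi x := itg chi2 0 L * chi1 x + - itg chi1 0 L * chi2 x.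
  have bc : bumpy chi by apply: bumpyD; exact: bumpyZ.
  pose eps := Num.min (Num.min s (L - t)) (L / 3).
  have [||||psi tpsi dpsi] := @primitive_test_fun L chi eps bc.
  - by rewrite !lt_min s0 subr_gt0 tL.
  - move=> x H'; rewrite /chi /chi1 /chi2 !itvbump_out ?mulr0 ?addr0//.
      case: H' => [xe|xe]; [left|right].
        by apply: ltW; apply: lt_le_trans xe _; rewrite ge_min lexx orbT.
      move: xe; rewrite /eps ltrBlDr -ltrBlDl; set E := Num.min _ _.
      have : E <= L / 3 by rewrite ge_min lexx orbT.
      lra.
    case: H' => [xe|xe]; [left|right].
      by apply: ltW; apply: lt_le_trans xe _; rewrite !ge_min lexx.
    move: xe; rewrite /eps; set E := Num.min _ (L / 3).
    have : E <= L - t by rewrite !ge_min lexx orbT.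
    lra.
  - rewrite /chi itgD; [|by apply: L1Z; exact: i1|by apply: L1Z; exact: i1].
    by rewrite (itgZ _ (i1 _ b1)) (itgZ _ (i1 _ b2)); ring.
  - exact: L0.
  have := H _ tpsi; rewrite dpsi /chi.
  under eq_itg do rewrite mulrDr mulrCA [X in _ + X]mulrCA.
  rewrite itgD; [|by apply: L1Z; exact: if1|by apply: L1Z; exact: if1].
  rewrite (itgZ _ (if1 _ b1)) (itgZ _ (if1 _ b2)) => E.
  rewrite (eq_itg (w' := fun x => f x * chi1 x - c * chi1 x)); last first.
    by move=> x _; rewrite mulrBl.
  rewrite itgB; [|exact: if1|by apply: L1Z; exact: i1].
  rewrite (itgZ _ (i1 _ b1)) /c; move: E n0.
  rewrite -/chi2; move: (itg chi2 0 L) (itg chi1 0 L) => I2 I1.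
  move: (itg _ 0 L) (itg _ 0 L) => J1 J2 E I20; apply: (mulfI I20).
  by rewrite mulr0 -[RHS]E; field.
have ifc : L1 0 L (fun x => f x - c) by apply: L1B => //; exact: L1_cst.
have zero s t : 0 < s -> s <= t -> t < L -> itg (fun x => f x - c) s t = 0.
  move=> s0 st tL.
  have := itg_bump_cvg ifc (ltW s0) st (ltW tL).
  under eq_fun do rewrite key//.
  by move=> /(cvg_unique _ (cvg_cst _)) => /(_ _) <-.
suff : {ae mu, forall t, 0 < t < L -> f t - c = 0}.
  move=> K; apply: (ae_imply K) => t + tL => /(_ tL) /eqP.
  by rewrite subr_eq0 => /eqP.
apply: ae_eq0_of_itg => // x /andP[x0 xL].
apply/eqP; rewrite -normr_le0; apply/ler_addgt0Pr => e e0; rewrite add0r.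
(* [zero] starts at a positive point; the missing piece next to [0] is small by absolute
   continuity. *)
have [d [d0 dP]] := itg_ac ifc e0.
pose s := Num.min x (d / 2).
have s0 : 0 < s by rewrite lt_min x0 divr_gt0.
have sx : s <= x by rewrite ge_min lexx.
have sL : s <= L by rewrite (le_trans sx)// ltW.
rewrite (itg_cat (L1S ifc (lexx _) (ltW xL)) (ltW s0) sx) (zero s x)// addr0.
apply: le_trans (itg_norm (L1S ifc (lexx _) sL)) _; apply: ltW; apply: dP => //.
  exact: ltW.
rewrite subr0 gt_min; apply/orP; right; lra.
Qed.

(** At a point of disagreement, [|u - v|] exceeds half of its value on a nondegenerate interval,
    where its integral should vanish. *)
Lemma econt_ae_eq a b u v : a < b -> econt a b u -> econt a b v ->
  {ae mu, forall t, a < t < b -> u t = v t} -> forall x, a <= x <= b -> u x = v x.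
Proof.
move=> ab cu cv uv x xab; apply/eqP; rewrite -subr_eq0; apply/negP => /negP ux.
pose w t := u t - v t.
have cw : econt a b w by apply: econtD => //; exact: econtN.
have wx : 0 < `|w x| / 2 by rewrite divr_gt0 ?normr_gt0.
have [d [d0 dP]] := cw x xab _ wx.
pose y := Num.max a (x - d / 2); pose z := Num.min b (x + d / 2).
have /andP[ax xb] := xab.
have ay : a <= y by rewrite le_max lexx.
have zb : z <= b by rewrite ge_min lexx.
have yx : y <= x by rewrite ge_max ax gerBl divr_ge0// ltW.
have xz : x <= z by rewrite le_min xb lerDl divr_ge0// ltW.
have yz : y < z.
  rewrite lt_min !gt_max ab/=; apply/andP; split; [|apply/andP; split]; lra.
have iw : L1 a b w by apply: econt_L1 => //; exact: ltW.
have : itg (fun=> `|w x| / 2) y z <= itg (fun t => `|w t|) y z.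
  apply: itg_le; first exact: L1_cst.
    by apply: L1S (L1_norm iw) _ _.
  apply: ae_all => t /andP[yt tz].
  have : `|w t - w x| < `|w x| / 2.
    apply: dP; first by rewrite (le_trans ay (ltW yt)) (le_trans (ltW tz) zb).
    move: yt tz; rewrite gt_max lt_min => /andP[_ +] /andP[_ +].
    by rewrite ltr_norml; lra.
  by have := ler_normD (w x - w t) (w t); rewrite subrK (distrC (w x)); lra.
rewrite itg_cst ?(ltW yz)// (_ : itg _ y z = itg (fun=> 0) y z).
  rewrite itg_cst ?(ltW yz)// mul0r leNgt mulr_gt0// subr_gt0//.
apply: eq_itg_ae; [by apply: L1S (L1_norm iw) _ _|exact: L1_cst|].
apply: (ae_imply uv) => t H /andP[yt tz].
rewrite /w H ?subrr ?normr0// (le_lt_trans ay yt) (lt_le_trans tz zb)//.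
Qed.

Lemma weak_derivP L u w : 0 < L -> econt 0 L u -> L2 L w ->
  (forall psi, test_fun L psi ->
    (\int[mu]_(x in `[0%R, L]) (u x * derive1 psi x)%:E =
     - \int[mu]_(x in `[0%R, L]) (w x * psi x)%:E)%E) <->
  (forall psi, test_fun L psi -> itg (fun x => u x * derive1 psi x) 0 L =
     - itg (fun x => w x * psi x) 0 L).
Proof.
move=> L0 cu /L2P/sqi_L1 iw; have iu := econt_L1 (ltW L0) cu.
by split => H psi tp; have := H _ tp;
  rewrite -(itgE (L1_test_fun_derive1 L0 tp iu)) -(itgE (L1_test_fun L0 tp iw));
  [move=> -[]|move=> ->].
Qed.

(** By parts, [u] minus the primitive [W] of [w] is orthogonal to every [psi']. It is thus a.e.
    constant, constant everywhere by continuity, and equal to [u 0]. *)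
Lemma weak_deriv_prim L u w : 0 < L -> econt 0 L u -> weak_deriv L u w ->
  prim 0 L u w.
Proof.
move=> L0 cu [L2w /(weak_derivP L0 cu L2w) H].
have iw : L1 0 L w by exact/sqi_L1/L2P.
pose W x := itg w 0 x.
have pW : prim 0 L W w.
  by split => // x /andP[x0 xL]; rewrite /W itg_xx add0r.
have cW := prim_econt pW.
have cuW : econt 0 L (fun t => u t - W t) by apply: econtD => //; exact: econtN.
have iu := econt_L1 (ltW L0) cu; have iW := econt_L1 (ltW L0) cW.
have [||c cP] := @du_Bois_Reymond L (fun t => u t - W t) L0.
- exact: econt_L1 (ltW L0) cuW.
- move=> psi tp; under eq_itg do rewrite mulrBl.
  rewrite itgB ?H//; [|exact: L1_test_fun_derive1|exact: L1_test_fun_derive1].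
  have := prim_parts (ltW L0) pW (test_fun_prim L0 tp).
  by rewrite (test_fun_0 tp) (test_fun_L tp) !mulr0 subrr; lra.
split => // x xL.
have K := econt_ae_eq L0 cuW (econtT (@cst_continuous _ _ c)) cP.
have := K x xL; have := K 0; rewrite lexx ltW// => /(_ isT).
by rewrite /W itg_xx /=; lra.
Qed.

Lemma prim_weak_deriv L u w : 0 < L -> prim 0 L u w -> sqi 0 L w -> weak_deriv L u w.
Proof.
move=> L0 pu iw; have L2w : L2 L w by exact/L2P.
split => //; apply/(weak_derivP L0 (prim_econt pu) L2w) => psi tp.
have := prim_parts (ltW L0) pu (test_fun_prim L0 tp).
by rewrite (test_fun_0 tp) (test_fun_L tp) !mulr0 subrr; lra.
Qed.

End WeakDerivatives.

(** * The regular Cauchy problem: comparison, Picard iteration, energy *)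

Section CauchyProblem.
Variable R : realType.
Local Notation mu := (@lebesgue_measure R).
Implicit Types (f u v w F : R -> R) (x y z c k s t e d l C lam : R).
Variables (L bl bu : R) (b g : R -> R).
Hypotheses (L0 : 0 < L) (bl0 : 0 < bl) (mb : meas 0 L b).
Hypothesis bP : forall x, bl <= b x <= bu.
Hypothesis gP : sqi 0 L g.

(** The equation [a u' = F(u) + g + c] solved for [u'], with [b] in the role of [1/a]. *)
Definition rhs F c u t : R := b t * (F (u t) + g t + c).
Definition sol F c u : Prop := prim 0 L u (rhs F c u) /\ u 0 = 0.

Let L0' : 0 <= L. Proof. exact: ltW. Qed.
Let b0 x : 0 <= b x. Proof. by have /andP[+ _] := bP x; apply: le_trans; exact: ltW. Qed.
Let bub x : b x <= bu. Proof. by case/andP : (bP x). Qed.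
Let bu0 : 0 <= bu. Proof. exact: le_trans (bub 0). Qed.
Let b_norm x : `|b x| <= bu. Proof. by rewrite ger0_norm. Qed.

Lemma rhs_L1 F c u : L1 0 L (F \o u) -> L1 0 L (rhs F c u).
Proof.
move=> iF; have iG : L1 0 L (fun t => F (u t) + g t + c).
  by apply: L1D; [apply: L1D => //; exact: sqi_L1|exact: L1_cst].
apply: (L1_le (g := fun t => bu * `|F (u t) + g t + c|)).
- by apply: measM => //; exact: L1_meas.
- by move=> t _; rewrite normrM ler_wpM2r.
- by apply: L1Z; exact: L1_norm.
Qed.

Lemma rhs_sqi F c u : sqi 0 L (F \o u) -> sqi 0 L (rhs F c u).
Proof.
move=> iF; apply: (sqiM (k := bu)) => //.
by apply: sqiD; [exact: sqiD|exact: sqi_cst].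
Qed.

Lemma sol_econt F c u : sol F c u -> econt 0 L u.
Proof. by case=> /prim_econt. Qed.

Lemma solE F c u x : sol F c u -> 0 <= x <= L -> u x = itg (rhs F c u) 0 x.
Proof. by move=> [[_ pu] u0] xL; rewrite pu// u0 add0r. Qed.

(** [u1 - u2 - bu k x] starts at [0] and does not increase where it is positive. For [k = 0] this
    gives uniqueness and monotonicity in [n] and [c]; for [k = c' - c] it gives the Lipschitz bound
    in [c]. *)
Lemma sol_le F1 F2 c1 c2 u1 u2 k : 0 <= k -> sol F1 c1 u1 -> sol F2 c2 u2 ->
  {ae mu, forall t, 0 < t < L -> u2 t < u1 t ->
    F1 (u1 t) + c1 <= F2 (u2 t) + c2 + k} ->
  forall x, 0 <= x <= L -> u1 x <= u2 x + bu * k * x.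
Proof.
move=> k0 [p1 u10] [p2 u20] H x xL.
have p := primD (primD p1 (primN p2)) (primN (prim_lin 0 L (bu * k))).
suff : u1 x + - u2 x + - (bu * k * x) <= 0 by lra.
apply: (prim_le0 p _ (ltr01)) xL; first by rewrite u10 u20; lra.
apply: (ae_imply H) => t + tL /andP[ut _] => /(_ tL).
have /andP[/ltW t0 _] := tL.
have : 0 <= bu * k * t by rewrite !mulr_ge0.
move=> kt /(_ _) Ft; rewrite /rhs.
have {}Ft : F1 (u1 t) + c1 <= F2 (u2 t) + c2 + k by apply: Ft; lra.
rewrite (_ : _ + _ = b t * (F1 (u1 t) + c1 - (F2 (u2 t) + c2)) - bu * k); last ring.
rewrite subr_le0; apply: (@le_trans _ _ (b t * k)); last by rewrite ler_wpM2r.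
by rewrite ler_wpM2l//; lra.
Qed.

Lemma rhsB_le F1 F2 c u v k x : L1 0 L (F1 \o u) -> L1 0 L (F2 \o v) ->
  0 <= x <= L -> (forall t, 0 <= t <= L -> `|F1 (u t) - F2 (v t)| <= k) ->
  `|itg (rhs F1 c u) 0 x - itg (rhs F2 c v) 0 x| <= bu * k * x.
Proof.
move=> iu iv /andP[x0 xL] H.
have i1 := L1S (rhs_L1 c iu) (lexx 0) xL.
have i2 := L1S (rhs_L1 c iv) (lexx 0) xL.
rewrite -itgB// -[X in _ <= _ * X](subr0 x) -(itg_cst _ x0).
apply: itg_norm_le; [exact: L1B|exact: L1_cst|].
move=> t /andP[t0 tx]; rewrite /rhs -mulrBr normrM.
apply: ler_pM => //; rewrite (_ : _ - _ = F1 (u t) - F2 (v t)); last ring.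
by apply: H; rewrite t0 (le_trans tx).
Qed.

Lemma itg_expR k x : 0 < k -> 0 <= x ->
  itg (fun t => expR (k * t)) 0 x = k^-1 * (expR (k * x) - 1).
Proof.
move=> k0 x0.
have de t : is_derive t 1 (fun t => k^-1 * expR (k * t)) (expR (k * t)).
  have dk : is_derive t 1 (fun t : R => k * t) k.
    rewrite [X in is_derive _ _ _ X](_ : k = k *: 1); last by rewrite /GRing.scale/= mulr1.
    exact: is_deriveZ.
  have d1 : is_derive t 1 (fun t => expR (k * t)) (expR (k * t) * k).
    exact: (@is_derive1_comp _ expR (fun t => k * t)).
  apply: is_derive_eq (is_deriveZ _ d1) _.
  by rewrite /GRing.scale/= mulrCA mulVf ?mulr1// gt_eqF.
have dE : derive1 (fun t => k^-1 * expR (k * t)) = fun t => expR (k * t).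
  by apply/funext => t; rewrite derive1E; have [_ ->] := de t.
have p : prim 0 x (fun t => k^-1 * expR (k * t)) (derive1 (fun t => k^-1 * expR (k * t))).
  apply: prim_derive; [exact: x0|by move=> t; have [] := de t|].
  rewrite dE => t; apply: continuous_comp; last exact: continuous_expR.
  exact: mulrl_continuous.
have := primB p (lexx 0) x0 (lexx x); rewrite dE => <-.
by rewrite mulr0 expR0 mulrBr.
Qed.

Section Picard.
Variables (F : R -> R) (c lam : R).
Hypothesis lam0 : 0 <= lam.
Hypothesis Flip : forall s t, `|F s - F t| <= lam * `|s - t|.

Lemma lipschitz_econt x y u : econt x y u -> econt x y (F \o u).
Proof.
move=> cu z zxy e e0; have l0 : 0 < lam + 1 by rewrite ltr_wpDl.
have [d [d0 dP]] := cu z zxy _ (divr_gt0 e0 l0).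
exists d; split => // t txy tz; apply: le_lt_trans (Flip _ _) _.
have := dP t txy tz; rewrite ltr_pdivlMr//; apply: le_lt_trans.
by rewrite mulrC ler_wpM2l// lerDl.
Qed.

Fixpoint picard (n : nat) : R -> R :=
  if n is n'.+1 then fun x => itg (rhs F c (picard n')) 0 x else fun=> 0.

Lemma picardS n x : picard n.+1 x = itg (rhs F c (picard n)) 0 x.
Proof. by []. Qed.

Lemma picard_econt n : econt 0 L (picard n).
Proof.
elim: n => [|n IH]; first exact/econtT/cst_continuous.
have i : L1 0 L (rhs F c (picard n)).
  by apply: rhs_L1; apply: econt_L1 => //; exact: lipschitz_econt.
by apply: (@prim_econt _ _ _ _ (rhs F c (picard n))); split => // x _; rewrite /= itg_xx add0r.
Qed.

Lemma picard_L1 n : L1 0 L (F \o picard n).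
Proof. by apply: econt_L1 => //; apply: lipschitz_econt; exact: picard_econt. Qed.

(** In the supremum norm weighted by [exp(-k x)], the Picard map contracts by [bu lam / k <= 1/2],
    so one pass covers all of [[0, L]]. *)
Lemma picard_step : exists M, 0 <= M /\ forall n x, 0 <= x <= L ->
  `|picard n.+1 x - picard n x| <= M * 2^-1 ^+ n.
Proof.
have [C [C0 CP]] := econt_bounded L0' (picard_econt 1).
pose k := 2 * (bu * lam + 1).
have bl' : 0 <= bu * lam by rewrite mulr_ge0.
have k0 : 0 < k by rewrite /k; lra.
suff H n x : 0 <= x <= L -> `|picard n.+1 x - picard n x| <= C * 2^-1 ^+ n * expR (k * x).
  exists (C * expR (k * L)); split; first by rewrite mulr_ge0// expR_ge0.
  move=> n x xL; apply: le_trans (H n x xL) _; rewrite mulrAC ler_wpM2r ?exprn_ge0//.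
  by rewrite ler_wpM2l// ler_expR ler_wpM2l ?(ltW k0)//; case/andP : xL.
elim: n x => [|n IH] x xL.
  rewrite subr0 expr0 mulr1; apply: le_trans (CP x xL) _.
  rewrite ler_peMr// -expR0 ler_expR mulr_ge0 ?(ltW k0)//; by case/andP : xL.
have /andP[x0 xL'] := xL.
have i m := L1S (rhs_L1 c (picard_L1 m)) (lexx 0) xL'.
pose D := C * 2^-1 ^+ n.
have D0 : 0 <= D by rewrite mulr_ge0// exprn_ge0.
have iexp : L1 0 x (fun t => expR (k * t)).
  apply: econt_L1 => //; apply: econtT => t; apply: continuous_comp.
    exact: mulrl_continuous.
  exact: continuous_expR.
rewrite (picardS n.+1) (picardS n) -(itgB (i _) (i _)).
apply: (@le_trans _ _ (itg (fun t => bu * lam * D * expR (k * t)) 0 x)).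
  apply: itg_norm_le; [by apply: L1B; exact: i|exact: L1Z|].
  move=> t /andP[t0 tx]; rewrite /rhs -mulrBr normrM -(mulrA (bu * lam) D) -(mulrA bu lam).
  apply: ler_pM => //.
  rewrite (_ : _ - _ = F (picard n.+1 t) - F (picard n t)); last ring.
  apply: le_trans (Flip _ _) _; rewrite ler_wpM2l//.
  by apply: IH; rewrite t0 (le_trans tx).
rewrite itgZ// itg_expR// exprS.
rewrite (_ : C * (2^-1 * 2^-1 ^+ n) * expR (k * x) = D * (2^-1 * expR (k * x))); last first.
  by rewrite /D; ring.
have -> : bu * lam * D * (k^-1 * (expR (k * x) - 1)) =
  D * (lam * bu / k * (expR (k * x) - 1)) by ring.
rewrite ler_wpM2l//.
have E1 := expR_gt0 (k * x).
have : lam * bu / k <= 2^-1 by rewrite ler_pdivrMr// /k; lra.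
have : 0 <= lam * bu / k by apply: divr_ge0; [exact: mulr_ge0|exact: ltW].
set q := lam * bu / k => q0 q1.
have : q * expR (k * x) <= 2^-1 * expR (k * x) by rewrite ler_wpM2r// ltW.
by rewrite mulrBr mulr1; lra.
Qed.

Lemma picard_sol : exists u, sol F c u.
Proof.
have [M [M0 MP]] := picard_step.
(* The tail from [n] on of the geometric majorant of the increments. Hence [picard n - q n] is
   nondecreasing and [picard n + q n] nonincreasing: nested intervals around the limit. *)
pose q n : R := 2 * M * 2^-1 ^+ n.
have qS n : q n - q n.+1 = M * 2^-1 ^+ n by rewrite /q exprS; lra.
have q0 n : 0 <= q n by rewrite /q !mulr_ge0// exprn_ge0.
have qc : q @ \oo --> (0 : R).
  rewrite -(mulr0 (2 * M)); apply: cvgM; first exact: cvg_cst.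
  by apply: cvg_expr; rewrite ger0_norm// invf_lt1// ltr1n.
have qn n : q n <= q 0%N.
  by rewrite /q expr0 ler_wpM2l ?mulr_ge0// exprn_ile1// invf_le1 ?ler1n.
pose lo x n := picard n x - q n; pose hi x n := picard n x + q n.
have lohi x n : lo x n <= hi x n by rewrite /lo /hi; have := q0 n; lra.
have lo_nd x : 0 <= x <= L -> nondecreasing_seq (lo x).
  move=> xL; apply/nondecreasing_seqP => n; rewrite /lo.
  by have := MP n x xL; have := qS n; rewrite ler_norml; lra.
have hi_ni x : 0 <= x <= L -> nonincreasing_seq (hi x).
  move=> xL; apply/nonincreasing_seqP => n; rewrite /hi.
  by have := MP n x xL; have := qS n; rewrite ler_norml; lra.
pose u x := limn (lo x).
have lo_cv x : 0 <= x <= L -> lo x @ \oo --> u x.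
  move=> xL; apply: nondecreasing_is_cvgn; first exact: lo_nd.
  exists (hi x 0%N) => _ [n _ <-].
  by apply: le_trans (lohi x n) _; exact: (hi_ni x xL 0%N n (leq0n n)).
have up x n : 0 <= x <= L -> `|u x - picard n x| <= q n.
  move=> xL; rewrite ler_distl; apply/andP; split.
    exact: (nondecreasing_cvgn_le (lo_nd x xL) (lo_cv x xL)).
  apply: (limr_le (lo_cv x xL)); near=> m.
  have nm : (n <= m)%N by near: m; exact: nbhs_infty_ge.
  by apply: le_trans (lohi x m) _; exact: (hi_ni x xL n m nm).
have cu : econt 0 L u.
  move=> x xL e e0; have e30 : 0 < e / 3 by rewrite divr_gt0.
  have /cvgrPdist_lt/(_ _ e30)[n _ /(_ n (leqnn n))] := qc.
  rewrite sub0r normrN ger0_norm// => qe.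
  have [d [d0 dP]] := picard_econt n xL e30.
  exists d; split => // y yL yx.
  have := dP y yL yx; have := up x n xL; have := up y n yL.
  by rewrite !ler_norml !ltr_norml; lra.
have iFu : L1 0 L (F \o u) by apply: econt_L1 => //; exact: lipschitz_econt.
have uE x : 0 <= x <= L -> u x = itg (rhs F c u) 0 x.
  move=> xL; have /andP[x0 xL'] := xL.
  have H n : `|u x - itg (rhs F c u) 0 x| <= q n.+1 + bu * (lam * q n) * x.
    rewrite -[u x](subrK (picard n.+1 x)) -addrA.
    apply: le_trans (ler_normD _ _) _; apply: lerD; first exact: up.
    apply: rhsB_le => //; first exact: picard_L1.
    move=> t tL; apply: le_trans (Flip _ _) _; rewrite ler_wpM2l// distrC.
    exact: up.
  apply/eqP; rewrite -subr_eq0 -normr_le0.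
  have cv : (fun n => q n.+1 + bu * (lam * q n) * x) @ \oo --> (0 + bu * (lam * 0) * x).
    apply: cvgD; first by rewrite (cvg_shiftS q).
    apply: cvgM; last exact: cvg_cst.
    by apply: cvgM; [exact: cvg_cst|apply: cvgM => //; exact: cvg_cst].
  rewrite !mulr0 mul0r addr0 in cv.
  apply/ler_addgt0Pr => e e0; rewrite add0r.
  have /cvgrPdist_lt/(_ _ e0)[n _ /(_ n (leqnn n)) K] := cv.
  apply: le_trans (H n) _; apply: ltW; apply: le_lt_trans K.
  by rewrite distrC subr0 ler_norm.
exists u; split; last by rewrite uE ?itg_xx// lexx.
split; first exact: rhs_L1.
move=> x xL; rewrite (uE x xL) (uE 0) ?lexx// itg_xx add0r.
Unshelve. all: by end_near. Qed.

Lemma lipschitz_continuous : continuous F.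
Proof.
move=> s; have l0 : 0 < lam + 1 by rewrite ltr_wpDl.
apply/cvgrPdist_lt => e e0; apply/nbhs_ballP.
exists (e / (lam + 1)); first exact: divr_gt0.
move=> t; rewrite /ball/= ltr_pdivlMr// => st; apply: le_lt_trans (Flip _ _) _.
by apply: le_lt_trans st; rewrite mulrC ler_wpM2l// lerDl.
Qed.

(* Testing the equation with [u' = b (F u + g + c)] makes the term [(F u + c) u']
   an exact derivative. *)
Lemma sol_energy u : sol F c u -> (forall s, s <= 0 -> 0 <= F s + c) -> u L <= 0 ->
  itg (fun t => rhs F c u t ^+ 2) 0 L <= bu ^+ 2 * itg (fun t => g t ^+ 2) 0 L.
Proof.
move=> su Fc uL; have [pu u0] := su; have cu := sol_econt su.
have [B [B0 BP]] := econt_bounded L0' cu.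
pose Fp s := F s + c.
have cFp : continuous Fp by move=> s; apply: cvgD; [exact: lipschitz_continuous|exact: cvg_cst].
have iFp x y : x <= y -> L1 x y Fp by move=> xy; apply: econt_L1 => //; exact: econtT.
(* The base point lies strictly below the range of [u], so [Phi] is differentiable at every value
   taken. *)
pose Phi s := itg Fp (- (B + 1)) s.
have Buy x : 0 <= x <= L -> - (B + 1) < u x.
  by move=> /BP; rewrite ler_norml => /andP[+ _]; lra.
have dPhi s : - (B + 1) < s -> derivable Phi s 1 /\ derive1 Phi s = Fp s.
  move=> Bs; apply: (@continuous_FTC1_closed _ Fp (- (B + 1)) s (s + 1)).
  - by rewrite ltrDl.
  - by apply: iFp; lra.
  - exact: Bs.
  - exact: cFp.
have ch := @prim_chain _ 0 L u _ Phi Fp L0' pu.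
have {}ch : itg (fun t => Fp (u t) * rhs F c u t) 0 L = Phi (u L) - Phi (u 0).
  apply: ch; first by apply: econt_comp cu => x _; exact: cFp.
  move=> x xL e e0; have [dx <-] := dPhi _ (Buy x xL).
  exact: derive1_approx.
have LL : 0 <= L <= L by rewrite L0' lexx.
(* The exact derivative integrates to minus the integral of [F + c] over [[u L, 0]], where [F + c]
   is nonnegative. *)
have le0 : itg (fun t => Fp (u t) * rhs F c u t) 0 L <= 0.
  rewrite ch u0 /Phi; have BL := Buy L LL.
  rewrite (itg_cat (iFp _ 0 _) (ltW BL) uL); last lra.
  rewrite subr_le0 lerDl; apply: itg_ge0; first exact: iFp.
  by apply: ae_all => s /andP[_ /ltW]; exact: Fc.
have sF : sqi 0 L (F \o u) by apply: sqi_econt => //; exact: lipschitz_econt.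
have [_ i2] := rhs_sqi c sF; have [_ ig2] := gP.
have bu1 : 0 < bu by apply: lt_le_trans bl0 _; have /andP[h1 h2] := bP 0; exact: le_trans h1 h2.
(* With [A = F u + g + c] one has [(F u + c) u' = b A (A - g)]. Here [b A^2 >= (b A)^2 / bu], and
   Young absorbs the product with [g] into half of it. *)
have : itg (fun t => (2 * bu)^-1 * rhs F c u t ^+ 2 - bu / 2 * g t ^+ 2) 0 L <= 0.
  apply: le_trans le0; apply: itg_le.
  - by apply: L1B; exact: L1Z.
  - apply: L1_mul_econt => //; last exact: (proj1 pu).
    by apply: econt_comp cu => x _; exact: cFp.
  apply: ae_all => t _; rewrite /rhs /Fp.
  set A := F (u t) + g t + c; have -> : F (u t) + c = A - g t by rewrite /A; ring.
  have /andP[h1 h2] := bP t; have bt0 : 0 < b t by exact: lt_le_trans h1.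
  rewrite -(@ler_pM2l _ (2 * bu)) ?mulr_gt0//.
  have -> : 2 * bu * ((2 * bu)^-1 * (b t * A) ^+ 2 - bu / 2 * g t ^+ 2) =
      (b t * A) ^+ 2 - bu ^+ 2 * g t ^+ 2 by field; rewrite gt_eqF.
  have := sqr_ge0 (b t * A - bu * g t).
  have : 0 <= b t * (bu - b t) * A ^+ 2 by rewrite mulr_ge0 ?sqr_ge0// mulr_ge0// subr_ge0.
  nra.
rewrite itgB; [|exact: L1Z|exact: L1Z].
rewrite !itgZ// subr_le0 -(@ler_pM2l _ (2 * bu)) ?mulr_gt0//.
rewrite mulVKf; last by rewrite gt_eqF// mulr_gt0.
by move=> H; apply: le_trans H _; rewrite le_eqVlt; apply/orP; left; apply/eqP; field.
Qed.

End Picard.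

End CauchyProblem.

(** * Increasing Lipschitz approximations of a nonincreasing function *)

Section LipschitzRegularization.
Variable R : realType.
Implicit Types (s t r k e d : R) (n p : nat).
Variables (f : R -> R) (m : R).
Hypothesis fm : forall s, 0 < s -> m <= f s.

(* Pasch-Hausdorff regularization with slope [n]; penalizing only the points to the
   right of [s] loses nothing because [f] is nonincreasing. *)
Definition lipreg n s : R :=
  inf [set f t + n%:R * Num.max (t - s) 0 | t in [set t | 0 < t]].

Let S n s := [set f t + n%:R * Num.max (t - s) 0 | t in [set t : R | 0 < t]].

Let S_lb n s : lbound (S n s) m.
Proof.
move=> _ [t t0 <-]; rewrite -[m]addr0 lerD ?fm// mulr_ge0//.
by rewrite le_max lexx orbT.
Qed.

Let S_inf n s : has_inf (S n s).
Proof.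
split; last by exists m; exact: S_lb.
by exists (f 1 + n%:R * Num.max (1 - s) 0); exists 1 => //=.
Qed.

Lemma lipreg_le_gen n s t : 0 < t -> lipreg n s <= f t + n%:R * Num.max (t - s) 0.
Proof. by move=> t0; apply: ge_inf; [case: (S_inf n s)|exists t]. Qed.

Lemma le_lipreg n s k : (forall t, 0 < t -> k <= f t + n%:R * Num.max (t - s) 0) ->
  k <= lipreg n s.
Proof.
move=> H; apply: lb_le_inf; first by case: (S_inf n s).
by move=> _ [t t0 <-]; exact: H.
Qed.

Lemma lipreg_le n s : 0 < s -> lipreg n s <= f s.
Proof.
by move=> s0; apply: le_trans (lipreg_le_gen n s s0) _; rewrite subrr maxxx mulr0 addr0.
Qed.

Lemma lipreg_noninc n s t : s <= t -> lipreg n t <= lipreg n s.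
Proof.
move=> st; apply: le_lipreg => r r0; apply: le_trans (lipreg_le_gen n t r0) _.
rewrite lerD2l ler_wpM2l// ge_max !le_max lexx !orbT andbT.
by apply/orP; left; rewrite lerD2l lerN2.
Qed.

Lemma lipreg_nondec n p s : (n <= p)%N -> lipreg n s <= lipreg p s.
Proof.
move=> np; apply: le_lipreg => r r0; apply: le_trans (lipreg_le_gen n s r0) _.
by rewrite lerD2l ler_wpM2r ?ler_nat// le_max lexx orbT.
Qed.

Lemma lipreg_lip n s t : `|lipreg n s - lipreg n t| <= n%:R * `|s - t|.
Proof.
suff H s' t' : lipreg n s' <= lipreg n t' + n%:R * `|s' - t'|.
  by rewrite ler_distl; have := H s t; have := H t s; rewrite (distrC t); lra.
rewrite -lerBlDr; apply: le_lipreg => r r0; rewrite lerBlDr -addrA -mulrDr.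
apply: le_trans (lipreg_le_gen n s' r0) _; rewrite lerD2l ler_wpM2l//.
have h := ler_norm (t' - s'); have h' := normr_ge0 (s' - t').
rewrite distrC in h.
have : Num.max (r - t') 0 >= r - t' by rewrite le_max lexx.
have : Num.max (r - t') 0 >= 0 by rewrite le_max lexx orbT.
by rewrite ge_max; move=> ? ?; apply/andP; split; lra.
Qed.

(** Competitors up to [s + r] are bounded by assumption; those beyond pay the penalty [n r] on top
    of [m]. *)
Lemma lipreg_ge n s r k : 0 <= r -> (forall t, 0 < t -> t <= s + r -> k <= f t) ->
  k <= m + n%:R * r -> k <= lipreg n s.
Proof.
move=> r0 H kr; apply: le_lipreg => t t0; have [tr|rt] := leP t (s + r).
  by rewrite -[k]addr0 lerD ?H// mulr_ge0// le_max lexx orbT.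
apply: le_trans kr _; apply: lerD; first exact: fm.
by rewrite ler_wpM2l// le_max; apply/orP; left; lra.
Qed.

Lemma lipreg_large s r k : 0 < r -> (forall t, 0 < t -> t <= s + r -> k <= f t) ->
  exists N, forall n, (N <= n)%N -> k <= lipreg n s.
Proof.
move=> r0 H; have [N NP] : exists N : nat, k - m <= N%:R * r.
  exists (Num.truncn (Num.max ((k - m) / r) 0)).+1.
  rewrite -ler_pdivrMr//; apply: ltW; apply: le_lt_trans (truncnS_gt _).
  by rewrite le_max lexx.
exists N => n Nn; apply: (lipreg_ge (ltW r0) H).
rewrite -lerBlDl; apply: le_trans NP _.
by rewrite ler_wpM2r ?(ltW r0)// ler_nat.
Qed.

Hypothesis fni : forall s t, 0 < s -> s <= t -> f t <= f s.

(** Squeeze: [lipreg n (s_ n) <= f (s_ n)] from above, and from below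
    [lipreg n (s_ n) >= lipreg n s], since [s_ n <= s]. The approximate solutions increase to their
    limit, which provides this inequality. *)
Lemma lipreg_cvg (s_ : nat -> R) s : 0 < s -> {for s, continuous f} ->
  (forall n, s_ n <= s) -> s_ @ \oo --> s -> (fun n => lipreg n (s_ n)) @ \oo --> f s.
Proof.
move=> s0 cf s_le s_cvg; apply/cvgrPdist_lt => e e0.
have e20 : 0 < e / 2 by rewrite divr_gt0.
have /cvgrPdist_lt/(_ _ e20)/nbhs_ballP[d /= d0 dP] := cf.
have [||N NP] := @lipreg_large s (d / 2) (f s - e / 2).
- by rewrite divr_gt0.
- move=> t t0 td; have [ts|st] := leP t s; first by have := fni t0 ts; lra.
  have : `|f s - f t| < e / 2.
    by apply: dP; rewrite /ball/= distrC ger0_norm ?subr_ge0 ?(ltW st)//; lra.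
  by rewrite ltr_norml; lra.
near=> n.
have sn0 : 0 < s_ n.
  near: n; have /cvgrPdist_lt/(_ _ s0) := s_cvg; apply: filterS => n.
  by rewrite ltr_norml; lra.
have h1 : `|f s - f (s_ n)| < e / 2.
  apply: dP; rewrite /ball/=; near: n.
  by have /cvgrPdist_lt/(_ _ d0) := s_cvg.
have h2 : f s - e / 2 <= lipreg n s by apply: NP; near: n; exact: nbhs_infty_ge.
have h3 := lipreg_le n sn0; have h4 := lipreg_noninc n (s_le n).
by move: h1; rewrite !ltr_norml; lra.
Unshelve. all: by end_near. Qed.

End LipschitzRegularization.

Lemma cvg_addn (R : realType) (N : nat) (u_ : nat -> R) (l : R) :
  u_ @ \oo --> l -> (fun n => u_ (n + N)%N) @ \oo --> l.
Proof. by rewrite (cvg_shiftn N u_). Qed.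

(** * The singular problem: approximation, admissible constants, limit *)

Section SingularProblem.
Variable R : realType.
Local Notation mu := (@lebesgue_measure R).
Implicit Types (u v w : R -> R) (x y z c k s t e d l C : R).
Variables (L bl bu : R) (b g f : R -> R) (m : R).
Hypotheses (L0 : 0 < L) (bl0 : 0 < bl) (mb : meas 0 L b).
Hypothesis bP : forall x, bl <= b x <= bu.
Hypothesis gP : sqi 0 L g.
Hypothesis gM : forall eta, 0 < eta -> eta < L -> exists M,
  {ae mu, forall t, 0 < t < L - eta -> - M <= g t}.
Hypothesis mf : measurable_fun setT f.
Hypothesis fm : forall s, 0 < s -> m <= f s.
Hypothesis fni : forall s t, 0 < s -> s <= t -> f t <= f s.
Hypothesis fcont : forall s, 0 < s -> {for s, continuous f}.
Hypothesis finf : forall k, exists d, 0 < d /\ forall s, 0 < s -> s <= d -> k <= f s.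

Let L0' : 0 <= L. Proof. exact: ltW. Qed.
Let b0 x : 0 < b x. Proof. by have /andP[+ _] := bP x; apply: lt_le_trans. Qed.
Let bu0 : 0 < bu. Proof. by apply: lt_le_trans (b0 0) _; case/andP : (bP 0). Qed.

Local Notation rhs := (rhs b g).
Local Notation sol := (sol L b g).

Let un_ex n c : exists u, sol (lipreg f n) c u.
Proof.
by apply: (picard_sol L0 bl0 mb bP gP c (ler0n _ n)); exact: lipreg_lip fm n.
Qed.

Definition appsol n c : R -> R := projT1 (cid (un_ex n c)).

Lemma appsolP n c : sol (lipreg f n) c (appsol n c).
Proof. exact: projT2 (cid (un_ex n c)). Qed.

Lemma appsol_nondec n p c x : (n <= p)%N -> 0 <= x <= L -> appsol n c x <= appsol p c x.
Proof.
move=> np xL; have := sol_le bl0 bP (lexx 0) (appsolP n c) (appsolP p c).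
rewrite mulr0; move=> /(_ _ x xL); rewrite mul0r addr0; apply.
apply: ae_all => t _ H; rewrite addr0 lerD2r.
exact: le_trans (lipreg_nondec fm _ np) (lipreg_noninc fm _ (ltW H)).
Qed.

Lemma appsol_lec n c c' x : c <= c' -> 0 <= x <= L ->
  appsol n c x <= appsol n c' x <= appsol n c x + bu * (c' - c) * x.
Proof.
move=> cc' xL; apply/andP; split.
  have := sol_le bl0 bP (lexx 0) (appsolP n c) (appsolP n c').
  rewrite mulr0; move=> /(_ _ x xL); rewrite mul0r addr0; apply.
  apply: ae_all => t _ H; rewrite addr0; apply: lerD; last exact: cc'.
  exact: (lipreg_noninc fm n (ltW H)).
have cc0 : 0 <= c' - c by rewrite subr_ge0.
apply: (sol_le bl0 bP cc0 (appsolP n c') (appsolP n c) _ xL).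
apply: ae_all => t _ H; have := lipreg_noninc fm n (ltW H); lra.
Qed.

(** Positivity belongs to the notion because [f] is controlled on positive numbers only; with it,
    comparison applies to [f] itself. *)
Definition possol c u : Prop :=
  [/\ sol f c u, forall x, 0 < x < L -> 0 < u x & u L = 0].

Lemma appsol_le_possol n c u x : possol c u -> 0 <= x <= L -> appsol n c x <= u x.
Proof.
move=> [su u0 _] xL.
have := sol_le bl0 bP (lexx 0) (appsolP n c) su.
rewrite mulr0; move=> /(_ _ x xL); rewrite mul0r addr0; apply.
apply: ae_all => t tL H; rewrite addr0 lerD2r.
apply: le_trans (lipreg_noninc fm _ (ltW H)) _.
by apply: (lipreg_le fm); exact: u0.
Qed.

Lemma possol_unique c u v : possol c u -> possol c v ->
  forall x, 0 <= x <= L -> u x = v x.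
Proof.
suff H u' v' x : possol c u' -> possol c v' -> 0 <= x <= L -> u' x <= v' x.
  by move=> su sv x xL; apply: le_anti; rewrite !H.
move=> [su u0 _] [sv v0 _] xL.
have := sol_le bl0 bP (lexx 0) su sv.
rewrite mulr0; move=> /(_ _ x xL); rewrite mul0r addr0; apply.
apply: ae_all => t tL vu; rewrite addr0 lerD2r.
by apply: fni; [exact: v0|exact: ltW].
Qed.

(** Linear barrier. Wherever [appsol n c] is below [k x], it is at most [d / 2], so [lipreg] is at
    least [M + |c| + 1] and the equation forces a slope of at least [bl], for every [n >= N]. *)
Lemma appsol_lower c eta : 0 < eta -> eta < L -> exists N k, 0 < k /\
  forall n x, (N <= n)%N -> 0 <= x <= L - eta -> k * x <= appsol n c x.
Proof.
move=> eta0 etaL; have [M MP] := gM eta0 etaL.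
have [d [d0 dP]] := finf (M + `|c| + 1).
have [||N NP] := @lipreg_large _ f m fm (d / 2) (d / 2) (M + `|c| + 1).
- by rewrite divr_gt0.
- by move=> t t0 td; apply: dP => //; lra.
(* The slope must not exceed [bl], and [k x] must stay below [d / 2] on [[0, L]]. *)
pose k := Num.min bl (d / 2 / L).
have k0 : 0 < k by rewrite lt_min bl0 !divr_gt0.
exists N, k; split => // n x Nn xL.
have etaL' : L - eta <= L by rewrite gerBl ltW.
have [p u0] := appsolP n c.
have p' := primS p (lexx 0) (_ : 0 <= L - eta) etaL'.
have {}p' := primD (prim_lin 0 (L - eta) k) (primN (p' _)).
suff : k * x + - appsol n c x <= 0 by lra.
apply: (prim_le0 (p' _) _ (@ltr01 R)) xL; first by rewrite subr_ge0 ltW.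
  by rewrite u0; lra.
apply: (ae_imply MP) => t + tL => /(_ tL) Mt /andP[ut _].
have /andP[t0 tL'] := tL.
have utd : appsol n c t <= d / 2.
  apply: (@le_trans _ _ (k * t)); first by lra.
  apply: (@le_trans _ _ (d / 2 / L * L)).
    apply: ler_pM; rewrite ?(ltW k0) ?(ltW t0)// ?ge_min ?lexx ?orbT//.
    by apply: ltW; apply: lt_le_trans tL' _.
  by rewrite divfK// gt_eqF.
have h1 := le_trans (NP n Nn) (lipreg_noninc fm n utd).
have h2 := ler_norm (- c); rewrite normrN in h2.
rewrite subr_le0; apply: (@le_trans _ _ (bl * 1)).
  by rewrite mulr1 ge_min lexx.
have /andP[bt1 _] := bP t.
by apply: ler_pM => //; [exact: ltW|rewrite /=; lra].
Qed.

Definition admissible c : Prop := forall n, appsol n c L <= 0.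

Let LL : 0 <= L <= L. Proof. by rewrite L0' lexx. Qed.

Lemma possol_admissible c u : possol c u -> admissible c.
Proof.
move=> su n; have [_ _ uL] := su.
by rewrite -uL; exact: appsol_le_possol.
Qed.

Lemma admissible_le c c' : c <= c' -> admissible c' -> admissible c.
Proof.
by move=> cc' ac n; have /andP[h _] := appsol_lec n cc' LL; exact: le_trans h (ac n).
Qed.

(** The value at [L] is Lipschitz in [c] with constant [bu L], for every [n]. *)
Lemma admissible_closed c : (forall e, 0 < e -> admissible (c - e)) -> admissible c.
Proof.
move=> H n; apply/ler_addgt0Pr => e e0; rewrite add0r.
pose d := e / (bu * L).
have d0 : 0 < d by rewrite divr_gt0// mulr_gt0.
have cd : c - d <= c by rewrite gerBl ltW.
have /andP[_] := appsol_lec n cd LL; rewrite subKr.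
have -> : bu * d * L = e by rewrite /d; field; rewrite !gt_eqF.
by have := H d d0 n; lra.
Qed.

(** Meaningful for admissible [c] and [x] in [[0, L]], where the sequence is monotone and bounded;
    elsewhere [limn] may return a default value. *)
Definition limsol c x : R := limn (fun n => appsol n c x).

Section Admissible.
Variable c : R.
Hypothesis Ac : admissible c.

Local Notation E := (bu ^+ 2 * itg (fun t => g t ^+ 2) 0 L).

Let energy : exists N, forall n, (N <= n)%N ->
  itg (fun t => rhs (lipreg f n) c (appsol n c) t ^+ 2) 0 L <= E.
Proof.
(* The level [- c] yields [lipreg f n + c >= 0] on [s <= 0] for large [n], as [sol_energy]
   requires. *)
have [d [d0 dP]] := finf (- c).
have [|N NP] := @lipreg_large _ f m fm 0 d (- c) d0 _.
  by move=> t t0; rewrite add0r; exact: dP.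
exists N => n Nn.
apply: (sol_energy L0 bl0 mb bP gP (ler0n _ n) (lipreg_lip fm n)).
- exact: appsolP.
- move=> s s0; have := le_trans (NP n Nn) (lipreg_noninc fm n s0); lra.
- exact: Ac.
Qed.

Let rhs_n_sqi n : sqi 0 L (rhs (lipreg f n) c (appsol n c)).
Proof.
apply: (rhs_sqi bl0 mb bP gP); apply: sqi_econt => //.
apply: (lipschitz_econt (ler0n _ n) (lipreg_lip fm n)).
exact: sol_econt (appsolP n c).
Qed.

Let appsol_bounded x : 0 <= x <= L -> exists B, forall n, appsol n c x <= B.
Proof.
move=> xL; have [N NP] := energy; exists (E + L) => n.
(* The energy bound holds only from [N] on; smaller indices are dominated by monotonicity in [n]. *)
have [p /andP[np Np]] : exists p, (n <= p)%N && (N <= p)%N.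
  by exists (maxn n N); rewrite leq_maxl leq_maxr.
apply: le_trans (appsol_nondec c np xL) _.
have /andP[x0 xL'] := xL.
rewrite (solE (appsolP p c) xL); have [_ i2] := rhs_n_sqi p.
have i1 := sqi_L1 (rhs_n_sqi p).
apply: le_trans (ler_norm _) _; apply: le_trans (itg_norm (L1S i1 (lexx 0) xL')) _.
apply: le_trans (itg_le_itv (L1_norm i1) _ (lexx 0) x0 xL') _ => //.
have := itg_young (rhs_n_sqi p) (sqi_cst 0 L 1) ltr01.
rewrite mul1r invr1 mul1r itg_cst// expr1n mul1r subr0 => H.
under eq_itg do rewrite -[X in `|X|]mulr1.
by apply: le_trans H _; rewrite lerD2r; exact: NP.
Qed.

Lemma appsol_cvg x : 0 <= x <= L -> (fun n => appsol n c x) @ \oo --> limsol c x.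
Proof.
move=> xL; apply: nondecreasing_is_cvgn.
  by move=> n p np; exact: appsol_nondec.
by have [B BP] := appsol_bounded xL; exists B => _ [n _ <-].
Qed.

Lemma appsol_le_limsol n x : 0 <= x <= L -> appsol n c x <= limsol c x.
Proof.
move=> xL; apply: (nondecreasing_cvgn_le _ (appsol_cvg xL)).
by move=> n' p np; exact: appsol_nondec.
Qed.

Lemma limsol_gt0 x : 0 < x < L -> 0 < limsol c x.
Proof.
move=> /andP[x0 xL]; have xL2 : 0 <= x <= L by rewrite !ltW.
have [||N [k [k0 kP]]] := @appsol_lower c (L - x).
- by rewrite subr_gt0.
- by rewrite gtrBl.
apply: lt_le_trans (appsol_le_limsol N xL2).
by apply: lt_le_trans (kP N x (leqnn N) _); rewrite ?mulr_gt0// subKr (ltW x0) lexx.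
Qed.

Lemma rhs_cvg x : 0 < x < L ->
  (fun n => rhs (lipreg f n) c (appsol n c) x) @ \oo --> rhs f c (limsol c) x.
Proof.
move=> xL; have xL2 : 0 <= x <= L by case/andP : xL => *; rewrite !ltW.
apply: cvgM; first exact: cvg_cst.
apply: cvgD; last exact: cvg_cst.
apply: cvgD; last exact: cvg_cst.
have l0 := limsol_gt0 xL.
apply: (lipreg_cvg fm fni l0 (fcont l0)) => [n|].
  exact: appsol_le_limsol.
exact: appsol_cvg.
Qed.

Let meas_limsol : meas 0 L (limsol c).
Proof.
apply: (measurable_fun_cvg (h := fun n => appsol n c)) => //.
  by move=> n; apply: econt_meas; exact: sol_econt (appsolP n c).
by move=> x /=; rewrite in_itv/=; exact: appsol_cvg.
Qed.

Let meas_rhs : meas 0 L (rhs f c (limsol c)).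
Proof.
apply: measM => //; apply: measD; last exact: meas_cst.
apply: measD; last by case: gP.
by apply: measurableT_comp => //; exact: meas_limsol.
Qed.

Lemma limsol_energy : sqi 0 L (rhs f c (limsol c)) /\
  itg (fun t => rhs f c (limsol c) t ^+ 2) 0 L <= E.
Proof.
have [N NP] := energy.
apply: (@fatou_sqr _ 0 L (fun n => rhs (lipreg f (n + N)) c (appsol (n + N) c))).
- by move=> n; case: (rhs_n_sqi (n + N)).
- exact: meas_rhs.
- by move=> t tL; exact: cvg_addn (rhs_cvg tL).
- by move=> n; exact: rhs_n_sqi.
- by move=> n; apply: NP; rewrite leq_addl.
Qed.

(** The derivatives converge pointwise inside and are bounded in L2 from [N] on, hence converge in
    L1. That passes to the limit in the integral equation, uniformly in [x]. *)
Lemma limsol_possol : possol c (limsol c).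
Proof.
have [N NP] := energy; have [sR _] := limsol_energy.
have cv := @cvg_itg_norm _ 0 L (fun n => rhs (lipreg f (n + N)) c (appsol (n + N) c))
  (rhs f c (limsol c)) E _ meas_rhs _ _ _.
have {}cv : (fun n => itg (fun t => `|rhs (lipreg f (n + N)) c (appsol (n + N) c) t -
    rhs f c (limsol c) t|) 0 L) @ \oo --> (0 : R).
  apply: cv.
  - by move=> n; case: (rhs_n_sqi (n + N)).
  - by move=> t tL; exact: cvg_addn (rhs_cvg tL).
  - by move=> n; exact: rhs_n_sqi.
  - by move=> n; apply: NP; rewrite leq_addl.
have i1 := sqi_L1 sR.
have E1 x : 0 <= x <= L -> limsol c x = itg (rhs f c (limsol c)) 0 x.
  move=> xL; have /andP[x0 xL'] := xL.
  have c1 := cvg_addn N (appsol_cvg xL).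
  apply: cvg_unique c1 _ => //.
  apply/cvgrPdist_lt => e e0; have /cvgrPdist_lt/(_ _ e0) := cv.
  apply: filterS => n; rewrite sub0r normrN; apply: le_lt_trans.
  apply: le_trans (ler_norm _); rewrite distrC (solE (appsolP _ _) xL).
  have i1n := sqi_L1 (rhs_n_sqi (n + N)).
  rewrite -(itgB (L1S i1n (lexx 0) xL') (L1S i1 (lexx 0) xL')).
  apply: le_trans (itg_norm _) _; first by apply: L1S (L1B i1n i1) _ _.
  by apply: itg_le_itv => //; exact: L1_norm (L1B i1n i1).
have l0 : limsol c 0 = 0 by rewrite E1 ?itg_xx// lexx.
have p : prim 0 L (limsol c) (rhs f c (limsol c)).
  by split => // x xL; rewrite E1// l0 add0r.
split => //; first exact: limsol_gt0.
apply: le_anti; apply/andP; split.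
  rewrite /limsol; apply: limr_le; last by apply: nearW => n; exact: Ac.
  by apply/cvg_ex; eexists; exact: appsol_cvg.
rewrite leNgt; apply/negP => lL.
have lL' : 0 < - limsol c L by rewrite oppr_gt0.
have [d [d0 dP]] := prim_econt p LL lL'.
pose x := Num.max (L / 2) (L - d / 2).
have x0 : 0 < x by rewrite lt_max divr_gt0.
have xL : x < L.
  by rewrite gt_max gtrBl (divr_gt0 d0)// andbT ltr_pdivrMr// ltr_pMr// ltr1n.
have : `|limsol c x - limsol c L| < - limsol c L.
  apply: dP; first by rewrite !ltW.
  rewrite distrC ger0_norm ?subr_ge0 ?(ltW xL)//.
  have : L - d / 2 <= x by rewrite le_max lexx orbT.
  lra.
have := limsol_gt0 (_ : 0 < x < L); rewrite x0 xL => /(_ isT).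
by rewrite ltr_norml; lra.
Qed.

(** Read off the equation: [f(u) = u' / b - g - c]. *)
Lemma limsol_f_sqi : sqi 0 L (f \o limsol c).
Proof.
have [sR _] := limsol_energy.
have mV : meas 0 L (fun t => (b t)^-1).
  (* A continuous function that agrees with the inverse on the range of [b], for measurability of
     [1/b]. *)
  pose h s := (Num.max bl s)^-1.
  have ch : continuous h.
    move=> s; apply: cvgV; first by rewrite gt_eqF// lt_max bl0.
    by apply: continuous_max; [exact: cvg_cst|exact: cvg_id].
  have := meas_comp ch mb; congr (meas 0 L _).
  by apply/funext => t; rewrite /h (max_idPr _)//; case/andP : (bP t).
have := sqiM (k := bl^-1) mV _ sR.
have H t : 0 <= t <= L -> `|(b t)^-1| <= bl^-1.
  move=> _; rewrite ger0_norm ?invr_ge0 ?(ltW (b0 t))//.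
  by rewrite lef_pV2 ?posrE//; case/andP : (bP t).
move=> /(_ H) s1; have := sqiD s1 (sqiN (sqiD gP (sqi_cst 0 L c))).
congr (sqi 0 L _); apply/funext => t; rewrite /= /rhs.
by field; rewrite gt_eqF.
Qed.

(** If [c + m > 0], then [u' >= bl (c + m) - bu |g|] while [u'] has zero integral. The maximum with
    [0] covers the case [c + m <= 0]. *)
Lemma admissible_bound :
  (c + m) * (bl * L) <= Num.max 0 (bu * itg (fun t => `|g t|) 0 L).
Proof.
have [cm|cm] := leP (c + m) 0.
  by rewrite le_max; apply/orP; left; rewrite mulr_le0_ge0// mulr_ge0// ltW.
rewrite le_max; apply/orP; right.
have [[p l0] lp lL] := limsol_possol.
have H : itg (rhs f c (limsol c)) 0 L = 0.
  by rewrite -(solE (conj p l0) LL).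
have ig := sqi_L1 gP.
have : itg (fun t => (c + m) * bl - bu * `|g t|) 0 L <= itg (rhs f c (limsol c)) 0 L.
  apply: itg_le; [|exact: (proj1 p)|].
    by apply: L1B; [exact: L1_cst|apply: L1Z; exact: L1_norm].
  apply: ae_all => t tL; rewrite /rhs.
  have h1 := fm (lp t tL); have /andP[h2 h3] := bP t.
  have h4 := ler_norm (- g t); rewrite normrN in h4.
  have h5 := normr_ge0 (g t).
  apply: (@le_trans _ _ (b t * (c + m) - b t * `|g t|)).
    rewrite lerB//; last by rewrite ler_wpM2r.
    by rewrite mulrC ler_wpM2r// ltW.
  by rewrite -mulrBr ler_wpM2l ?(ltW (b0 t))//; lra.
rewrite H itgB; [|exact: L1_cst|by apply: L1Z; exact: L1_norm].
rewrite itg_cst// itgZ; last exact: L1_norm.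
by rewrite subr0 subr_le0 mulrA.
Qed.

End Admissible.

End SingularProblem.

(** * Density of continuous functions in L2 and a criterion for weak convergence *)

Section Density.
Variable R : realType.
Local Notation mu := (@lebesgue_measure R).
Implicit Types (u v w h p : R -> R) (x y z c k s t e d r C L E : R).

Lemma minmax_dist k s t :
  `|Num.max (- k) (Num.min s k) - Num.max (- k) (Num.min t k)| <= `|s - t|.
Proof.
have H s' t' : Num.max (- k) (Num.min s' k) <= Num.max (- k) (Num.min t' k) + `|s' - t'|.
  have h := ler_norm (s' - t'); have h0 := normr_ge0 (s' - t').
  have m1 : - k <= Num.max (- k) (Num.min t' k) by rewrite le_max lexx.
  rewrite ge_max; apply/andP; split; first by lra.
  have [tk|kt] := leP t' k.
    have : t' <= Num.max (- k) t' by rewrite le_max lexx orbT.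
    have : Num.min s' k <= s' by rewrite ge_min lexx.
    lra.
  have : k <= Num.max (- k) k by rewrite le_max lexx orbT.
  have : Num.min s' k <= k by rewrite ge_min lexx orbT.
  lra.
rewrite ler_distl; have := H s t; have := H t s; rewrite (distrC t); lra.
Qed.

Lemma minmax_norm k s : 0 <= k -> `|Num.max (- k) (Num.min s k)| <= k.
Proof.
move=> k0; rewrite ler_norml le_max lexx/= ge_max ge_min lexx orbT andbT.
by rewrite ge0_cp.
Qed.

(** Truncate [h] at a level [n], approximate the truncation in L1 by a continuous function, and
    truncate that one too: between functions bounded by [n], the squared L2 distance is at most
    [2 n] times the L1 distance. *)
Lemma sqi_dense L h e : 0 < L -> sqi 0 L h -> 0 < e ->
  exists p, econt 0 L p /\ itg (fun t => (h t - p t) ^+ 2) 0 L <= e.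
Proof.
move=> L0 sh e0; pose tr (n : nat) s := Num.max (- n%:R) (Num.min s (n%:R : R)).
have [mh i2] := sh.
have mtr n p : meas 0 L p -> meas 0 L (fun t => tr n (p t)).
  move=> mp; apply: meas_max; first exact: meas_cst.
  by apply: meas_min => //; exact: meas_cst.
have trh n t : `|tr n (h t)| <= n%:R by exact: minmax_norm.
have trc t : (fun n => tr n (h t)) @ \oo --> h t.
  apply/cvgrPdist_lt => d d0; near=> n.
  have : `|h t| <= n%:R.
    by apply: (@le_trans _ _ (Num.truncn `|h t|).+1%:R);
      [exact/ltW/truncnS_gt|rewrite ler_nat; near: n; exact: nbhs_infty_gt].
  rewrite ler_norml => /andP[h1 h2].
  by rewrite /tr (min_idPl h2) (max_idPr h1) subrr normr0.
have s1 n : sqi 0 L (fun t => h t - tr n (h t)).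
  apply: sqiD => //; apply: sqiN.
  by apply: (sqi_bounded (k := n%:R)) => //; exact: mtr.
have [n nP] : exists n, itg (fun t => (h t - tr n (h t)) ^+ 2) 0 L < e / 4.
  have [|||||_ cv] := @itg_dominated _ 0 L (fun n t => (h t - tr n (h t)) ^+ 2)
    (fun=> 0) (fun t => h t ^+ 2).
  - by move=> n; apply: measurable_funX; case: (s1 n).
  - exact: meas_cst.
  - apply: ae_all => t _.
    have c0 : (fun n => h t - tr n (h t)) @ \oo --> (0 : R).
      by rewrite -(subrr (h t)); apply: cvgB; [exact: cvg_cst|exact: trc].
    by rewrite -[X in _ --> X](mulr0 (0 : R)); exact: cvgM.
  - exact: i2.
  - apply: ae_all => t _ n; rewrite ger0_norm ?sqr_ge0// -[leRHS]real_normK ?num_real//.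
    rewrite -[leLHS]real_normK ?num_real// lerXn2r ?nnegrE//.
    rewrite /tr; have [ht|ht] := leP (h t) n%:R.
      have [ht'|ht'] := leP (- n%:R) (h t); first by rewrite subrr normr0.
      have n0 : 0 <= n%:R :> R by [].
      by rewrite !ltr0_norm; lra.
    have n0 : 0 <= n%:R :> R by [].
    rewrite (max_idPr _) ?ge0_cp//; rewrite !ger0_norm; lra.
  have e4 : 0 < e / 4 by rewrite divr_gt0.
  have : itg (fun=> 0) 0 L = 0 :> R by rewrite itg_cst ?mul0r// ltW.
  move: cv => /cvgrPdist_lt /(_ _ e4)[n _ /(_ n (leqnn n))] + E0.
  rewrite E0 sub0r normrN => H; exists n.
  by apply: le_lt_trans H; exact: ler_norm.
pose k : R := n%:R + 1.
have k0 : 0 < k by rewrite /k ltr_wpDl.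
have itr : L1 0 L (fun t => tr n (h t)) by apply: (L1_bounded (k := n%:R)) => //; exact: mtr.
have Lfin : (mu `[0%R, L]%classic < +oo)%E.
  by rewrite lebesgue_measure_itv /=; case: ifP => _; rewrite ltry.
have [q_ [cq iq cvq]] := @approximation_continuous_integrable R `[0, L]%classic
  (fun t => tr n (h t)) (measurable_itv _) Lfin itr.
have [j jP] : exists j, itg (fun t => `|tr n (h t) - q_ j t|) 0 L < e / (8 * k).
  have e1 : 0 < e / (8 * k) by rewrite divr_gt0// mulr_gt0.
  move/fine_cvgP : cvq => [_ /cvgrPdist_lt/(_ _ e1)[j _ /(_ j (leqnn j))]].
  rewrite sub0r normrN => H; exists j; apply: le_lt_trans H.
  exact: ler_norm.
exists (fun t => tr n (q_ j t)); split.
  have ctr : continuous (tr n).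
    apply: (lipschitz_continuous (@ler01 R)) => s t; rewrite mul1r.
    exact: minmax_dist.
  by apply: (econt_comp (F := tr n)) => [x _|]; [exact: ctr|apply: econtT; exact: cq].
have mq : meas 0 L (q_ j) by apply: econt_meas; apply: econtT; exact: cq.
have s2 : sqi 0 L (fun t => tr n (h t) - tr n (q_ j t)).
  apply: sqiD; last apply: sqiN; apply: (sqi_bounded (k := n%:R)) => //; try exact: mtr.
  by move=> t _; exact: minmax_norm.
have sp : sqi 0 L (fun t => h t - tr n (q_ j t)).
  have := sqiD (s1 n) s2; congr (sqi 0 L _); apply/funext => t; ring.
have [_ i1n] := s1 n; have [_ i2n] := s2.
have ld := L1_norm (L1B itr (iq j)).
apply: (@le_trans _ _ (itg (fun t => 2 * (h t - tr n (h t)) ^+ 2 +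
    2 * (tr n (h t) - tr n (q_ j t)) ^+ 2) 0 L)).
  apply: itg_le; [by case: sp|by apply: L1D; exact: L1Z|apply: ae_all => t _].
  have := sqr_ge0 ((h t - tr n (h t)) - (tr n (h t) - tr n (q_ j t))); nra.
rewrite itgD; [|exact: L1Z|exact: L1Z]; rewrite !itgZ//.
have : itg (fun t => (tr n (h t) - tr n (q_ j t)) ^+ 2) 0 L <=
    itg (fun t => 2 * k * `|tr n (h t) - q_ j t|) 0 L.
  apply: itg_le => //; first exact: L1Z.
  apply: ae_all => t _; rewrite -real_normK ?num_real// expr2.
  have a1 : `|tr n (h t) - tr n (q_ j t)| <= `|tr n (h t) - q_ j t|.
    have trtr : tr n (tr n (h t)) = tr n (h t).
      have := trh n t; rewrite ler_norml => /andP[h1 h2].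
      by rewrite {1}/tr (min_idPl h2) (max_idPr h1).
    by rewrite -{1}trtr; exact: minmax_dist.
  apply: ler_pM => //.
  apply: le_trans (ler_normB _ _) _.
  have := trh n t; have := minmax_norm (q_ j t) (ler0n R n); rewrite -/(tr n _) /k; lra.
rewrite itgZ//; move: jP; rewrite ltr_pdivlMr ?mulr_gt0//; nra.
Unshelve. all: by end_near. Qed.

Lemma itg_mul_le L D p r : 0 < L -> sqi 0 L D -> sqi 0 L p ->
  (forall t, 0 <= t <= L -> `|p t| <= r) ->
  `|itg (fun t => D t * p t) 0 L| <= r * itg (fun t => `|D t|) 0 L.
Proof.
move=> L0 sD sp pr; have iD := L1_norm (sqi_L1 sD); rewrite -itgZ//.
apply: itg_norm_le; [exact: sqi_L1M|exact: L1Z|].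
by move=> t tL; rewrite normrM mulrC ler_wpM2r// pr.
Qed.

(** Against a continuous [p], which is nearly constant on short intervals, [int D p] is close to
    [p x] times an increment of the primitive of [D], and these increments tend to [0]. The L2 bound
    then extends this to all [h] by density. A general filter covers both a limit at a finite
    constant and one at [-oo]. *)
Lemma weak_cvg0 (T : Type) (F : set_system T) (FF : Filter F) (D : T -> R -> R) L E h :
  0 < L -> (\forall i \near F, sqi 0 L (D i) /\ itg (fun t => D i t ^+ 2) 0 L <= E) ->
  (forall e, 0 < e -> \forall i \near F, forall x, 0 <= x <= L -> `|itg (D i) 0 x| <= e) ->
  sqi 0 L h ->
  forall e, 0 < e -> \forall i \near F, `|itg (fun t => D i t * h t) 0 L| <= e.
Proof.
move=> L0 Dbnd Dunif sh.
wlog E0 : E Dbnd / 0 <= E.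
  move=> H; apply: (H (Num.max E 0)); last by rewrite le_max lexx orbT.
  by apply: filterS Dbnd => i [? h1]; split => //; rewrite le_max h1.
have DL1 : \forall i \near F, L1 0 L (D i) /\ itg (fun t => `|D i t|) 0 L <= E + L.
  apply: filterS Dbnd => i [sD DE]; split; first exact: sqi_L1.
  have := itg_young sD (sqi_cst 0 L 1) ltr01.
  rewrite mul1r invr1 mul1r (itg_cst _ (ltW L0)) expr1n mul1r subr0 => H.
  under eq_itg do rewrite -[X in `|X|]mulr1.
  by apply: le_trans H _; rewrite lerD2r.
have cont p : econt 0 L p -> forall e, 0 < e ->
    \forall i \near F, `|itg (fun t => D i t * p t) 0 L| <= e.
  move=> cp e e0.
  pose r := e / 2 / (E + L + 1).
  have r0 : 0 < r by rewrite !divr_gt0//; lra.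
  have ip i x y : L1 0 L (D i) -> 0 <= x -> x <= y -> y <= L -> L1 x y (fun t => D i t * p t).
    move=> iD x0 xy yL; rewrite (_ : (fun _ => _) = fun t => p t * D i t); last first.
      by apply/funext => t; rewrite mulrC.
    apply: L1_mul_econt => //; last exact: L1S iD _ _.
    exact: econtS cp _ _.
  (* The error of freezing [p] is charged to [int |D i|], which is additive over intervals and
     bounded, so it does not accumulate with the number of pieces. *)
  pose Q x y : Prop := forall e', 0 < e' -> \forall i \near F,
    `|itg (fun t => D i t * p t) x y| <= e' + r * itg (fun t => `|D i t|) x y.
  have : Q 0 L.
    apply: interval_induction; first exact: ltW.
      move=> x y z x0 xy yz zL Qxy Qyz e' e'0.
      have e20 : 0 < e' / 2 by rewrite divr_gt0.
      move: DL1 (Qxy _ e20) (Qyz _ e20); apply: filterS3 => i [iD _] h1 h2.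
      have ixz := ip i x z iD x0 (le_trans xy yz) zL.
      rewrite (itg_cat ixz xy yz) (itg_cat (L1S (L1_norm iD) x0 zL) xy yz).
      apply: le_trans (ler_normD _ _) _; lra.
    move=> x xL; have [d [d0 dP]] := cp x xL r r0; have /andP[x0 xL'] := xL.
    have loc y z : 0 <= y -> y <= z -> z <= L -> x - d < y -> z < x + d -> Q y z.
      move=> y0 yz zL xdy zxd e' e'0.
      have p1 : 0 < `|p x| + 1 by rewrite ltr_wpDl.
      have e10 : 0 < e' / 2 / (`|p x| + 1) by rewrite !divr_gt0.
      move: DL1 (Dunif _ e10); apply: filterS2 => i [iD _] Di.
      have iD' := L1S iD y0 zL.
      have i1 := L1Z (p x) iD'; have i2 := ip i y z iD y0 yz zL.
      have Dyz : `|itg (D i) y z| <= e' / (`|p x| + 1).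
        have zL2 : 0 <= z <= L by rewrite zL (le_trans y0).
        have yL2 : 0 <= y <= L by rewrite y0 (le_trans yz).
        have := Di z zL2; have := Di y yL2.
        rewrite (itg_cat (L1S iD (lexx 0) zL) y0 yz) => h1 h2.
        have := ler_normB (itg (D i) 0 y + itg (D i) y z) (itg (D i) 0 y).
        rewrite addrAC subrr add0r.
        have -> : e' / (`|p x| + 1) = e' / 2 / (`|p x| + 1) + e' / 2 / (`|p x| + 1).
          by field; rewrite gt_eqF.
        lra.
      rewrite (_ : itg _ y z = itg (fun t => p x * D i t) y z +
        itg (fun t => D i t * p t - p x * D i t) y z); last first.
        by rewrite -itgD//; [apply: eq_itg => t _; ring|exact: L1B].
      apply: le_trans (ler_normD _ _) _; apply: lerD.
        rewrite itgZ// normrM; apply: (@le_trans _ _ ((`|p x| + 1) * (e' / (`|p x| + 1)))).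
          by apply: ler_pM => //; rewrite lerDl.
        by rewrite mulrC divfK// gt_eqF.
      rewrite -itgZ; last exact: L1_norm.
      apply: itg_norm_le; [exact: L1B|by apply: L1Z; exact: L1_norm|].
      move=> t /andP[yt tz]; rewrite mulrC -mulrBl normrM ler_wpM2r//.
      apply: ltW; apply: dP; first by rewrite (le_trans y0 yt) (le_trans tz zL).
      by rewrite ltr_norml; apply/andP; split; lra.
    exists d; split => //; split => [y xy yd yL|y yd yx y0].
      by apply: loc => //; lra.
    by apply: loc => //; lra.
  move=> /(_ (e / 2)); rewrite divr_gt0// => /(_ isT) QL.
  move: DL1 QL; apply: filterS2 => i [iD DE] H; apply: le_trans H _.
  have : r * itg (fun t => `|D i t|) 0 L <= e / 2.
    rewrite /r mulrAC ler_pdivrMr; last by lra.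
    by rewrite ler_wpM2l ?divr_ge0 ?(ltW e0)//; lra.
  lra.
(* Young's weight: [t0 E <= e / 4], and density is used with tolerance [t0 e / 4], so the other term
   is also at most [e / 4]. *)
move=> e e0; pose t0 := e / (4 * (E + 1)).
have t00 : 0 < t0 by rewrite divr_gt0// mulr_gt0//; lra.
have e40 : 0 < e / 4 by rewrite divr_gt0.
have [p [cp hp]] := sqi_dense L0 sh (mulr_gt0 t00 e40).
have e20 : 0 < e / 2 by rewrite divr_gt0.
have sp := sqi_econt (ltW L0) cp.
have shp : sqi 0 L (fun t => h t - p t) by apply: sqiD => //; exact: sqiN.
move: Dbnd (cont p cp _ e20); apply: filterS2 => i [sD DE] H.
have i1 := sqi_L1M sD sp; have i2 := sqi_L1M sD shp.
rewrite (_ : itg _ 0 L = itg (fun t => D i t * p t) 0 L +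
    itg (fun t => D i t * (h t - p t)) 0 L); last first.
  by rewrite -itgD//; apply: eq_itg => t _; ring.
apply: le_trans (ler_normD _ _) _.
have : `|itg (fun t => D i t * (h t - p t)) 0 L| <= e / 2.
  apply: le_trans (itg_norm i2) _.
  apply: le_trans (itg_young sD shp t00) _.
  have a1 : t0 * itg (fun t => D i t ^+ 2) 0 L <= e / 4.
    rewrite /t0 mulrAC ler_pdivrMr; last by rewrite mulr_gt0//; lra.
    rewrite (_ : e / 4 * (4 * (E + 1)) = e * (E + 1)); last by field.
    by rewrite ler_wpM2l ?(ltW e0)//; lra.
  have a2 : t0^-1 * itg (fun t => (h t - p t) ^+ 2) 0 L <= e / 4.
    by rewrite ler_pdivrMl.
  lra.
lra.
Qed.

End Density.

Opaque itg.

(** * Strict monotonicity in the constant and smallness as it tends to [-oo] *)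

Section SolutionBranch.
Variable R : realType.
Local Notation mu := (@lebesgue_measure R).
Implicit Types (u v w : R -> R) (x y z c k s t e d r C E : R).
Variables (L bl bu : R) (b g f : R -> R).
Hypotheses (L0 : 0 < L) (bl0 : 0 < bl).
Hypothesis bP : forall x, bl <= b x <= bu.
Hypothesis gP : sqi 0 L g.
Hypothesis fni : forall s t, 0 < s -> s <= t -> f t <= f s.
Hypothesis fcont : forall s, 0 < s -> {for s, continuous f}.

Let L0' : 0 <= L. Proof. exact: ltW. Qed.
Let b0 x : 0 < b x. Proof. by have /andP[+ _] := bP x; apply: lt_le_trans. Qed.
Let bub x : b x <= bu. Proof. by case/andP : (bP x). Qed.
Let bu0 : 0 < bu. Proof. by apply: lt_le_trans (b0 0) (bub 0). Qed.

Local Notation rhs := (rhs b g).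
Local Notation possol := (possol L b g f).

Lemma possol_ge0 c u x : possol c u -> 0 <= x <= L -> 0 <= u x.
Proof.
move=> [[_ u0] up uL] /andP[x0 xL].
move: x0; rewrite le_eqVlt => /predU1P[<-|x0]; first by rewrite u0.
move: xL; rewrite le_eqVlt => /predU1P[->|xL]; first by rewrite uL.
by rewrite ltW// up// x0.
Qed.

Lemma possol_lec c c' u v x : c <= c' -> possol c u -> possol c' v ->
  0 <= x <= L -> u x <= v x <= u x + bu * (c' - c) * x.
Proof.
move=> cc' [su up _] [sv vp _] xL; apply/andP; split.
  have := sol_le bl0 bP (lexx 0) su sv.
  rewrite mulr0; move=> /(_ _ x xL); rewrite mul0r addr0; apply.
  apply: ae_all => t tL H; rewrite addr0; apply: lerD; last exact: cc'.
  by apply: fni; [exact: vp|exact: ltW].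
have cc0 : 0 <= c' - c by rewrite subr_ge0.
apply: (sol_le bl0 bP cc0 sv su _ xL).
by apply: ae_all => t tL H; have := fni (up t tL) (ltW H); lra.
Qed.

(** If the solutions touched at an interior [x], continuity would make [f u] and [f v] close just
    before [x]. Then [v - u] has slope at least [bl (c' - c) / 2] there and is negative before [x],
    against [u <= v]. *)
Lemma possol_lt c c' u v x : c < c' -> possol c u -> possol c' v ->
  0 < x < L -> u x < v x.
Proof.
move=> cc' pu pv xL; have /andP[x0 xL'] := xL.
have xL2 : 0 <= x <= L by rewrite !ltW.
have /andP[uv _] := possol_lec (ltW cc') pu pv xL2.
rewrite lt_neqAle uv andbT; apply/negP => /eqP uvx.
have [su up _] := pu; have [sv vp _] := pv.
have cfu p : econt 0 L p -> 0 < p x -> forall e, 0 < e ->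
    exists d, 0 < d /\ forall y, 0 <= y <= L -> `|y - x| < d -> `|f (p y) - f (p x)| < e.
  move=> cp px e e0.
  have /cvgrPdist_lt/(_ _ e0)/nbhs_ballP[r /= r0 rP] := fcont px.
  have [d [d0 dP]] := cp x xL2 r r0; exists d; split => // y yL yx.
  by rewrite distrC; apply: rP; rewrite /ball/= distrC; exact: dP.
(* Two errors of a quarter leave half of the gap [c' - c]. *)
have e0 : 0 < (c' - c) / 4 by rewrite divr_gt0// subr_gt0.
have [d [d0 dP]] := cfu u (sol_econt su) (up x xL) _ e0.
have [d' [d'0 d'P]] := cfu v (sol_econt sv) (vp x xL) _ e0.
pose y := Num.max 0 (Num.max (x - d / 2) (x - d' / 2)).
have y0 : 0 <= y by rewrite le_max lexx.
have y1 : x - d / 2 <= y by rewrite !le_max lexx orbT.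
have y2 : x - d' / 2 <= y by rewrite !le_max lexx !orbT.
have yx : y < x by rewrite !gt_max x0 !gtrBl !divr_gt0.
have yL2 : 0 <= y <= L by rewrite y0 (le_trans (ltW yx) (ltW xL')).
have /andP[uvy _] := possol_lec (ltW cc') pu pv yL2.
have p := primD (proj1 sv) (primN (proj1 su)).
have := primB p y0 (ltW yx) (ltW xL'); rewrite uvx => H.
have : itg (fun=> bl * ((c' - c) / 2)) y x <= v x + - v x - (v y + - u y).
  rewrite H; apply: itg_le; [exact: L1_cst|by apply: L1S (proj1 p) _ _ => //; exact: ltW|].
  apply: ae_all => t /andP[yt tx].
  have tL : 0 <= t <= L by rewrite (le_trans y0 (ltW yt)) (ltW (lt_trans tx xL')).
  have td : `|t - x| < d by rewrite distrC ger0_norm ?subr_ge0 ?(ltW tx)//; lra.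
  have td' : `|t - x| < d' by rewrite distrC ger0_norm ?subr_ge0 ?(ltW tx)//; lra.
  have h1 := dP t tL td; have h2 := d'P t tL td'; rewrite uvx in h1.
  rewrite /rhs -mulrBr; have /andP[h3 _] := bP t.
  rewrite !ltr_norml in h1 h2.
  by apply: ler_pM => //; [exact: ltW|rewrite divr_ge0// subr_ge0 ltW|lra].
rewrite itg_cst ?(ltW yx)//.
have : 0 < bl * ((c' - c) / 2) * (x - y) by rewrite !mulr_gt0 ?divr_gt0 ?subr_gt0.
lra.
Qed.

Lemma rhs_upper c u t k : f (u t) + c <= k -> k <= 0 ->
  rhs f c u t <= bl * k + bu * `|g t|.
Proof.
move=> fk k0; have /andP[h3 h4] := bP t; have h2 := ler_norm (g t).
apply: (@le_trans _ _ (b t * k + b t * `|g t|)).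
  by rewrite /rhs -mulrDr; apply: ler_wpM2l; [exact: ltW|lra].
by apply: lerD; [exact: ler_wnM2r|exact: ler_wpM2r].
Qed.

(* If [u] is at least [e] somewhere, equicontinuity keeps it above [e / 2] on an
   interval of fixed length, where [f u] is bounded; then [u' <= b (f u + g + c)]
   is very negative for [c] close to [-oo]. *)
Lemma possol_small E e : 0 < e -> exists C, forall c u, c <= C -> possol c u ->
  itg (fun t => rhs f c u t ^+ 2) 0 L <= E -> sqi 0 L (rhs f c u) ->
  forall x, 0 <= x <= L -> u x < e.
Proof.
have arith (e' i1 i2 i3 i4 : R) : i1 <= i3 + i2 -> i2 <= i4 ->
  i3 <= - (e' / 2 + i4 + 1) -> - (e' / 2) <= i1 -> False by move=> *; lra.
move=> e0.
wlog E0 : E / 0 <= E.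
  move=> H; have E'0 : 0 <= Num.max E 0 by rewrite le_max lexx orbT.
  have [C CP] := H _ E'0.
  exists C => c u cC pu uE; apply: CP => //.
  by rewrite le_max uE.
pose G := itg (fun t => `|g t|) 0 L.
have ig := sqi_L1 gP.
have G0 : 0 <= G by apply: itg_ge0; [exact: L1_norm|exact: ae_all].
(* Young with weight [k] bounds the oscillation over a length [r] by [k E + r / k <= e / 2]. *)
pose k := e / (4 * (E + 1)); pose r := k * (e / 4).
have k0 : 0 < k by rewrite divr_gt0// mulr_gt0//; lra.
have r0 : 0 < r by rewrite mulr_gt0// divr_gt0.
(* For [c] below this value, the drop over length [r] beats both the contribution of [g] and the
   permitted oscillation [e / 2]. *)
exists (- f (e / 2) - (e / 2 + bu * G + 1) / (bl * r)).
move=> c u cC pu uE sR x xL.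
rewrite ltNge; apply/negP => ex.
have [su up uL] := pu; have [p u0] := su.
have e20 : 0 < e / 2 by rewrite divr_gt0.
have eq y : 0 <= y -> y <= x -> x - y <= r -> `|u x - u y| <= e / 2.
  move=> y0 yx xyr; have /andP[_ xL'] := xL.
  rewrite (primB p)//; have iR := sqi_L1 sR.
  apply: le_trans (itg_norm (L1S iR y0 xL')) _.
  have sRy := sqiS sR y0 xL'.
  have := itg_young sRy (sqi_cst y x 1) k0; rewrite itg_cst// expr1n mul1r => H.
  under eq_itg do rewrite -[X in `|X|]mulr1.
  apply: le_trans H _.
  have a1 : k * itg (fun t => rhs f c u t ^+ 2) y x <= e / 4.
    rewrite /k mulrAC ler_pdivrMr; last by rewrite mulr_gt0//; lra.
    rewrite (_ : e / 4 * (4 * (E + 1)) = e * (E + 1)); last by field.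
    rewrite ler_wpM2l ?(ltW e0)//; apply: (@le_trans _ _ E); last by lra.
    apply: le_trans uE; apply: itg_le_itv => //; first by case: sR.
    by move=> t; exact: sqr_ge0.
  have a2 : k^-1 * (x - y) <= e / 4 by rewrite ler_pdivrMl.
  lra.
(* Otherwise [0] is within [r] of [x], and [u 0 = 0] forces [u x <= e / 2]. *)
have rx : r <= x.
  rewrite leNgt; apply/negP => xr; have /andP[x0 _] := xL.
  have := eq 0 (lexx 0) x0; rewrite subr0 u0 subr0 => /(_ (ltW xr)).
  by rewrite ger0_norm; lra.
have xr0 : 0 <= x - r by rewrite subr_ge0.
have xrx : x - r <= x by rewrite gerBl ltW.
have /andP[x0 xL'] := xL.
have := eq (x - r) xr0 xrx; rewrite subKr lexx => /(_ isT).
rewrite (primB p)// => H.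
have brr : 0 < bl * r by rewrite mulr_gt0.
have cfe : (f (e / 2) + c) * (bl * r) <= - (e / 2 + bu * G + 1).
  have : f (e / 2) + c <= - ((e / 2 + bu * G + 1) / (bl * r)).
    by rewrite addrC -lerBrDr addrC.
  by rewrite -mulNr ler_pdivlMr.
have fc0 : f (e / 2) + c <= 0.
  have buG : 0 <= bu * G by rewrite mulr_ge0// ltW.
  rewrite leNgt; apply/negP => fc.
  have : 0 < (f (e / 2) + c) * (bl * r) by rewrite mulr_gt0.
  lra.
have : itg (rhs f c u) (x - r) x <=
    itg (fun t => bl * (f (e / 2) + c) + bu * `|g t|) (x - r) x.
  apply: itg_le.
  - exact: L1S (proj1 p) _ _.
  - apply: L1D; first exact: L1_cst.
    by apply: L1Z; apply: L1_norm; exact: L1S ig _ _.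
  apply: ae_all => t /andP[t1 t2].
  have tu : e / 2 <= u t.
    have := eq t (ltW (le_lt_trans xr0 t1)) (ltW t2).
    have tr : x - t <= r by lra.
    by move=> /(_ tr); rewrite ler_norml; lra.
  by apply: rhs_upper => //; rewrite lerD2r; exact: fni.
rewrite itgD; [|exact: L1_cst|]; last first.
  by apply: L1Z; apply: L1_norm; exact: L1S ig _ _.
rewrite itg_cst// itgZ; last by apply: L1_norm; exact: L1S ig _ _.
rewrite subKr => H2.
have gle : bu * itg (fun t => `|g t|) (x - r) x <= bu * G.
  by rewrite ler_wpM2l ?(ltW bu0)//; apply: itg_le_itv => //; exact: L1_norm.
have : - (e / 2) <= itg (rhs f c u) (x - r) x by move: H; rewrite ler_norml => /andP[+ _].
have Efc : bl * (f (e / 2) + c) * r = (f (e / 2) + c) * (bl * r) by ring.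
rewrite Efc in H2.
exact: (arith e _ _ _ _ H2 gle cfe).
Qed.

End SolutionBranch.

(** * The family of all positive solutions and its largest constant *)

Section SolutionFamily.
Variable R : realType.
Local Notation mu := (@lebesgue_measure R).
Implicit Types (u v w : R -> R) (x y z c k s t e d r C E : R).
Variables (L bl bu : R) (b g f : R -> R) (m : R).
Hypotheses (L0 : 0 < L) (bl0 : 0 < bl) (mb : meas 0 L b).
Hypothesis bP : forall x, bl <= b x <= bu.
Hypothesis gP : sqi 0 L g.
Hypothesis gM : forall eta : R, 0 < eta -> eta < L -> exists M : R,
  {ae mu, forall t, 0 < t < L - eta -> - M <= g t}.
Hypothesis mf : measurable_fun setT f.
Hypothesis fm : forall s, 0 < s -> m <= f s.
Hypothesis fni : forall s t, 0 < s -> s <= t -> f t <= f s.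
Hypothesis fcont : forall s, 0 < s -> {for s, continuous f}.
Hypothesis finf : forall k, exists d, 0 < d /\ forall s, 0 < s -> s <= d -> k <= f s.

Local Notation possol := (possol L b g f).

Lemma solution_family : (exists c u, possol c u) ->
  exists (cs : R) (U : R -> R -> R),
  [/\ (cs + m) * (bl * L) <= Num.max 0 (bu * itg (fun t => `|g t|) 0 L),
      forall c, c <= cs -> [/\ possol c (U c), sqi 0 L (f \o U c),
        sqi 0 L (rhs b g f c (U c)) &
        itg (fun t => rhs b g f c (U c) t ^+ 2) 0 L <=
          bu ^+ 2 * itg (fun t => g t ^+ 2) 0 L] &
      forall c u, possol c u -> c <= cs /\ forall x, 0 <= x <= L -> u x = U c x].
Proof.
move=> [c0 [u0 pu0]].
pose adm := admissible L0 bl0 mb bP gP fm.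
pose A := [set c | adm c].
(* Existence of a solution enters here, so that the supremum is that of a nonempty set. *)
have A0 : A !=set0 by exists c0; exact: possol_admissible pu0.
have blL : 0 < bl * L by rewrite mulr_gt0.
have bnd c : adm c -> (c + m) * (bl * L) <= Num.max 0 (bu * itg (fun t => `|g t|) 0 L).
  by move=> ac; exact: (admissible_bound gM mf fni fcont finf ac).
have supA : has_sup A.
  split => //; exists (Num.max 0 (bu * itg (fun t => `|g t|) 0 L) / (bl * L) - m).
  by move=> c /bnd; rewrite lerBrDr ler_pdivlMr.
pose cs := sup A.
have lt_adm c : c < cs -> adm c.
  move=> ccs; have cs0 : 0 < cs - c by rewrite subr_gt0.
  have [c' Ac'] := sup_adherent cs0 supA; rewrite subKr => cc'.
  exact: admissible_le (ltW cc') Ac'.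
have le_adm c : c <= cs -> adm c.
  rewrite le_eqVlt => /predU1P[->|]; last exact: lt_adm.
  apply: admissible_closed => e e0; apply: lt_adm.
  by rewrite gtrBl.
exists cs, (limsol L0 bl0 mb bP gP fm); split.
- exact/bnd/le_adm.
- move=> c /le_adm ac; have [sR sE] := limsol_energy gM mf fni fcont finf ac.
  split => //; first exact: limsol_possol.
  exact: limsol_f_sqi.
- move=> c u pu; have ac := possol_admissible L0 bl0 mb bP gP fm pu; split.
    by apply: ub_le_sup => //; case: supA.
  move=> x xL; apply: (possol_unique bl0 bP fni pu _ xL).
  exact: limsol_possol.
Qed.

End SolutionFamily.

(** * Properties of [phi] and of its finite part *)

Section SingularNonlinearity.
Variable R : realType.
Local Notation mu := (@lebesgue_measure R).
Implicit Types (s t k d x : R).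
Variable phi : R -> \bar R.
Hypotheses (Hphi : H_phi phi) (phi0 : phi 0 = +oo%E).

Let f s := fine (phi s).

Lemma phi_fin s : s != 0 -> phi s = (f s)%:E.
Proof.
move=> s0; have [_ [h1 h2]] := Hphi; rewrite /f fineK// fin_numE h1/=.
by rewrite lt_eqF// h2.
Qed.

Lemma fine_phi_continuous s : s != 0 -> {for s, continuous f}.
Proof.
move=> s0; have [cphi _] := Hphi; have := cphi s.
rewrite /continuous_at (phi_fin s0) => H; exact: (fine_cvg H).
Qed.

Lemma phi_measurable : measurable_fun setT phi.
Proof.
have [cphi _] := Hphi.
apply: (measurability _ (ErealGenOInfty.measurableE R)).
move=> /= _ [_ [y ->]] <-; apply: measurableI => //; apply: open_measurable.
rewrite preimage_itvoy; apply: (open_comp (f := phi) (D := [set z | (y%:E < z)%E])).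
  by move=> x _; exact: cphi.
exact: open_ereal_gt_ereal.
Qed.

Lemma fine_phi_measurable : measurable_fun setT f.
Proof. by apply: measurableT_comp => //; exact: phi_measurable. Qed.

Lemma phi_large k : exists d, 0 < d /\ forall s, `|s| < d -> (k%:E <= phi s)%E.
Proof.
have [cphi _] := Hphi; have := cphi 0; rewrite /continuous_at phi0.
move=> /cvgey_ge/(_ k)/nbhs_ballP[d /= d0 dP]; exists d; split => // s sd.
by apply: dP; rewrite /ball/= sub0r normrN.
Qed.

Lemma fine_phi_large k : exists d, 0 < d /\ forall s, 0 < s -> s <= d -> k <= f s.
Proof.
have [d [d0 dP]] := phi_large k; exists (d / 2); split; first by rewrite divr_gt0.
move=> s s0 sd; rewrite -lee_fin -phi_fin ?gt_eqF//; apply: dP.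
by rewrite gtr0_norm//; lra.
Qed.

(** From below: [phi >= 0] near [0], because it tends to [+oo] there, and [phi] is bounded
    elsewhere. From above: [phi 1] is finite. *)
Lemma phi_inf_fin : H_bdd phi -> ereal_inf (range phi) \is a fin_num.
Proof.
move=> bphi; have [d [d0 dP]] := phi_large 0.
have [M MP] := bphi d d0.
rewrite fin_real//; apply/andP; split; last first.
  apply: (@le_lt_trans _ _ (phi 1)); first by apply: ereal_inf_lbound; exists 1.
  by case: Hphi => _ [_]; apply; rewrite oner_neq0.
apply: (@lt_le_trans _ _ (Num.min 0 (- M))%:E); first exact: ltNyr.
apply: le_ereal_inf_tmp => _ [s _ <-].
have [sd|ds] := ltP `|s| d.
  by apply: le_trans (dP s sd); rewrite lee_fin ge_min lexx.
have := MP s ds; case: (phi s) => [r| |] /=.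
- rewrite !lee_fin ler_norml ge_min => /andP[-> _].
  by rewrite orbT.
- by rewrite leey.
- by rewrite leNgt ltry.
Qed.

End SingularNonlinearity.

(** * Weak solutions of (P) and positive solutions of the integral equation *)

Section WeakSolutions.
Variable R : realType.
Local Notation mu := (@lebesgue_measure R).
Implicit Types (u v w psi : R -> R) (x y z c k s t e d r C E : R).
Variables (L alpha beta : R) (a g : R -> R) (phi : R -> \bar R).
Hypotheses (L0 : 0 < L) (Ha : H_a L alpha beta a) (Hg : L2 L g).
Hypotheses (Hphi : H_phi phi) (phi0 : phi 0 = +oo%E).
Hypothesis HM : forall eta : R, 0 < eta < L -> exists M : R, 0 < M /\
  {ae mu, forall x, x \in `[0%R, L - eta] -> - M <= g x}.

Let f s := fine (phi s).

(** The bounds on [a] hold only a.e.; clipping changes [a] on a null subset of []0, L[] and makes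
    the bounds on [coef] hold everywhere. *)
Definition clip s : R := Num.max alpha (Num.min beta s).
Definition coef x : R := (clip (a x))^-1.

Let alpha0 : 0 < alpha. Proof. by case: Ha. Qed.
Let alpha_beta : alpha < beta. Proof. by case: Ha => _ []. Qed.
Let beta0 : 0 < beta. Proof. exact: lt_trans alpha_beta. Qed.
Let ma : meas 0 L a. Proof. by case: Ha => _ [_ []]. Qed.
Let gP : sqi 0 L g. Proof. exact/L2P. Qed.
Let L0' : 0 <= L. Proof. exact: ltW. Qed.

Lemma clip_itv s : alpha <= clip s <= beta.
Proof.
by rewrite /clip le_max lexx/= ge_max (ltW alpha_beta)/= ge_min lexx.
Qed.

Let clip0 s : 0 < clip s.
Proof. by have /andP[h _] := clip_itv s; exact: lt_le_trans h. Qed.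

Lemma coef_itv x : beta^-1 <= coef x <= alpha^-1.
Proof.
by have /andP[h1 h2] := clip_itv (a x); rewrite /coef !lef_pV2 ?posrE// h1 h2.
Qed.

Let clip_continuous : continuous clip.
Proof.
move=> s; apply: continuous_max; first exact: cvg_cst.
by apply: continuous_min; [exact: cvg_cst|exact: cvg_id].
Qed.

Let mclip : meas 0 L (fun x => clip (a x)).
Proof. exact: (meas_comp clip_continuous ma). Qed.

Lemma coef_meas : meas 0 L coef.
Proof.
apply: (meas_comp (F := fun s => (clip s)^-1)) ma => s.
by apply: cvgV; [rewrite gt_eqF|exact: clip_continuous].
Qed.

Lemma a_clip : {ae mu, forall x, 0 < x < L -> a x = clip (a x)}.
Proof.
have [_ [_ [_ H]]] := Ha; apply: (ae_imply H) => x + /andP[x0 xL].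
rewrite in_itv/= (ltW x0) (ltW xL) => /(_ isT)/andP[h1 h2].
by rewrite /clip (min_idPr h2) (max_idPr h1).
Qed.

Lemma g_lower (eta : R) : 0 < eta -> eta < L -> exists M : R,
  {ae mu, forall t, 0 < t < L - eta -> - M <= g t}.
Proof.
move=> h1 h2; have [|M [_ MP]] := HM (eta := eta); first by rewrite h1.
exists M; apply: (ae_imply MP) => t + /andP[t0 tL]; apply.
by rewrite in_itv/= !ltW.
Qed.

Local Notation rhs := (rhs coef g).
Local Notation possol := (possol L coef g f).

Let eq_integral_ae (p q : R -> R) : meas 0 L p -> meas 0 L q ->
  {ae mu, forall t, 0 < t < L -> p t = q t} ->
  (\int[mu]_(x in `[0%R, L]) (p x)%:E = \int[mu]_(x in `[0%R, L]) (q x)%:E)%E.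
Proof.
move=> mp mq /ae_closed pq; apply: ae_eq_integral => //.
- by apply/measurable_EFinP; exact: mp.
- by apply/measurable_EFinP; exact: mq.
- by apply: (ae_imply pq) => t /= H; rewrite in_itv/= => tL; rewrite H.
Qed.

Let mpsi psi : test_fun L psi -> meas 0 L psi.
Proof. by move=> tp; apply: econt_meas; apply: econtT; exact: test_fun_cont tp. Qed.

Let mdpsi psi : test_fun L psi -> meas 0 L (derive1 psi).
Proof.
by move=> tp; apply: econt_meas; apply: econtT; exact: test_fun_derive1_cont tp.
Qed.

Let a_rhs c u : {ae mu, forall t, 0 < t < L -> a t * rhs f c u t = f (u t) + g t + c}.
Proof.
apply: (ae_imply a_clip) => t H tL; rewrite /rhs /coef {1}(H tL).
by rewrite mulrA mulfV ?mul1r// gt_eqF.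
Qed.

Let f_phi u : (forall x, 0 < x < L -> 0 < u x) ->
  forall t, 0 < t < L -> phi (u t) = (f (u t))%:E.
Proof. by move=> u0 t tL; rewrite (phi_fin Hphi)// gt_eqF// u0. Qed.

Lemma possol_H10 c u : possol c u -> sqi 0 L (rhs f c u) ->
  H10 L u /\ weak_deriv L u (rhs f c u).
Proof.
move=> [[p u0] up uL] sR; have cu := prim_econt p.
have wd := prim_weak_deriv L0 p sR; split => //.
split; first exact/within_econt.
by split => //; split => //; split; [apply/L2P; exact: sqi_econt|exists (rhs f c u)].
Qed.

Lemma possol_weak_eq c u psi : possol c u -> sqi 0 L (rhs f c u) ->
  sqi 0 L (f \o u) -> test_fun L psi ->
  (\int[mu]_(x in `[0%R, L]) (a x * rhs f c u x * psi x)%:E =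
   \int[mu]_(x in `[0%R, L]) ((f (u x) + g x + c) * psi x)%:E)%E.
Proof.
move=> pu [mR _] [mfu _] tp; apply: eq_integral_ae.
- by apply: measM; [exact: measM|exact: mpsi].
- apply: measM; last exact: mpsi.
  by apply: measD; [apply: measD => //; case: gP|exact: meas_cst].
by apply: (ae_imply (a_rhs c u)) => t H tL; rewrite H.
Qed.

Lemma possol_weak_sol c u : possol c u -> sqi 0 L (rhs f c u) ->
  sqi 0 L (f \o u) -> weak_sol L a g phi u.
Proof.
move=> pu sR sf; have [hu wd] := possol_H10 pu sR; have [_ up _] := pu.
have [[p _] _ _] := pu; have cu := prim_econt p.
split => //; split.
  have mphi : measurable_fun `[0%R, L] (fun x => phi (u x)).
    by apply: measurableT_comp; [exact: phi_measurable|exact: econt_meas cu].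
  split => //.
  rewrite (@ae_eq_integral _ _ _ mu `[0%R, L]%classic (fun x => (f (u x) ^+ 2)%:E)) //.
  - have [_ i2] := sf; rewrite -(itgE i2); exact: ltry.
  - exact: emeasurable_funM.
  - by apply/measurable_EFinP; apply: measurable_funX; case: sf.
  have := ae_closed (ae_all (f_phi up)); move=> H; apply: (ae_imply H) => t /= h.
  by rewrite in_itv/= => /h ->; rewrite -EFinM.
exists (rhs f c u); split => // psi tp.
have [mR _] := sR; have [mfu _] := sf.
have ifg : L1 0 L (fun t => f (u t) + g t) by apply: L1D; exact: sqi_L1.
rewrite (@eq_integral_ae _ (fun x => (f (u x) + g x + c) * derive1 psi x)); last 3 first.
- by apply: measM; [exact: measM|exact: mdpsi].
- apply: measM; last exact: mdpsi.
  by apply: measD; [exact: L1_meas|exact: meas_cst].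
- by apply: (ae_imply (a_rhs c u)) => t H tL; rewrite H.
have i1 : L1 0 L (fun x => (f (u x) + g x) * derive1 psi x).
  exact: L1_test_fun_derive1.
have i2 : L1 0 L (fun x => c * derive1 psi x).
  by apply: L1Z; exact: (proj1 (test_fun_prim L0 tp)).
have i3 : L1 0 L (fun x => (f (u x) + g x + c) * derive1 psi x).
  by apply: L1_test_fun_derive1 => //; apply: L1D => //; exact: L1_cst.
rewrite -(itgE i1) -(itgE i3); congr EFin.
under eq_itg do rewrite mulrDl.
rewrite itgD// itgZ; last exact: (proj1 (test_fun_prim L0 tp)).
(* The constant is invisible in (P), since [psi'] has zero integral. *)
by rewrite (itg_test_fun L0 tp) mulr0 addr0.
Qed.

(** [fine] is [0] at infinite values, so [f(u)^2 <= phi(u)^2]; integrability of the latter excludes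
    infinite values a.e. *)
Lemma phi_L2_sqi u : phi_L2 L phi u ->
  sqi 0 L (f \o u) /\ {ae mu, forall t, 0 < t < L -> phi (u t) = (f (u t))%:E}.
Proof.
move=> [mphi lt]; have ge0 t : (0 <= phi (u t) * phi (u t))%E.
  by case: (phi (u t)) => [r| |]//; rewrite -EFinM lee_fin -expr2 sqr_ge0.
have ip : mu.-integrable `[0%R, L] (fun t => phi (u t) * phi (u t))%E.
  apply/integrableP; split; first exact: emeasurable_funM.
  by under eq_integral do rewrite gee0_abs//.
have mfu : meas 0 L (f \o u).
  by apply: (measurableT_comp (f := fine)) => //; exact: fine_measurable.
split.
  split => //; apply/integrableP; split.
    by apply/measurable_EFinP; exact: measurable_funX.
  apply: le_lt_trans lt; apply: ge0_le_integral => //.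
  - do 2 apply: measurableT_comp => //.
    exact: measurable_funX.
  - exact: emeasurable_funM.
  move=> t _; rewrite /= ger0_norm ?sqr_ge0// /f.
  by case: (phi (u t)) => [r| |] /=; rewrite ?expr0n/= ?mulyy ?mulNyNy ?leey// expr2 EFinM.
have H : {ae mu, forall t, `[0%R, L]%classic t ->
    (phi (u t) * phi (u t))%E \is a fin_num} by exact: integrable_ae.
apply: (ae_imply H) => t + /andP[t0 tL]; rewrite /= in_itv/= !ltW// => /(_ isT).
by rewrite /f; case: (phi (u t)) => [r| |].
Qed.

(** Du Bois-Reymond provides [c]. The sign of [u] is not known beforehand, so positivity is obtained
    from the barrier [k x] by looking only at points where [0 < k x - u < d / 2]: there [|u| < d],
    and [phi] is large on both sides of [0]. *)
Lemma weak_sol_possol u : weak_sol L a g phi u -> exists c, possol c u.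
Proof.
move=> [[/within_econt cu [u0 [uL [_ _]]]] [/phi_L2_sqi[sf phif] [w [wd eqn]]]].
have pw := weak_deriv_prim L0 cu wd.
have sw : sqi 0 L w by case: wd => /L2P.
have scw : sqi 0 L (fun t => clip (a t) * w t).
  apply: (sqiM (k := beta)) => // t _; rewrite ger0_norm ?(ltW (clip0 _))//.
  by case/andP : (clip_itv (a t)).
have ifg : L1 0 L (fun t => f (u t) + g t) by apply: L1D; exact: sqi_L1.
have icw := sqi_L1 scw.
have [|psi tp|c cP] := @du_Bois_Reymond R L
    (fun t => clip (a t) * w t - (f (u t) + g t)) L0.
- exact: L1B.
- have := eqn psi tp.
  have i1 := L1_test_fun_derive1 L0 tp ifg; have i2 := L1_test_fun_derive1 L0 tp icw.
  rewrite (@eq_integral_ae _ (fun t => clip (a t) * w t * derive1 psi t)); last 3 first.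
  + by apply: measM; [apply: measM => //; case: sw|exact: mdpsi].
  + exact: L1_meas.
  + by apply: (ae_imply a_clip) => t H tL; rewrite {1}(H tL).
  rewrite -(itgE i1) -(itgE i2) => -[E].
  under eq_itg do rewrite mulrBl.
  by rewrite itgB// E subrr.
exists c.
have sR : sqi 0 L (rhs f c u).
  apply: (@rhs_sqi R L beta^-1 alpha^-1) sf => //.
  - by rewrite invr_gt0.
  - exact: coef_meas.
  - exact: coef_itv.
have wR : {ae mu, forall t, 0 < t < L -> w t = rhs f c u t}.
  apply: (ae_imply cP) => t H tL; rewrite /rhs /coef -(H tL).
  by field; rewrite gt_eqF.
have p : prim 0 L u (rhs f c u).
  split; first exact: sqi_L1.
  move=> x xL; rewrite (proj2 pw x xL); congr (_ + _); have /andP[x0 xL'] := xL.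
  apply: eq_itg_ae; [by apply: L1S (proj1 pw) _ _|by apply: L1S (sqi_L1 sR) _ _|].
  by apply: (ae_imply wR) => t H /andP[t0 tx]; apply: H; rewrite t0 (lt_le_trans tx).
split => // x /andP[x0 xL].
(* Keeps [x] inside [[0, L - eta]], where [g] is bounded below. *)
pose eta := (L - x) / 2.
have eta0 : 0 < eta by rewrite divr_gt0// subr_gt0.
have etaL : eta < L by rewrite /eta; lra.
have [M MP] := g_lower eta0 etaL.
have [d [d0 dP]] := phi_large Hphi phi0 (M + `|c| + 1).
pose k := Num.min beta^-1 (d / 2 / L).
have k0 : 0 < k by rewrite lt_min invr_gt0 beta0 !divr_gt0.
have Leta : L - eta <= L by rewrite gerBl ltW.
have Leta0 : 0 <= L - eta by rewrite subr_ge0 ltW.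
have p' := primD (prim_lin 0 (L - eta) k) (primN (primS p (lexx 0) Leta0 Leta)).
have xLe : 0 <= x <= L - eta by rewrite (ltW x0)/= /eta; lra.
suff : k * x + - u x <= 0.
  by move=> H; have : 0 < k * x by [rewrite mulr_gt0]; lra.
apply: (prim_le0 p' _ (_ : 0 < d / 2)) xLe; first by rewrite u0; lra.
  by rewrite divr_gt0.
apply: (ae_imply (ae_and MP phif)) => t [+ +] tL => /(_ tL) Mt.
have /andP[t0 tL'] := tL.
have tL2 : 0 < t < L by rewrite t0 (lt_le_trans tL').
move=> /(_ tL2) phit /andP[ut ut'].
have kt : k * t <= d / 2.
  apply: (@le_trans _ _ (d / 2 / L * L)); last by rewrite divfK// gt_eqF.
  apply: ler_pM; rewrite ?(ltW k0) ?(ltW t0)// ?ge_min ?lexx ?orbT//.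
  by case/andP : tL2 => _ /ltW.
have kt0 : 0 < k * t by rewrite mulr_gt0.
have : `|u t| < d by rewrite ltr_norml; apply/andP; split; lra.
move=> /dP; rewrite phit lee_fin => ft.
have h2 := ler_norm (- c); rewrite normrN in h2.
rewrite subr_le0; apply: (@le_trans _ _ (beta^-1 * 1)).
  by rewrite mulr1 ge_min lexx.
have /andP[bt1 _] := coef_itv t.
by apply: ler_pM => //; [rewrite invr_ge0 ltW|rewrite /=; lra].
Qed.

End WeakSolutions.

(** * Cauchy-Schwarz bound and assembly *)

(** Nonnegativity of the variance of [|g|]; [k] is its mean value. *)
Lemma itg_norm_sqrt (R : realType) (L : R) (g : R -> R) : 0 < L -> sqi 0 L g ->
  itg (fun t => `|g t|) 0 L <= Num.sqrt L * Num.sqrt (itg (fun t => g t ^+ 2) 0 L).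
Proof.
move=> L0 sg; have ig := L1_norm (sqi_L1 sg); have [_ i2] := sg.
set G := itg (fun t => `|g t|) 0 L; pose k := G / L.
have G0 : 0 <= G by apply: itg_ge0 => //; exact: ae_all.
have ic : L1 0 L (fun=> k ^+ 2) by exact: L1_cst.
have i3 : L1 0 L (fun t => g t ^+ 2 - 2 * k * `|g t|) by apply: L1B => //; exact: L1Z.
have : 0 <= itg (fun t => g t ^+ 2 - 2 * k * `|g t| + k ^+ 2) 0 L.
  apply: itg_ge0; first exact: L1D.
  apply: ae_all => t _; rewrite -[g t ^+ 2]real_normK ?num_real//.
  by have := sqr_ge0 (`|g t| - k); rewrite sqrrB; lra.
rewrite itgD// itgB//; last exact: L1Z.
rewrite itgZ// itg_cst ?(ltW L0)// subr0 -/G.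
set S := itg (fun t => g t ^+ 2) 0 L => H.
have GS : G ^+ 2 <= L * S.
  have : 0 <= L * (S - 2 * k * G + k ^+ 2 * L) by rewrite mulr_ge0// ltW.
  have -> : L * (S - 2 * k * G + k ^+ 2 * L) = L * S - G ^+ 2.
    by rewrite /k; field; rewrite gt_eqF.
  by rewrite subr_ge0.
rewrite -sqrtrM ?(ltW L0)// -[leLHS]ger0_norm// -sqrtr_sqr.
by apply: ler_wsqrtr.
Qed.

Theorem mainTheorem8 (R : realType) (L alpha beta : R) (a g : R -> R)
    (phi : R -> \bar R) :
  0 < L ->
  H_a L alpha beta a ->
  L2 L g ->
  H_phi phi -> phi 0 = +oo%E -> H_int phi -> H_bdd phi ->
  (forall s t : R, 0 <= s -> s <= t -> (phi t <= phi s)%E) ->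
  (forall eta : R, 0 < eta < L -> exists M : R, 0 < M /\
     {ae (@lebesgue_measure R), forall x, x \in `[0%R, L - eta] -> - M <= g x}) ->
  (exists u, weak_sol L a g phi u) ->
  exists (cstar : R) (U : R -> R -> R) (dU : R -> R -> R),
    (cstar%:E <= ((Num.sqrt L)^-1 * (beta / alpha + 1) * L2norm L g)%:E
                 - ereal_inf (range phi))%E /\
    (* U(c) in H^1_0 with weak derivative dU(c) *)
    (forall c, c <= cstar -> H10 L (U c) /\ weak_deriv L (U c) (dU c)) /\
    (* continuity of U for the weak topology of H^1_0 *)
    (forall v dv, H10 L v -> weak_deriv L v dv ->
       {within `]-oo, cstar], continuous (fun c => H1inner L (U c) (dU c) v dv)}) /\
    (forall c, c <= cstar ->
       weak_sol L a g phi (U c) /\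
       (forall psi, test_fun L psi ->
          (\int[@lebesgue_measure R]_(x in `[0%R, L]) (a x * dU c x * psi x)%:E =
           \int[@lebesgue_measure R]_(x in `[0%R, L])
              ((fine (phi (U c x)) + g x + c) * psi x)%:E)%E) /\
       (forall x, x \in `[0%R, L] -> 0 <= U c x)) /\
    (forall c1 c2, c1 < c2 -> c2 <= cstar ->
       forall x, x \in `]0%R, L[ -> U c1 x < U c2 x) /\
    (* U(c) -> 0 weakly in H^1_0 as c -> -oo *)
    (forall v dv, H10 L v -> weak_deriv L v dv ->
       (fun c => H1inner L (U c) (dU c) v dv) @ -oo --> (0 : R)) /\
    (* U(c) -> 0 uniformly on [0,L] as c -> -oo *)
    (forall eps : R, 0 < eps -> exists C : R, forall c, c <= C -> c <= cstar ->
       forall x, x \in `[0%R, L] -> `|U c x| < eps) /\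
    (forall u, weak_sol L a g phi u ->
       exists c, c <= cstar /\ forall x, x \in `[0%R, L] -> u x = U c x).
Proof.
move=> L0 Ha Hg Hphi phi0 _ bphi mono HM [u0 /(weak_sol_possol L0 Ha Hg Hphi phi0 HM)[c0 pu0]].
have gP : sqi 0 L g by exact/L2P.
have [alpha0 [ab _]] := Ha; have beta0 : 0 < beta by exact: lt_trans ab.
pose f s := fine (phi s); pose b := coef alpha beta a.
have bP x : beta^-1 <= b x <= alpha^-1 by exact: coef_itv Ha x.
have bl0 : 0 < beta^-1 by rewrite invr_gt0.
have phif s : 0 < s -> phi s = (f s)%:E by move=> s0; rewrite (phi_fin Hphi)// gt_eqF.
have infE := phi_inf_fin Hphi phi0 bphi.
pose m := fine (ereal_inf (range phi)).
have fm s : 0 < s -> m <= f s.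
  by move=> s0; rewrite -lee_fin fineK// -phif//; apply: ereal_inf_lbound; exists s.
have fni s t : 0 < s -> s <= t -> f t <= f s.
  move=> s0 st; rewrite -lee_fin -!phif// ?(lt_le_trans s0)//.
  by apply: mono => //; exact: ltW.
have fcont s : 0 < s -> {for s, continuous f}.
  by move=> s0; apply: fine_phi_continuous => //; rewrite gt_eqF.
have [cs [U [csb UP Uuniq]]] := solution_family L0 bl0 (coef_meas Ha) bP gP
  (g_lower HM) (fine_phi_measurable Hphi) fm fni fcont (fine_phi_large Hphi phi0)
  (ex_intro _ c0 (ex_intro _ u0 pu0)).
pose dU c := rhs b g f c (U c).
pose E := alpha^-1 ^+ 2 * itg (fun t => g t ^+ 2) 0 L.
have LL : 0 <= L <= L by rewrite lexx ltW.
have dUprim c x : c <= cs -> 0 <= x <= L -> itg (dU c) 0 x = U c x.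
  by move=> /UP[[sU _ _] _ _ _] xL; rewrite (solE sU xL).
have inner c v dv : c <= cs -> H10 L v -> weak_deriv L v dv ->
    H1inner L (U c) (dU c) v dv =
    itg (fun t => U c t * v t) 0 L + itg (fun t => dU c t * dv t) 0 L.
  move=> /UP[[sU _ _] _ sR _] [_ [_ [_ [/L2P sv _]]]] [/L2P sdv _].
  rewrite -itgD; [by []| |exact: sqi_L1M].
  by apply: sqi_L1M => //; apply: sqi_econt; [exact: ltW|exact: sol_econt sU].
(* Uniform convergence of [U c] suffices for weak convergence in H1, because the bound [E] on the
   derivatives is uniform in [c]. Used along [c -> c1] within the half-line and along [c -> -oo]. *)
have weak (F : set_system R) (FF : Filter F) (c1 : R) (v dv : R -> R) : H10 L v -> weak_deriv L v dv ->
    (\forall c \near F, c <= cs) -> forall V dV, econt 0 L V -> sqi 0 L dV ->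
    (forall x, 0 <= x <= L -> itg dV 0 x = V x) ->
    (forall e, 0 < e -> \forall c \near F, forall x, 0 <= x <= L -> `|U c x - V x| <= e) ->
    H1inner L (U c) (dU c) v dv @[c --> F] -->
      itg (fun t => V t * v t) 0 L + itg (fun t => dV t * dv t) 0 L.
  move=> Hv wv Fcs V dV cV sdV pV UV.
  have [_ [_ [_ [/L2P sv _]]]] := Hv; have [/L2P sdv _] := wv.
  have sV : sqi 0 L V by apply: sqi_econt => //; exact: ltW.
  apply/cvgrPdist_le => e e0; have e20 : 0 < e / 2 by rewrite divr_gt0.
  pose K := itg (fun t => `|v t|) 0 L.
  have K0 : 0 <= K.
    by apply: itg_ge0; [exact/L1_norm/sqi_L1|exact: ae_all].
  have H1 : \forall c \near F, `|itg (fun t => (dU c t - dV t) * dv t) 0 L| <= e / 2.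
    apply: (@weak_cvg0 R R F FF (fun c t => dU c t - dV t) L
      (2 * E + 2 * itg (fun t => dV t ^+ 2) 0 L) dv L0 _ _ sdv _ e20).
      apply: filterS Fcs => c /UP[_ _ sR leE].
      have sD : sqi 0 L (fun t => dU c t - dV t) by apply: sqiD => //; exact: sqiN.
      split => //; have [_ i1] := sR; have [_ i2] := sdV.
      apply: (@le_trans _ _ (itg (fun t => 2 * dU c t ^+ 2 + 2 * dV t ^+ 2) 0 L)).
        apply: itg_le; [by case: sD|by apply: L1D; exact: L1Z|].
        by apply: ae_all => t _; have := sqr_ge0 (dU c t + dV t); nra.
      rewrite itgD; [|exact: L1Z|exact: L1Z].
      by rewrite (itgZ 2 i1) (itgZ 2 i2) lerD2r ler_wpM2l.
    move=> r r0; move: Fcs (UV r r0); apply: filterS2 => c ccs H x xL.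
    have [_ _ sR _] := UP c ccs; have /andP[x0 xL'] := xL.
    rewrite itgB; last 2 first.
    - exact: L1S (sqi_L1 sR) _ _.
    - exact: L1S (sqi_L1 sdV) _ _.
    by rewrite dUprim// pV//; exact: H.
  have K1 : 0 < K + 1 by rewrite ltr_wpDl.
  move: Fcs H1 (UV _ (divr_gt0 e20 K1)); apply: filterS3 => c ccs h1 h2.
  have [[sU _ _] _ sR _] := UP c ccs.
  have sUc : sqi 0 L (U c) by apply: sqi_econt; [exact: ltW|exact: sol_econt sU].
  have sUV : sqi 0 L (fun t => U c t - V t) by apply: sqiD => //; exact: sqiN.
  have h3 : `|itg (fun t => (U c t - V t) * v t) 0 L| <= e / 2.
    under eq_itg do rewrite mulrC.
    apply: le_trans (itg_mul_le L0 sv sUV h2) _; rewrite -/K.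
    rewrite mulrAC ler_pdivrMr// ler_wpM2l ?(ltW e20)//.
    by rewrite lerDl.
  rewrite inner//; move: h1 h3.
  under eq_itg do rewrite mulrBl.
  rewrite (itgB (sqi_L1M sR sdv) (sqi_L1M sdV sdv)) => h1.
  under eq_itg do rewrite mulrBl.
  rewrite (itgB (sqi_L1M sUc sv) (sqi_L1M sV sv)) => h3.
  move: h1 h3; rewrite !ler_norml => /andP[h1 h1'] /andP[h3 h3'].
  by apply/andP; split; lra.
exists cs, U, dU; split; [|split; [|split; [|split; [|split; [|split; [|split]]]]]].
- rewrite -(fineK infE) -/m -EFinB lee_fin lerBrDr.
  have G0 : 0 <= L2norm L g by exact: sqrtr_ge0.
  have S0 : 0 <= (Num.sqrt L)^-1 by rewrite invr_ge0 sqrtr_ge0.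
  have Eg : L2norm L g = Num.sqrt (itg (fun t => g t ^+ 2) 0 L) by [].
  have blL : 0 < beta^-1 * L by rewrite mulr_gt0.
  have r0 : 0 <= (Num.sqrt L)^-1 * (beta / alpha + 1) * L2norm L g.
    by rewrite !mulr_ge0// addr_ge0// divr_ge0// ltW.
  rewrite -(ler_pM2r blL); apply: le_trans csb _; rewrite ge_max; apply/andP; split.
    by rewrite mulr_ge0// ltW.
  have sL : 0 < Num.sqrt L by rewrite sqrtr_gt0.
  (* Once multiplied by [beta^-1 L], the claimed bound reads [(alpha^-1 + beta^-1) sqrt L |g|_2].
     Cauchy-Schwarz applied to the integral bound yields its first summand. *)
  apply: (@le_trans _ _ (alpha^-1 * (Num.sqrt L * L2norm L g))).
    by rewrite ler_wpM2l ?invr_ge0 ?(ltW alpha0)// Eg; exact: itg_norm_sqrt.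
  have -> : (Num.sqrt L)^-1 * (beta / alpha + 1) * L2norm L g * (beta^-1 * L) =
    (alpha^-1 + beta^-1) * (Num.sqrt L * L2norm L g).
    have arith (s N : R) : s != 0 -> s^-1 * (beta / alpha + 1) * N * (beta^-1 * (s * s)) =
        (alpha^-1 + beta^-1) * (s * N).
      by move=> s0; field; rewrite s0 !gt_eqF.
    rewrite -arith ?gt_eqF//; congr (_ * (_ * _)).
    by rewrite -expr2 sqr_sqrtr ?ltW.
  by rewrite mulrDl lerDl !mulr_ge0// ?invr_ge0 ltW.
- by move=> c /UP[pU _ sR _]; exact: possol_H10 pU sR.
- move=> v dv Hv wv; apply/subspace_continuousP => c1 /=; rewrite in_itv/= => c1cs.
  have [[sU _ _] _ sR _] := UP c1 c1cs.
  suff H : (fun c => H1inner L (U c) (dU c) v dv) @ within [set` `]-oo, cs]] (nbhs c1) -->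
      H1inner L (U c1) (dU c1) v dv by exact: H.
  rewrite (inner c1 v dv c1cs Hv wv).
  apply: weak => //.
  + by rewrite /within/=; apply/nbhs_ballP; exists 1 => //= c _; rewrite in_itv.
  + exact: sol_econt sU.
  + by move=> x xL; exact: dUprim.
  move=> e e0; rewrite /within/=; apply/nbhs_ballP.
  have aL : 0 < alpha^-1 * L by rewrite mulr_gt0// invr_gt0.
  (* [U] is Lipschitz in [c] for the supremum norm, with constant [alpha^-1 L]. *)
  exists (e / (alpha^-1 * L)) => /=; first exact: divr_gt0.
  move=> c; rewrite /ball/= ltr_pdivlMr// => /ltW cc; rewrite in_itv/= => ccs x xL.
  have [pU _ _ _] := UP c ccs; have [pU1 _ _ _] := UP c1 c1cs.
  have bnd r : 0 <= r -> alpha^-1 * r * x <= r * (alpha^-1 * L).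
    move=> r0; rewrite (mulrC alpha^-1) -mulrA ler_wpM2l//.
    by rewrite ler_wpM2l ?invr_ge0 ?(ltW alpha0)//; case/andP : xL.
  have [le|/ltW le] := leP c c1.
    have /andP[k1 k2] := possol_lec bl0 bP fni le pU pU1 xL.
    rewrite distrC ger0_norm ?subr_ge0//.
    move: cc; rewrite ger0_norm ?subr_ge0// => cc.
    by have := bnd (c1 - c); rewrite subr_ge0 => /(_ le); lra.
  have /andP[k1 k2] := possol_lec bl0 bP fni le pU1 pU xL.
  rewrite ger0_norm ?subr_ge0//.
  move: cc; rewrite distrC ger0_norm ?subr_ge0// => cc.
  by have := bnd (c - c1); rewrite subr_ge0 => /(_ le); lra.
- move=> c ccs; have [pU sf sR _] := UP c ccs; split.
    exact: (possol_weak_sol L0 Ha Hg Hphi pU sR sf).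
  split; first by move=> psi tp; exact: (possol_weak_eq Ha Hg pU sR sf tp).
  by move=> x; rewrite in_itv/=; exact: possol_ge0 pU.
- move=> c1 c2 cc c2cs x; rewrite in_itv/= => xL.
  have [pU1 _ _ _] := UP c1 (le_trans (ltW cc) c2cs); have [pU2 _ _ _] := UP c2 c2cs.
  exact: (possol_lt bl0 bP fni fcont cc pU1 pU2 xL).
- move=> v dv Hv wv.
  have Z (w : R -> R) : itg (fun t => 0 * w t) 0 L = 0.
    rewrite (eq_itg (w' := fun=> 0)); last by move=> t _; rewrite mul0r.
    by rewrite itg_cst ?mul0r// ltW.
  (* The limit profile is zero; its uniform convergence comes from [possol_small]. *)
  have := weak -oo _ 0 v dv Hv wv _ (fun=> 0) (fun=> 0).
  rewrite !Z addr0; apply.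
  + by apply: nbhs_ninfty_le; exact: num_real.
  + exact/econtT/cst_continuous.
  + exact: sqi_cst.
  + by move=> x /andP[x0 _]; rewrite itg_cst// mul0r.
  move=> e e0; have [C CP] := possol_small bl0 bP gP fni E e0.
  near=> c => x xL; have ccs : c <= cs.
    by near: c; apply: nbhs_ninfty_le; exact: num_real.
  have cC : c <= C by near: c; apply: nbhs_ninfty_le; exact: num_real.
  have [pU _ sR sE] := UP c ccs.
  by rewrite subr0 ger0_norm ?(possol_ge0 pU)// ltW// (CP c).
- move=> e e0; have [C CP] := possol_small bl0 bP gP fni E e0.
  exists C => c cC ccs x; rewrite in_itv/= => xL; have [pU _ sR sE] := UP c ccs.
  by rewrite ger0_norm ?(possol_ge0 pU)// (CP c).
- move=> u /(weak_sol_possol L0 Ha Hg Hphi phi0 HM)[c pu].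
  by have [ccs uU] := Uuniq c u pu; exists c; split => // x; rewrite in_itv; exact: uU.
Unshelve. all: by end_near. Qed.
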